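(* The group $\Gamma_1=\langle x,y,t\mid txt^{-1}=[x,y]\rangle$ admits a free isometric action on a $\mathbb{Z}^2$-tree and is virtually special (and hence virtually residually torsion-free nilpotent), but is not residually nilpotent.
   Context: $[x,y]=x^{-1}y^{-1}xy$. $\mathbb{Z}^2$ has the lexicographic order. For a linearly ordered abelian group $\Lambda$, a $\Lambda$-tree is a $\Lambda$-metric space (a set with a $\Lambda$-valued function satisfying the metric axioms) in which any two points are endpoints of a segment (an isometric image of an interval of $\Lambda$), two segments with a common endpoint meet in a segment, and two segments meeting in exactly one point, an endpoint of both, have union a segment. An action by isometries is free if the stabiliser of every point and of every closed segment is trivial. Virtually special means having a finite index subgroup that is the fundamental group of a special cube complex in the sense of Haglund and Wise. *)

(* Defs.v *)
From HB Require Import structures.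
From Stdlib Require Import Relation_Operators.
From mathcomp Require Import all_boot all_order all_algebra.
From mathcomp Require Import generic_quotient.
From mathcomp Require Import boolp classical_sets.

Set Implicit Arguments.
Unset Strict Implicit.
Unset Printing Implicit Defensive.

Import Order.TTheory GRing.Theory Num.Theory.

Local Open Scope classical_set_scope.
Local Open Scope group_scope.
Local Open Scope quotient_scope.

(** * Quotient groups *)

(* A monoid with an operation [pg_inv] that is an inverse only up to the
   equivalence relation generated by [pg_step]. *)
Record preGroup := PreGroup {
  pg_sort :> choiceType;
  pg_step : pg_sort -> pg_sort -> Prop;
  pg_one : pg_sort;
  pg_mul : pg_sort -> pg_sort -> pg_sort;
  pg_inv : pg_sort -> pg_sort;
  pg_mulA : associative pg_mul;
  pg_mul1 : left_id pg_one pg_mul;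
  pg_mulr1 : right_id pg_one pg_mul;
  pg_stepl : forall a b c, pg_step a b -> pg_step (pg_mul c a) (pg_mul c b);
  pg_stepr : forall a b c, pg_step a b -> pg_step (pg_mul a c) (pg_mul b c);
  pg_mulV : forall a,
    clos_refl_sym_trans _ pg_step (pg_mul (pg_inv a) a) pg_one;
  pg_mulrV : forall a,
    clos_refl_sym_trans _ pg_step (pg_mul a (pg_inv a)) pg_one
}.

Section QuotientGroup.
Variable P : preGroup.

Definition pg_eqv (a b : P) : bool :=
  `[< clos_refl_sym_trans _ (@pg_step P) a b >].

Lemma pg_eqv_refl : reflexive pg_eqv.
Proof. by move=> a; apply/asboolP; exact: rst_refl. Qed.

Lemma pg_eqv_sym : symmetric pg_eqv.
Proof. by move=> a b; apply/asboolP/asboolP; exact: rst_sym. Qed.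

Lemma pg_eqv_trans : transitive pg_eqv.
Proof.
by move=> b a c /asboolP ab /asboolP bc; apply/asboolP; exact: rst_trans ab bc.
Qed.

Canonical pg_equiv_rel := EquivRel pg_eqv pg_eqv_refl pg_eqv_sym pg_eqv_trans.

Definition quo := {eq_quot pg_equiv_rel}.
HB.instance Definition _ := Choice.copy quo {eq_quot pg_equiv_rel}.

Definition cls (a : P) : quo := \pi_{eq_quot pg_equiv_rel} a.

Lemma cls_eq a b : cls a = cls b <-> clos_refl_sym_trans _ (@pg_step P) a b.
Proof.
split=> [/eqP | ab]; first by rewrite eqmodE => /asboolP.
by apply/eqP; rewrite eqmodE; apply/asboolP.
Qed.

Lemma clsK (x : quo) : cls (repr x) = x.
Proof. exact: reprK. Qed.

Lemma pg_mul_eqv (a a' b b' : P) :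
  clos_refl_sym_trans _ (@pg_step P) a a' ->
  clos_refl_sym_trans _ (@pg_step P) b b' ->
  clos_refl_sym_trans _ (@pg_step P) (pg_mul a b) (pg_mul a' b').
Proof.
move=> aa' bb'; apply: (@rst_trans _ _ _ (pg_mul a' b)).
  elim: aa' => [x y xy|x|x y _ IH|x y z _ xy _ yz].
  - by apply: rst_step; exact: pg_stepr.
  - exact: rst_refl.
  - exact: rst_sym.
  - exact: rst_trans xy yz.
elim: bb' => [x y xy|x|x y _ IH|x y z _ xy _ yz].
- by apply: rst_step; exact: pg_stepl.
- exact: rst_refl.
- exact: rst_sym.
- exact: rst_trans xy yz.
Qed.

Definition quo_mul : quo -> quo -> quo :=
  locked (fun x y => cls (pg_mul (repr x) (repr y))).
Definition quo_one : quo := cls (pg_one P).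
Definition quo_inv : quo -> quo := locked (fun x => cls (pg_inv (repr x))).

Lemma repr_cls a : clos_refl_sym_trans _ (@pg_step P) (repr (cls a)) a.
Proof. by apply/cls_eq; rewrite clsK. Qed.

Lemma cls_mul a b : quo_mul (cls a) (cls b) = cls (pg_mul a b).
Proof. by rewrite /quo_mul -lock; apply/cls_eq; apply: pg_mul_eqv; exact: repr_cls. Qed.

Lemma quo_mulA : associative quo_mul.
Proof.
move=> x y z; rewrite -(clsK x) -(clsK y) -(clsK z).
by rewrite !cls_mul pg_mulA.
Qed.

Lemma quo_mul1 : left_id quo_one quo_mul.
Proof. by move=> x; rewrite -(clsK x) cls_mul pg_mul1. Qed.

Lemma quo_mulr1 : right_id quo_one quo_mul.
Proof. by move=> x; rewrite -(clsK x) cls_mul pg_mulr1. Qed.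

Lemma quo_mulV : left_inverse quo_one quo_inv quo_mul.
Proof.
by move=> x; rewrite -{2}(clsK x) /quo_inv -lock cls_mul; apply/cls_eq; exact: pg_mulV.
Qed.

Lemma quo_mulrV : right_inverse quo_one quo_inv quo_mul.
Proof.
by move=> x; rewrite -{1}(clsK x) /quo_inv -lock cls_mul; apply/cls_eq; exact: pg_mulrV.
Qed.

HB.instance Definition _ :=
  isGroup.Build quo quo_mulA quo_mul1 quo_mulr1 quo_mulV quo_mulrV.

Lemma cls1 : cls (pg_one P) = 1 :> quo.
Proof. by []. Qed.

Lemma clsM a b : cls (pg_mul a b) = cls a * cls b :> quo.
Proof. by rewrite -cls_mul. Qed.

Lemma clsV a : cls (pg_inv a) = (cls a)^-1 :> quo.
Proof.
apply: (mulgI (cls a)); rewrite mulgV -clsM -cls1; apply/cls_eq.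
exact: pg_mulrV.
Qed.

End QuotientGroup.

(** * Groups given by generators and relations *)

Section Presentation.
Variables (A : choiceType) (R : seq (A * bool) -> seq (A * bool) -> Prop).

(* The letter [(a, false)] stands for [a], and [(a, true)] for [a^-1]. *)
Let word := seq (A * bool).

Definition inv_letter (l : A * bool) := (l.1, ~~ l.2).
Definition inv_word (w : word) : word := rev (map inv_letter w).

Inductive word_step : word -> word -> Prop :=
| WordCancel p l q : word_step (p ++ [:: l; inv_letter l] ++ q) (p ++ q)
| WordRel p u v q : R u v -> word_step (p ++ u ++ q) (p ++ v ++ q).

Lemma word_stepl u v w : word_step u v -> word_step (w ++ u) (w ++ v).
Proof.
case=> [p l q | p u' v' q Ruv]; rewrite ![w ++ (p ++ _)]catA.
  exact: WordCancel.
exact: WordRel.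
Qed.

Lemma word_stepr u v w : word_step u v -> word_step (u ++ w) (v ++ w).
Proof.
case=> [p l q | p u' v' q Ruv]; rewrite -!catA.
  exact: WordCancel.
exact: WordRel.
Qed.

Lemma inv_letterK : involutive inv_letter.
Proof. by case=> a b; rewrite /inv_letter /= negbK. Qed.

Lemma inv_wordK : involutive inv_word.
Proof. by move=> w; rewrite /inv_word map_rev revK (mapK inv_letterK). Qed.

Lemma word_mulrV w : clos_refl_sym_trans _ word_step (w ++ inv_word w) [::].
Proof.
elim/last_ind: w => [|w l IH]; first exact: rst_refl.
apply: rst_trans IH; apply: rst_step.
rewrite /inv_word map_rcons rev_rcons cat_rcons.
exact: WordCancel.
Qed.

Lemma word_mulV w : clos_refl_sym_trans _ word_step (inv_word w ++ w) [::].
Proof. by rewrite -{2}(inv_wordK w); exact: word_mulrV. Qed.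

Definition word_preGroup : preGroup :=
  @PreGroup word word_step [::] cat inv_word (@catA _) (@cat0s _) (@cats0 _)
    word_stepl word_stepr word_mulV word_mulrV.

(* The group with set of generators [A] and relations [u = v] for [R u v]. *)
Definition presented : groupType := quo word_preGroup.

End Presentation.

(* Generators [x], [y], [t]; the only relation is
   [t x t^-1 = x^-1 y^-1 x y]. *)
Definition gen_x : 'I_3 := @Ordinal 3 0 isT.
Definition gen_y : 'I_3 := @Ordinal 3 1 isT.
Definition gen_t : 'I_3 := @Ordinal 3 2 isT.

Definition Gamma1_rel (u v : seq ('I_3 * bool)) : Prop :=
  u = [:: (gen_t, false); (gen_x, false); (gen_t, true)] /\
  v = [:: (gen_x, true); (gen_y, true); (gen_x, false); (gen_y, false)].

Definition Gamma1 : groupType := presented Gamma1_rel.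

(** * Nilpotency, residual and virtual properties *)

Section GroupProperties.
Implicit Types G H Q : groupType.

Definition subgroup G (S : set G) : Prop :=
  [/\ S 1, forall g h, S g -> S h -> S (g * h) & forall g, S g -> S g^-1].

Definition generated G (S : set G) : set G :=
  [set g | forall K : set G, subgroup K -> S `<=` K -> K g].

Fixpoint lower_central G (n : nat) : set G :=
  if n is m.+1 then
    generated [set [~ g, h] | g in @lower_central G m & h in [set: G]]
  else [set: G].

Definition nilpotent G : Prop :=
  exists n, @lower_central G n `<=` [set 1].

Definition torsion_free G : Prop :=
  forall (g : G) n, (0 < n)%N -> g ^+ n = 1 -> g = 1.

Definition residually (P : groupType -> Prop) G : Prop :=
  forall g : G, g <> 1 ->
    exists (Q : groupType) (f : {multiplicative G -> Q}),
      [/\ P Q, forall q, exists h, f h = q & f g <> 1].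

Definition finite_index G (S : set G) : Prop :=
  exists r : seq G, forall g, exists2 a, a \in r & S (a^-1 * g).

(* [i] identifies [H] with a finite index subgroup of [G]. *)
Definition virtually (P : groupType -> Prop) G : Prop :=
  exists (H : groupType) (i : {multiplicative H -> G}),
    [/\ injective i, finite_index (range i) & P H].

Definition isomorphic G H : Prop :=
  exists f : {multiplicative G -> H}, bijective f.

End GroupProperties.

(** * Lambda-trees *)

Definition linearly_ordered_group (L : porderZmodType) : Prop :=
  total (<=%R : rel L) /\ forall x y z : L, (x <= y)%R -> (z + x <= z + y)%R.

Section LambdaTree.
(* Used only when [linearly_ordered_group L] holds. *)
Variable L : porderZmodType.
Local Open Scope ring_scope.

Definition labs (z : L) : L := Order.max z (- z).

Record metricSpace := MetricSpace {
  mpoint :> Type;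
  mdist : mpoint -> mpoint -> L;
  mdist_ge0 : forall p q, 0 <= mdist p q;
  mdist_eq0 : forall p q, mdist p q = 0 <-> p = q;
  mdistC : forall p q, mdist p q = mdist q p;
  mdist_triangle : forall p q r, mdist p r <= mdist p q + mdist q r
}.

(* [S] is a segment with endpoints [p] and [q]. *)
Definition segment (X : metricSpace) (p q : X) (S : set X) : Prop :=
  exists (a b : L) (f : L -> X),
    [/\ a <= b,
        forall s t, a <= s <= b -> a <= t <= b ->
          mdist (f s) (f t) = labs (s - t),
        f a = p, f b = q & S = f @` [set s | a <= s <= b]].

Definition is_segment (X : metricSpace) (S : set X) : Prop :=
  exists p q, segment p q S.

(* Trees are nonempty: every group acts freely on the empty set. *)
Definition is_tree (X : metricSpace) : Prop :=
  [/\ inhabited X,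
      forall p q : X, exists S, segment p q S,
      forall (p q r : X) S T, segment p q S -> segment p r T ->
        is_segment (S `&` T) &
      forall (p q r : X) S T, segment p q S -> segment p r T ->
        S `&` T = [set p] -> is_segment (S `|` T)].

Record isometricAction (G : groupType) (X : metricSpace) := IsometricAction {
  act :> G -> X -> X;
  act1 : forall p, act 1%g p = p;
  actM : forall g h p, act (g * h)%g p = act g (act h p);
  act_isometry : forall g p q, mdist (act g p) (act g q) = mdist p q
}.

(* The second clause concerns setwise stabilisers. *)
Definition free_action (G : groupType) (X : metricSpace)
    (a : isometricAction G X) : Prop :=
  (forall (p : X) g, a g p = p -> g = 1%g) /\
  (forall (S : set X) g, is_segment S -> a g @` S = S -> g = 1%g).

Definition acts_freely_on_tree (G : groupType) : Prop :=
  exists (X : metricSpace) (a : isometricAction G X),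
    is_tree X /\ free_action a.

End LambdaTree.

(* The lexicographic order is displayed as [<=%R]. *)
Definition Z2 := (int *lexi[ring_display] int)%type.
HB.instance Definition _ := Order.Total.on Z2.
HB.instance Definition _ := GRing.Zmodule.copy Z2 (int * int)%type.

Lemma Z2_leE (p q : Z2) :
  (p <= q)%R = (p.1 <= q.1)%R && ((q.1 <= p.1)%R ==> (p.2 <= q.2)%R).
Proof. by []. Qed.

Lemma Z2_linearly_ordered_group : linearly_ordered_group Z2.
Proof.
split=> [p q|p q r]; first exact: le_total.
by rewrite !Z2_leE !lerD2l.
Qed.

(** * Cube complexes *)

Definition cube (n : nat) := {ffun 'I_n -> bool}.

Definition hamming n (u v : cube n) : nat := #|[set i | u i != v i]|%SET.

(* The isometric embeddings of the vertex set [{0,1}^m] into [{0,1}^n] are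
   exactly the parametrisations of the [m]-dimensional faces of the
   [n]-cube by the standard [m]-cube. *)
Definition is_cubemap m n (f : {ffun cube m -> cube n}) : bool :=
  [forall u, forall v, hamming (f u) (f v) == hamming u v].

Record cubemap m n := Cubemap {
  cubemap_val :> {ffun cube m -> cube n};
  cubemapP : is_cubemap cubemap_val
}.

HB.instance Definition _ m n := [isSub for @cubemap_val m n].

Lemma cubemap_id_subproof n : is_cubemap [ffun u : cube n => u].
Proof. by apply/forallP=> u; apply/forallP=> v; rewrite !ffunE. Qed.

Definition cubemap_id n : cubemap n n := Cubemap (cubemap_id_subproof n).

Lemma cubemap_comp_subproof k m n (g : cubemap m n) (f : cubemap k m) :
  is_cubemap [ffun u => g (f u)].
Proof.
apply/forallP=> u; apply/forallP=> v; rewrite !ffunE.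
have /forallP/(_ (f u))/forallP/(_ (f v))/eqP-> := cubemapP g.
by have /forallP/(_ u)/forallP/(_ v) := cubemapP f.
Qed.

Definition cubemap_comp k m n (g : cubemap m n) (f : cubemap k m) :
  cubemap k n := Cubemap (cubemap_comp_subproof g f).

Lemma vertex_map_subproof n (v : cube n) : is_cubemap [ffun _ : cube 0 => v].
Proof.
apply/forallP=> u; apply/forallP=> u'; rewrite !ffunE /hamming.
by rewrite !eq_card0 // => i; rewrite inE ?eqxx //; case: i.
Qed.

(* The vertex [v] of the [n]-cube. *)
Definition vertex_map n (v : cube n) : cubemap 0 n :=
  Cubemap (vertex_map_subproof v).

Definition shift n (v : cube n) (i : 'I_n) (b : bool) : cube n :=
  [ffun j => v j (+) ((j == i) && b)].

Lemma edge_map_subproof n (v : cube n) i :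
  is_cubemap [ffun u : cube 1 => shift v i (u ord0)].
Proof.
apply/forallP=> u; apply/forallP=> u'; rewrite !ffunE /hamming.
have [uu'|uu'] := eqVneq (u ord0) (u' ord0).
  rewrite uu' !eq_card0 // => j; rewrite inE ?eqxx //.
  by rewrite (ord1 j) uu' eqxx.
rewrite (@eq_card1 _ i) ?(@eq_card1 _ ord0) // => j; rewrite !inE.
  by rewrite (ord1 j) uu' eqxx.
rewrite !ffunE; have [_|_] /= := eqVneq j i; last by rewrite !addbF eqxx.
by rewrite (inj_eq (@addbI _)) uu'.
Qed.

(* The edge of the [n]-cube from [v] to the neighbour of [v] in direction
   [i]. *)
Definition edge_map n (v : cube n) (i : 'I_n) : cubemap 1 n :=
  Cubemap (edge_map_subproof v i).

(* A complex obtained by gluing cubes along faces by isometries.  [cell n] is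
   the set of pairs of an [n]-cube of the complex and a parametrisation of it
   by the standard [n]-cube; thus every [n]-cube gives [2^n n!] elements of
   [cell n], on which the isometries of the standard cube act freely. *)
Record cubeComplex := CubeComplex {
  cell : nat -> choiceType;
  face : forall m n, cubemap m n -> cell n -> cell m;
  face_id : forall n (c : cell n), face (cubemap_id n) c = c;
  face_comp : forall k m n (g : cubemap m n) (f : cubemap k m) (c : cell n),
    face (cubemap_comp g f) c = face f (face g c);
  face_free : forall n (f : cubemap n n) (c : cell n),
    face f c = c -> f = cubemap_id n
}.

Definition corner0 n : cube n := [ffun _ => false].
Definition corner1 n (i : 'I_n) : cube n := shift (corner0 n) i true.

Section CubeComplex.
Variable X : cubeComplex.

Definition vertex_at n (v : cube n) (c : cell X n) : cell X 0 :=
  face (vertex_map v) c.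
Definition edge_at n (v : cube n) (i : 'I_n) (c : cell X n) : cell X 1 :=
  face (edge_map v i) c.

(* Elements of [cell X 1] are oriented edges. *)
Definition source (e : cell X 1) : cell X 0 := vertex_at (corner0 1) e.
Definition target (e : cell X 1) : cell X 0 := vertex_at (corner1 ord0) e.
Definition flip (e : cell X 1) : cell X 1 := edge_at (corner1 ord0) ord0 e.

Lemma face_eq m n (f g : cubemap m n) (c : cell X n) :
  (forall u, f u = g u) -> face f c = face g c.
Proof. by move=> fg; congr face; apply/val_inj/ffunP. Qed.

Lemma source_edge n (v : cube n) i (c : cell X n) :
  source (edge_at v i c) = vertex_at v c.
Proof.
rewrite /source /edge_at /vertex_at -face_comp; apply: face_eq => u.
by rewrite !ffunE; apply/ffunP=> j; rewrite !ffunE andbF addbF.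
Qed.

Lemma target_edge n (v : cube n) i (c : cell X n) :
  target (edge_at v i c) = vertex_at (shift v i true) c.
Proof.
rewrite /target /edge_at /vertex_at -face_comp; apply: face_eq => u.
by rewrite !ffunE; apply/ffunP=> j; rewrite !ffunE eqxx.
Qed.

Lemma source_flip (e : cell X 1) : source (flip e) = target e.
Proof. exact: source_edge. Qed.

Lemma target_flip (e : cell X 1) : target (flip e) = source e.
Proof.
rewrite target_edge; congr vertex_at.
by apply/ffunP=> j; rewrite !ffunE (ord1 j) eqxx.
Qed.

Lemma flipK : involutive flip.
Proof.
move=> e; rewrite -[RHS]face_id /flip /edge_at -face_comp.
apply: face_eq => u; rewrite !ffunE; apply/ffunP=> j.
by rewrite !ffunE (ord1 j) !eqxx /= negbK.
Qed.

(** ** The fundamental group *)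

Fixpoint walk (u : cell X 0) (p : seq (cell X 1)) (v : cell X 0) : bool :=
  if p is e :: q then (source e == u) && walk (target e) q v else u == v.

Definition connected : Prop :=
  inhabited (cell X 0) /\ forall u v, exists p, walk u p v.

(* Cancelling a backtrack, and pushing a path across a square. *)
Inductive path_step : seq (cell X 1) -> seq (cell X 1) -> Prop :=
| PathCancel p e q : path_step (p ++ [:: e; flip e] ++ q) (p ++ q)
| PathSquare p (s : cell X 2) q :
    path_step
      (p ++ [:: edge_at (corner0 2) ord0 s;
                edge_at (corner1 ord0) ord_max s] ++ q)
      (p ++ [:: edge_at (corner0 2) ord_max s;
                edge_at (corner1 ord_max) ord0 s] ++ q).

Definition path_rev (p : seq (cell X 1)) := rev (map flip p).

Lemma walk_cat u v w p q : walk u p v -> walk v q w -> walk u (p ++ q) w.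
Proof.
elim: p u => [|e p IH] u /=; first by move=> /eqP->.
by move=> /andP[-> /IH].
Qed.

Lemma walk_rcons u p e v :
  walk u (rcons p e) v = walk u p (source e) && (target e == v).
Proof.
elim: p u => [|e' p IH] u /=; first by rewrite eq_sym.
by rewrite IH andbA.
Qed.

Lemma walk_rev u v p : walk u p v -> walk v (path_rev p) u.
Proof.
elim: p u => [|e p IH] u /=; first by rewrite eq_sym.
move=> /andP[/eqP<- /IH]; rewrite /path_rev /= rev_cons walk_rcons.
by rewrite source_flip target_flip eqxx andbT.
Qed.

Lemma path_revK : involutive path_rev.
Proof. by move=> p; rewrite /path_rev map_rev revK (mapK flipK). Qed.

Section Loops.
Variable v : cell X 0.

Record loop := Loop {
  loop_path :> seq (cell X 1);
  loopP : walk v loop_path v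
}.

HB.instance Definition _ := [isSub for loop_path].
HB.instance Definition _ := [Choice of loop by <:].

Definition loop_step (p q : loop) : Prop := path_step p q.
Definition loop_one : loop := @Loop [::] (eqxx v).
Definition loop_mul (p q : loop) : loop := Loop (walk_cat (loopP p) (loopP q)).
Definition loop_inv (p : loop) : loop := Loop (walk_rev (loopP p)).

Lemma loop_mulA : associative loop_mul.
Proof. by move=> p q r; apply/val_inj/catA. Qed.

Lemma loop_mul1 : left_id loop_one loop_mul.
Proof. by move=> p; apply/val_inj. Qed.

Lemma loop_mulr1 : right_id loop_one loop_mul.
Proof. by move=> p; apply/val_inj/cats0. Qed.

Lemma loop_stepl (p q r : loop) :
  loop_step p q -> loop_step (loop_mul r p) (loop_mul r q).
Proof.
rewrite /loop_step /=; case=> *; rewrite ![loop_path r ++ (_ ++ _)]catA.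
  exact: PathCancel.
exact: PathSquare.
Qed.

Lemma loop_stepr (p q r : loop) :
  loop_step p q -> loop_step (loop_mul p r) (loop_mul q r).
Proof.
rewrite /loop_step /=; case=> *; rewrite -!catA.
  exact: PathCancel.
exact: PathSquare.
Qed.

Lemma loop_mulrV p :
  clos_refl_sym_trans _ loop_step (loop_mul p (loop_inv p)) loop_one.
Proof.
suff H q w : walk v q w -> forall l : loop, loop_path l = q ++ path_rev q ->
  clos_refl_sym_trans _ loop_step l loop_one by exact: (H _ _ (loopP p)).
elim/last_ind: q w => [|q e IH] w.
  by move=> _ l l0; rewrite (_ : l = loop_one); [exact: rst_refl|exact: val_inj].
rewrite walk_rcons => /andP[qe _] l lE.
pose l' : loop := Loop (walk_cat qe (walk_rev qe)).
apply: (rst_trans _ _ _ l'); last exact: (IH _ qe).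
apply: rst_step; rewrite /loop_step lE /path_rev map_rcons rev_rcons cat_rcons.
exact: PathCancel.
Qed.

Lemma loop_mulV p :
  clos_refl_sym_trans _ loop_step (loop_mul (loop_inv p) p) loop_one.
Proof.
have := loop_mulrV (loop_inv p).
by congr (clos_refl_sym_trans _ _ _ _); apply/val_inj; rewrite /= path_revK.
Qed.

Definition loop_preGroup : preGroup :=
  @PreGroup loop loop_step loop_one loop_mul loop_inv loop_mulA loop_mul1
    loop_mulr1 loop_stepl loop_stepr loop_mulV loop_mulrV.

Definition fundamental_group : groupType := quo loop_preGroup.

End Loops.

(** ** Nonpositive curvature *)

(* An [n]-cube with a parametrisation [c] is an ordered [(n-1)]-simplex of the
   link of its vertex [vertex_at (corner0 n) c], whose vertices are the
   following oriented edges. *)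
Definition corner_edge n (c : cell X n) (i : 'I_n) : cell X 1 :=
  edge_at (corner0 n) i c.

(* [a] and [b] are consecutive edges, issued from the same vertex, of some
   square. *)
Definition span_square (a b : cell X 1) : Prop :=
  exists s : cell X 2, corner_edge s ord0 = a /\ corner_edge s ord_max = b.

(* The first two clauses say that the links are simplicial complexes: the
   vertices of a simplex are distinct, and determine it. *)
Definition nonpositively_curved : Prop :=
  [/\ forall n (c : cell X n), injective (corner_edge c),
      forall n (c c' : cell X n),
        vertex_at (corner0 n) c = vertex_at (corner0 n) c' ->
        (forall i, corner_edge c i = corner_edge c' i) -> c = c' &
      forall n (v : cell X 0) (e : 'I_n -> cell X 1),
        injective e -> (forall i, source (e i) = v) ->
        (forall i j, i != j -> span_square (e i) (e j)) ->
        exists c : cell X n,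
          vertex_at (corner0 n) c = v /\ forall i, corner_edge c i = e i].

(** ** Hyperplanes *)

(* Parallelism of oriented edges is generated by: [a] and [b] are opposite
   edges, with the same direction, of a square. *)
Definition opposite (a b : cell X 1) : Prop :=
  exists s : cell X 2,
    a = edge_at (corner0 2) ord0 s /\ b = edge_at (corner1 ord_max) ord0 s.

Definition parallel : cell X 1 -> cell X 1 -> Prop :=
  clos_refl_sym_trans _ opposite.

(* [a] and [b] are dual to the same hyperplane. *)
Definition same_hyperplane (a b : cell X 1) : Prop :=
  parallel a b \/ parallel a (flip b).

(* [a] and [b] are distinct edges, issued from the same vertex, which are not
   consecutive in a square at this vertex. *)
Definition osculate (a b : cell X 1) : Prop :=
  [/\ source a = source b, a <> b & ~ span_square a b].

Definition embedded_hyperplanes : Prop :=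
  forall a b, span_square a b -> ~ same_hyperplane a b.

Definition two_sided_hyperplanes : Prop :=
  forall a, ~ parallel a (flip a).

Definition no_direct_self_osculation : Prop :=
  forall a b, osculate a b -> ~ parallel a b.

Definition no_inter_osculation : Prop :=
  forall a b a' b', span_square a b -> osculate a' b' ->
    ~ (same_hyperplane a a' /\ same_hyperplane b b').

Definition special : Prop :=
  [/\ nonpositively_curved, embedded_hyperplanes, two_sided_hyperplanes,
      no_direct_self_osculation & no_inter_osculation].

End CubeComplex.

Definition special_group (G : groupType) : Prop :=
  exists (X : cubeComplex) (v : cell X 0),
    [/\ connected X, special X & isomorphic G (fundamental_group v)].

(* Main.v *)
From HB Require Import structures.
From Stdlib Require Import Relation_Operators.
Require Import Defs.
From mathcomp Require Import all_boot all_order all_algebra.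
From mathcomp Require Import ssrAC fraction boolp classical_sets zify ring.

Set Implicit Arguments.
Unset Strict Implicit.
Unset Printing Implicit Defensive.

Import Order.TTheory GRing.Theory Num.Theory.

(** Put b = y^-1 x y.  The relation says that t x t^-1 = x^-1 b.  So Gamma1 is a
    double HNN extension of the free group on x and b, which is the fundamental
    group of a pair of pants: x, b and x^-1 b are its boundary curves, y
    conjugates b to x, and t conjugates x to x^-1 b.

    The pants group consists of the even words in three half-turns, and the
    boundary curves are the products of two half-turns.  Let the half-turns act
    by the matrices [invol], which depend on a parameter U.  A matrix that maps
    the eigenvectors of one boundary curve to those of another can serve as the
    image of y or t; up to scalars it contains one more parameter lam, the same
    for both stable letters.  This gives a family [rep] of representations of
    Gamma1 by matrices of size 2.  At lam = 0 the stable letters have rank one,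
    and at U = 1 the half-turns are nilpotent of rank one.

    Free action.  Over the field of rational functions in lam and U - 1, with
    its lexicographic valuation in Z^2, the group acts on the tree of homothety
    classes of norms on the plane.  An element whose trace and determinant
    satisfy 2 v(tr) < v(det) fixes neither a point nor a segment.  Every
    nontrivial element is of this kind ([trace_det]).  It is conjugate to a
    cyclically reduced word; if stable letters occur in it, then at lam = 0 its
    trace is a product of pairings of eigenvectors, none of which vanishes
    because the word has no pinch ([pairing_eq0]), while its determinant is 0.
    If none occurs, the same happens at U = 1.

    Virtual specialness.  A complex whose hyperplanes are given in advance, as
    commuting partial involutions of the set of vertices, is automatically
    special ([icomplex_special]).  Such a complex with 72 vertices is a finite
    covering of a square complex with fundamental group Gamma1.  A weight in
    Gamma1 for each edge gives a homomorphism from its fundamental group to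
    Gamma1; lifting words to paths shows that it is injective and that its image
    is the stabiliser of a point in an action on 18 points.

    Residual properties of that subgroup.  For 3 U^2 = 1 the three half-turns
    coincide, and when moreover lam = 1 the group acts through a finite group in
    which the subgroup is trivial.  So if lam is a rational function of U that
    is congruent to 1 modulo 3 U^2 - 1, then [rep] maps the subgroup to a
    congruence subgroup of level 1.  Its quotients by congruence subgroups are
    nilpotent and torsion-free ([Qk_torsion_free], [Qk_nilpotent]).  By
    [trace_det] again, every nontrivial element has a nontrivial image for some
    choice of lam.

    Finally x = t^-1 [x, y] t, so x lies in all terms of the lower central
    series and vanishes in every nilpotent quotient, although x is not 1. *)

(** * Two by two matrices *)

Local Open Scope ring_scope.

Lemma ord2P (i : 'I_2) : i = 0 \/ i = 1.
Proof. by case: i => -[|[|//]] ?; [left|right]; exact: val_inj. Qed.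

Lemma big_ord2 (A : nmodType) (F : 'I_2 -> A) : \sum_i F i = F 0 + F 1.
Proof. by rewrite !big_ord_recl big_ord0 addr0; congr (_ + F _); apply/val_inj. Qed.

Definition mx2 (A : Type) (a b c d : A) : 'M[A]_2 :=
  \matrix_(i, j) if i == 0 then (if j == 0 then a else b)
                 else (if j == 0 then c else d).

Section Mx2.
Variable A : comPzRingType.
Implicit Types (M N : 'M[A]_2) (a b c d : A) (u w : A * A).

Lemma mx2E a b c d : ((mx2 a b c d 0 0 = a) * (mx2 a b c d 0 1 = b) *
  (mx2 a b c d 1 0 = c) * (mx2 a b c d 1 1 = d))%type.
Proof. by do !split; rewrite mxE. Qed.

Lemma mx2_eta M : M = mx2 (M 0 0) (M 0 1) (M 1 0) (M 1 1).
Proof.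
apply/matrixP => i j.
by case: (ord2P i) => ->; case: (ord2P j) => ->; rewrite mx2E.
Qed.

Lemma mx2M a b c d a' b' c' d' : mx2 a b c d *m mx2 a' b' c' d' =
  mx2 (a * a' + b * c') (a * b' + b * d') (c * a' + d * c') (c * b' + d * d').
Proof. by rewrite [LHS]mx2_eta; congr mx2; rewrite !mxE big_ord2 !mx2E. Qed.

Lemma mx2Z k a b c d : k *: mx2 a b c d = mx2 (k * a) (k * b) (k * c) (k * d).
Proof. by rewrite [LHS]mx2_eta; congr mx2; rewrite !mxE. Qed.

Lemma mx2_scalar a : a%:M = mx2 a 0 0 a.
Proof. by rewrite [LHS]mx2_eta; congr mx2; rewrite !mxE. Qed.

Lemma mx2_trace M : \tr M = M 0 0 + M 1 1.
Proof. by rewrite /mxtrace big_ord2. Qed.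

Lemma mx2_det M : \det M = M 0 0 * M 1 1 - M 0 1 * M 1 0.
Proof.
rewrite (expand_det_row M 0) big_ord2 /cofactor !det_mx11 !mxE.
have -> : lift 0 0 = 1 :> 'I_2 by apply/val_inj.
have -> : lift 1 0 = 0 :> 'I_2 by apply/val_inj.
by rewrite /= expr0 expr1; ring.
Qed.

(** The linear form [det2 u] vanishes exactly on the line of [u], so that a
    line can be given by one vector both as an image and as a kernel. *)
Definition det2 u w : A := u.1 * w.2 - u.2 * w.1.

Definition mulv M w : A * A :=
  (M 0 0 * w.1 + M 0 1 * w.2, M 1 0 * w.1 + M 1 1 * w.2).

(** This matrix sends a vector [z] to [det2 w z] times [u]: its image is the
    line of [u] and its kernel is the line of [w]. *)
Definition rank1 u w : 'M[A]_2 :=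
  mx2 (- (u.1 * w.2)) (u.1 * w.1) (- (u.2 * w.2)) (u.2 * w.1).

Definition scalev a w : A * A := (a * w.1, a * w.2).

Lemma mulvM M N w : mulv (M *m N) w = mulv M (mulv N w).
Proof. by rewrite /mulv !mxE !big_ord2 /=; congr pair; ring. Qed.

Lemma mulv1 w : mulv 1%:M w = w.
Proof. by case: w => x y; rewrite /mulv !mxE /=; congr pair; ring. Qed.

Lemma mulvZ M a w : mulv M (scalev a w) = scalev a (mulv M w).
Proof. by rewrite /mulv /scalev /=; congr pair; ring. Qed.

Lemma det2Zl a u w : det2 (scalev a u) w = a * det2 u w.
Proof. by rewrite /det2 /=; ring. Qed.

Lemma det2Zr a u w : det2 u (scalev a w) = a * det2 u w.
Proof. by rewrite /det2 /=; ring. Qed.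

Lemma det2_mulv M u w : det2 (mulv M u) (mulv M w) = \det M * det2 u w.
Proof. by rewrite mx2_det /det2 /mulv /=; ring. Qed.

Lemma rank1_mulv M u w : M *m rank1 u w = rank1 (mulv M u) w.
Proof.
by rewrite {1}[M]mx2_eta /rank1 mx2M /mulv /=; congr mx2; ring.
Qed.

Lemma trace_rank1 M u w : \tr (rank1 u w *m M) = det2 w (mulv M u).
Proof.
rewrite {1}[M]mx2_eta /rank1 mx2M mx2_trace !mx2E /det2 /mulv /=; ring.
Qed.

(** A product of rank one maps is nonzero as long as no image falls into the
    next kernel. *)
Lemma rank1_rank1 M u w u' w' :
  rank1 u w *m M *m rank1 u' w' = det2 w (mulv M u') *: rank1 u w'.
Proof.
by rewrite -mulmxA rank1_mulv {1}/rank1 /rank1 !mx2M mx2Z /det2 /=; congr mx2; ring.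
Qed.

End Mx2.

(** * Trees with distances in Z^2 *)

Local Open Scope classical_set_scope.

Lemma Z2_addE (p q : Z2) : ((p + q).1 = p.1 + q.1) * ((p + q).2 = p.2 + q.2).
Proof. by []. Qed.
Lemma Z2_oppE (p : Z2) : ((- p).1 = - p.1) * ((- p).2 = - p.2).
Proof. by []. Qed.
Lemma Z2_0E : ((0 : Z2).1 = 0) * ((0 : Z2).2 = 0).
Proof. by []. Qed.
Lemma Z2_eqP (p q : Z2) : p = q <-> p <= q /\ q <= p.
Proof. by split=> [->|[pq qp]]; [split|apply/eqP; rewrite eq_le pq]. Qed.
Lemma Z2_ltP (p q : Z2) : (p < q) = ~~ (q <= p).
Proof. exact: ltNge. Qed.

(** Linear arithmetic in the ordered group Z^2. Antisymmetry replaces the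
    equations by inequalities, and these are lexicographic comparisons of
    coordinates. *)
Ltac z2 :=
  intros;
  try (apply (proj2 (Z2_eqP _ _)));
  repeat match goal with p := _ |- _ => clearbody p end;
  repeat match goal with
  | H : is_true (_ <= _) |- _ => revert H
  | H : is_true (_ < _) |- _ => revert H
  | H : _ \/ _ |- _ => revert H
  | H : _ /\ _ |- _ => revert H
  | H : @eq ?T _ _ |- _ => unify T Z2; apply (proj1 (Z2_eqP _ _)) in H; revert H
  | H : is_true (~~ _) |- _ => revert H
  end;
  rewrite ?(Z2_ltP, Z2_eqP); rewrite ?(Z2_leE, Z2_addE, Z2_oppE, Z2_0E);
  repeat match goal with p : ?T |- _ => unify T Z2; destruct p end;
  cbn [fst snd]; lia.

Lemma labs_Z2 (s t : Z2) : s <= t -> labs (s - t) = t - s /\ labs (t - s) = t - s.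
Proof.
move=> st; rewrite /labs; split.
  rewrite max_r ?opprB //; z2.
rewrite max_l //; z2.
Qed.

Lemma labsP (s t z : Z2) : labs (s - t) = z -> s - t = z \/ t - s = z.
Proof.
by case/orP: (le_total s t) => /labs_Z2[h h']; rewrite ?h ?h'; [right|left].
Qed.

Section Hyperbolic.
Variable X : metricSpace Z2.
Local Notation d := (@mdist _ X).

(** In a tree, this set is the segment from [p] to [q]. *)
Definition between (p q : X) : set X := [set z | d p z + d z q = d p q].

Hypothesis four_point : forall p q r s : X,
  d p q + d r s <= d p r + d q s \/ d p q + d r s <= d p s + d q r.
Hypothesis geodesic : forall p q : X, exists S, segment p q S.
Hypothesis median : forall p q r : X,
  exists c, [/\ between p q c, between p r c & between q r c].

(** The four-point condition for [z], [z'], [p], [q] bounds the distance of [z]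
    and [z'] by the difference of their distances to [p]. *)
Lemma between_uniq (p q z z' : X) :
  between p q z -> between p q z' -> d p z = d p z' -> z = z'.
Proof.
rewrite /between /= => hz hz' e; apply/mdist_eq0.
have := four_point z z' p q; have := mdist_ge0 z z'.
rewrite (mdistC z p) (mdistC z' p).
move: (d z z') (d p q) (d p z) (d p z') (d z q) (d z' q) hz hz' e => a b c c' e e'.
z2.
Qed.

(** A segment contains a point at every distance from [p] up to [d p q], and a
    point between [p] and [q] is determined by this distance. *)
Lemma segmentE (p q : X) S : segment p q S -> S = between p q.
Proof.
case=> a [b [f [ab fiso fa fb ->]]]; have leaa : a <= a <= b by rewrite lexx.
have lebb : a <= b <= b by rewrite lexx andbT.
have dpq : d p q = b - a by rewrite -fa -fb fiso //; case: (labs_Z2 ab).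
apply/seteqP; split=> [z [s /= /andP[as_ sb] <-]|z hz].
  rewrite /between /= dpq -fa -fb !fiso ?as_ ?sb ?lexx ?ab //.
  rewrite (labs_Z2 as_).1 (labs_Z2 sb).1; z2.
have dz0 := mdist_ge0 p z; have dz1 := mdist_ge0 z q; move: hz; rewrite /between /= dpq => hz.
have h : a <= a + d p z <= b.
  by apply/andP; split; move: (d p z) (d z q) dz0 dz1 hz => u v; z2.
exists (a + d p z) => //; apply: (@between_uniq p q _ z).
- case/andP: (h) => h1 h2; rewrite /between/= -{1}fa -{1}fb !fiso // (labs_Z2 h1).1 (labs_Z2 h2).1 dpq.
  by move: (d p z) => u; z2.
- by rewrite /between /= dpq.
case/andP: (h) => h1 h2; rewrite -{1}fa fiso // (labs_Z2 h1).1.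
by move: (d p z) => u; z2.
Qed.

Lemma between_segment (p q : X) : segment p q (between p q).
Proof. by have [S sS] := geodesic p q; rewrite -(segmentE sS). Qed.

(** The median [c] is the branch point of the tripod spanned by the three
    points. *)
Lemma betweenI (p q r c : X) :
  between p q c -> between p r c -> between q r c ->
  between p q `&` between p r = between p c.
Proof.
rewrite /between /= => cpq cpr cqr; apply/seteqP; split=> z /=.
  case=> zq zr; have := four_point z c q r; have := mdist_triangle p z c.
  move: cpq cpr cqr zq zr; rewrite (mdistC q c).
  move: (d p c) (d c q) (d p q) (d c r) (d p r) (d q r).
  move: (d p z) (d z q) (d z r) (d z c) => *; z2.
move=> zc; have := mdist_triangle z c q; have := mdist_triangle z c r.
have := mdist_triangle p z q; have := mdist_triangle p z r.
move: zc cpq cpr.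
move: (d p c) (d c q) (d p q) (d c r) (d p r) (d p z) (d z q) (d z r) (d z c).
by move=> *; split; z2.
Qed.

(** A metric space whose triples have medians and whose points are joined by
    segments is a tree as soon as it satisfies the four-point condition,
    because the latter makes segments unique. If the segments from [p] meet
    only in [p], then [p] is the median, hence lies between the other two
    points. *)
Lemma hyperbolic_tree : inhabited X -> is_tree X.
Proof.
move=> X0; split=> // p q r S T /segmentE-> /segmentE->.
  have [c [cpq cpr cqr]] := median p q r.
  by rewrite (betweenI cpq cpr cqr); exists p, c; exact: between_segment.
move=> pI; have [c [cpq cpr cqr]] := median p q r.
have cp : c = p by have : (between p q `&` between p r) c by []; rewrite pI.
subst c; suff -> : between p q `|` between p r = between q r.
  by exists q, r; exact: between_segment.
rewrite /between /= in cqr *; apply/seteqP; split=> z /=.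
  have := mdist_triangle q z r.
  have := mdist_triangle q p z; have := mdist_triangle z p r.
  move: cqr; rewrite (mdistC q z) (mdistC p z) (mdistC q p).
  move: (d p q) (d p r) (d q r) (d z q) (d z r) (d z p).
  by move=> a b c e f g h1 h2 h3 h4 [h|h]; z2.
have := four_point z p q r; have := mdist_triangle q p z; have := mdist_triangle q z p.
have := mdist_triangle p z q; have := mdist_triangle p z r.
move: cqr; rewrite (mdistC q p) (mdistC q z) (mdistC z p).
move: (d p q) (d p r) (d q r) (d z q) (d z r) (d p z).
move=> a b c e f g h1 h2 h3 h4 h5 h6 h7.
(* As [p] lies between [q] and [r], the point [z] is beyond [p] as seen
   from [q] exactly when it is at least as far from [q] as [p] is. *)
case/orP: (le_total a e) => ae; [right|left]; z2.
Qed.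

End Hyperbolic.

(** * The tree of norms of a valued field *)

Section ValuationTree.
Variables (K : fieldType) (v : K -> Z2).
Hypothesis vM : forall a b, a != 0 -> b != 0 -> v (a * b) = v a + v b.
Hypothesis vD : forall a b r, a != 0 -> b != 0 -> a + b != 0 ->
  r <= v a -> r <= v b -> r <= v (a + b).

(** A valuation is a function on nonzero elements here; this predicate gives 0
    infinite valuation. *)
Definition vle (r : Z2) (a : K) : bool := (a == 0) || (r <= v a).

Lemma v1 : v 1 = 0.
Proof.
have := vM (oner_neq0 K) (oner_neq0 K); rewrite mulr1.
by move=> /(congr1 (fun z => z - v 1)); rewrite subrr addrK.
Qed.

Lemma vN a : a != 0 -> v (- a) = v a.
Proof.
have N1 : (-1 : K) != 0 by rewrite oppr_eq0 oner_neq0.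
move=> a0; rewrite -mulN1r vM //.
have := vM N1 N1; rewrite mulrNN mulr1 v1; move: (v (-1)) (v a) => s t; z2.
Qed.

Lemma vle0 r : vle r 0. Proof. by rewrite /vle eqxx. Qed.

Lemma vleD r a b : vle r a -> vle r b -> vle r (a + b).
Proof.
have [->|a0] := eqVneq a 0; first by rewrite add0r.
have [->|b0] := eqVneq b 0; first by rewrite addr0.
rewrite /vle (negPf a0) (negPf b0) /=; have [//|ab0] := eqVneq (a + b) 0.
exact: vD.
Qed.

Lemma vleN r a : vle r (- a) = vle r a.
Proof.
rewrite /vle oppr_eq0; have [//|a0] /= := eqVneq a 0; by rewrite vN.
Qed.

Lemma vleB r a b : vle r a -> vle r b -> vle r (a - b).
Proof. by move=> ra rb; rewrite vleD // vleN. Qed.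

Lemma vleC r a b : vle r (a - b) = vle r (b - a).
Proof. by rewrite -vleN opprB. Qed.

Lemma vle_weak r s a : s <= r -> vle r a -> vle s a.
Proof. by rewrite /vle => sr /orP[->//|ra]; rewrite (le_trans sr ra) orbT. Qed.

Lemma vleM r s a b : vle r a -> vle s b -> vle (r + s) (a * b).
Proof.
rewrite /vle mulf_eq0; have [->//|a0] /= := eqVneq a 0.
have [->//|b0] /= := eqVneq b 0; rewrite vM //.
by move: (v a) (v b) => p q; z2.
Qed.

Lemma vleMl r a b : a != 0 -> vle r (a * b) = vle (r - v a) b.
Proof.
move=> a0; rewrite /vle mulf_eq0 (negPf a0) /=.
by have [->//|b0] /= := eqVneq b 0; rewrite vM //; apply/idP/idP; z2.
Qed.

(** The points of the tree of a valued field are the homothety classes of norms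
    on the plane. The group Z^2 has no infinity, so a norm is described by its
    balls: [nrm a r w s] says that [w] has norm at least [s] for the norm that
    has (1, 0) and (a, 1) as an orthogonal basis and takes the values 0 and [r]
    on them. *)
Definition nrm (a : K) (r : Z2) (w : K * K) (s : Z2) : Prop :=
  vle s (w.1 - a * w.2) /\ vle (s - r) w.2.

(** Homothety of norms. *)
Definition shifted (N N' : K * K -> Z2 -> Prop) : Prop :=
  exists c : Z2, forall w s, N w s <-> N' w (s - c).

Lemma nrm_e1 a r s : nrm a r (1, 0) s <-> s <= 0.
Proof.
rewrite /nrm /= mulr0 subr0 /vle oner_eq0 eqxx /= v1.
by split=> [[]|].
Qed.

Lemma nrm_a1 a r b s : nrm a r (b, 1) s <-> vle s (b - a) /\ s <= r.
Proof.
rewrite /nrm /= mulr1 /vle oner_eq0 /= v1.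
by split=> -[-> h]; split=> //; move: h; z2.
Qed.

Lemma shifted_sym N N' : shifted N N' -> shifted N' N.
Proof. by case=> c h; exists (- c) => w s; rewrite h opprK addrK. Qed.

Lemma shifted_trans N N' N'' : shifted N N' -> shifted N' N'' -> shifted N N''.
Proof.
move=> [c h] [c' h']; exists (c + c') => w s.
by rewrite h h' opprD addrA.
Qed.

Lemma shifted_precomp N N' (f : K * K -> K * K) :
  shifted N N' -> shifted (fun w => N (f w)) (fun w => N' (f w)).
Proof. by case=> c h; exists c => w s; exact: h. Qed.

(** The norms [nrm a r] all take the value 0 at (1, 0), so no two of them are
    properly homothetic. *)
Lemma shifted_nrm a r b s : shifted (nrm a r) (nrm b s) -> nrm a r = nrm b s.
Proof.
case=> c h; have c0 : c = 0.
  have h0 := (h (1, 0) 0).1 ((nrm_e1 a r 0).2 (lexx _)).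
  have h1 := (h (1, 0) c).2; rewrite subrr !nrm_e1 in h0 h1.
  by have := h1 (lexx _); move: h0; z2.
by apply/funext => w; apply/funext => t; apply/propext; rewrite h c0 subr0.
Qed.

(** The class of [nrm a r] is the ball of radius [r] around [a]; the tree has a
    ray from every ball towards the whole line, along which the radius
    decreases. The rays of the two balls merge at this radius. *)
Definition meetd (a : K) (r : Z2) (b : K) (s : Z2) : Z2 :=
  let m := Order.min r s in if a == b then m else Order.min m (v (a - b)).

Lemma le_meetd t a r b s :
  (t <= meetd a r b s) = [&& t <= r, t <= s & vle t (a - b)].
Proof.
rewrite /meetd /vle subr_eq0; case: ifP => _ /=; rewrite !le_min ?andbT //.
by rewrite andbA.
Qed.

Lemma meetd_le a r b s :
  [/\ meetd a r b s <= r, meetd a r b s <= s & vle (meetd a r b s) (a - b)].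
Proof. by apply/and3P; rewrite -le_meetd. Qed.

Lemma meetdC a r b s : meetd a r b s = meetd b s a r.
Proof.
have H a' r' b' s' : meetd a' r' b' s' <= meetd b' s' a' r'.
  by rewrite le_meetd vleC; case: (meetd_le a' r' b' s') => -> -> ->.
by apply/Z2_eqP; split; exact: H.
Qed.

Lemma meetd_ultra a r b s c t :
  meetd a r b s <= meetd a r c t \/ meetd b s c t <= meetd a r c t.
Proof.
case: (meetd_le a r b s) (meetd_le b s c t) => h1 h2 h3 [h4 h5 h6].
case/orP: (le_total (meetd a r b s) (meetd b s c t)) => h; [left|right];
  rewrite le_meetd; apply/and3P; split.
- by [].
- exact: le_trans h5.
- by rewrite -(subrKA b); apply: vleD => //; exact: vle_weak h6.
- exact: le_trans h1.
- by [].
- by rewrite -(subrKA b); apply: vleD => //; exact: vle_weak h3.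
Qed.

Lemma meetdd a r s : meetd a r a s = Order.min r s.
Proof. by rewrite /meetd eqxx. Qed.

(** This expresses [meetd] by the order of norms alone. Linear maps preserve
    that order, so this is why they act by isometries. *)
Lemma nrm_leP a r b s c :
  (forall w t, nrm a r w t -> nrm b s w (t + c)) <-> c <= meetd a r b s - r.
Proof.
split=> [h|h [x y] t [/= h1 h2]].
  have c0 : c <= 0.
    by have := h (1, 0) 0; rewrite !nrm_e1 add0r; apply.
  have /nrm_a1[h1 h2] : nrm b s (a, 1) (r + c).
    by apply: h; apply/nrm_a1; rewrite subrr vle0.
  have : r + c <= meetd a r b s by rewrite le_meetd h1 h2 andbT; z2.
  by z2.
case: (meetd_le a r b s) => m1 m2 m3; have c0 : c <= 0 by z2.
split=> /=.
  rewrite (_ : x - b * y = x - a * y + (a - b) * y); last by ring.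
  apply: vleD; first by apply: vle_weak h1; z2.
  rewrite (_ : t + c = (r + c) + (t - r)); last by z2.
  by apply: vleM => //; apply: vle_weak m3; z2.
by apply: vle_weak h2; z2.
Qed.

Definition is_nrm (N : K * K -> Z2 -> Prop) : Prop := exists a r, N = nrm a r.
(** Points are the norms rather than the pairs (a, r), because the same norm
    comes from many centres [a]. *)
Definition norm := {N : K * K -> Z2 -> Prop | is_nrm N}.

Definition mk a r : norm := exist is_nrm (nrm a r) (ex_intro _ a (ex_intro _ r erefl)).

Lemma norm_centerP (p : norm) : {ar : K * Z2 | sval p = nrm ar.1 ar.2}.
Proof.
apply: cid; case: p => N /= [a [r ->]]; by exists (a, r).
Qed.

Definition ctr (p : norm) : K := (sval (norm_centerP p)).1.
Definition rad (p : norm) : Z2 := (sval (norm_centerP p)).2.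

Lemma norm_eq (p q : norm) : sval p = sval q -> p = q.
Proof.
case: p q => [N hN] [N' hN'] /= e; subst N'; congr exist; exact: Prop_irrelevance.
Qed.

Lemma mkK (p : norm) : mk (ctr p) (rad p) = p.
Proof. by apply: norm_eq; rewrite /= /ctr /rad; case: norm_centerP. Qed.

Lemma norm_ind (P : norm -> Prop) : (forall a r, P (mk a r)) -> forall p, P p.
Proof. by move=> h p; rewrite -(mkK p). Qed.

Definition meetn (p q : norm) : Z2 := meetd (ctr p) (rad p) (ctr q) (rad q).

Lemma nrm_inj a r b s : nrm a r = nrm b s <-> r = s /\ vle r (a - b).
Proof.
split=> [e|[<- h]].
  have h1 : 0 <= meetd a r b s - r.
    by apply/nrm_leP => w t; rewrite e addr0.
  have h2 : 0 <= meetd b s a r - s.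
    by apply/nrm_leP => w t; rewrite e addr0.
  move: h1 h2; rewrite (meetdC b); case: (meetd_le a r b s) => m1 m2 m3 h1 h2.
  by split; [|apply: vle_weak m3]; z2.
apply: shifted_nrm; exists 0 => w t; rewrite subr0.
have m : meetd a r b r = r.
  by apply/Z2_eqP; rewrite le_meetd lexx h; case: (meetd_le a r b r).
split; [have := nrm_leP a r b r 0|have := nrm_leP b r a r 0].
all: by rewrite ?(meetdC b) m subrr lexx => -[_ /(_ isT)/(_ w t)]; rewrite addr0.
Qed.

Lemma rad_mk a r : rad (mk a r) = r.
Proof.
by have := congr1 (@sval _ _) (mkK (mk a r)); rewrite nrm_inj; case.
Qed.

(** The radius at which two rays merge does not depend on the chosen
    centres. *)
Lemma meetn_mk a r b s : meetn (mk a r) (mk b s) = meetd a r b s.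
Proof.
have := congr1 (@sval _ _) (mkK (mk a r)); rewrite nrm_inj => -[+ h1].
have := congr1 (@sval _ _) (mkK (mk b s)); rewrite nrm_inj => -[+ h2].
rewrite /meetn; move: (ctr _) (ctr _) (rad _) (rad _) h1 h2 => a' b' r' s' h1 h2 e1 e2.
subst r' s'; suff H a0 b0 a1 b1 : vle r (a0 - a1) -> vle s (b0 - b1) ->
    meetd a0 r b0 s <= meetd a1 r b1 s.
  by apply/Z2_eqP; split; apply: H => //; rewrite vleC.
move=> ha hb; case: (meetd_le a0 r b0 s) => m1 m2 m3.
rewrite le_meetd m1 m2 /=.
rewrite (_ : a1 - b1 = (a0 - b0) - (a0 - a1) + (b0 - b1)); last by ring.
by apply: vleD; [apply: vleB => //; apply: vle_weak ha|apply: vle_weak hb].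
Qed.

(** The path from [p] to [q] descends to the radius where the rays merge, then
    ascends. *)
Definition ndist (p q : norm) : Z2 := rad p + rad q - (meetn p q + meetn p q).

Lemma meetn_le p q : meetn p q <= rad p /\ meetn p q <= rad q.
Proof. by rewrite /meetn; case: (meetd_le (ctr p) (rad p) (ctr q) (rad q)). Qed.

Lemma meetnC p q : meetn p q = meetn q p. Proof. exact: meetdC. Qed.

Lemma meetn_ultra p q r :
  meetn p q <= meetn p r \/ meetn q r <= meetn p r.
Proof. exact: meetd_ultra. Qed.

Lemma meetnn p : meetn p p = rad p.
Proof. by rewrite /meetn meetdd minxx. Qed.

Lemma ndist_ge0 p q : 0 <= ndist p q.
Proof. by case: (meetn_le p q); rewrite /ndist; z2. Qed.

Lemma ndist_eq0 p q : ndist p q = 0 <-> p = q.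
Proof.
split=> [|->]; last by rewrite /ndist meetnn subrr.
rewrite /ndist => h; rewrite -(mkK p) -(mkK q); apply: norm_eq; apply/nrm_inj.
move: h; rewrite /meetn; move: (ctr _) (rad _) (ctr q) (rad q) => a r b s.
case: (meetd_le a r b s) => m1 m2 m3 h; split; [|apply: vle_weak m3]; z2.
Qed.

Lemma ndistC p q : ndist p q = ndist q p.
Proof. by rewrite /ndist (meetnC p) (addrC (rad p)). Qed.

Lemma ndist_triangle p q r : ndist p r <= ndist p q + ndist q r.
Proof.
have := meetn_ultra p q r; case: (meetn_le p q) (meetn_le q r); rewrite /ndist.
move: (meetn p q) (meetn q r) (meetn p r) (rad p) (rad q) (rad r) => a b c e f g.
by move=> h1 h2 [h3 h4] [h5|h5]; z2.
Qed.

Definition norm_space : metricSpace Z2 :=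
  MetricSpace ndist_ge0 ndist_eq0 ndistC ndist_triangle.

(** Up to the radii this is the ultrametric inequality for [meetn]. *)
Lemma ndist_four_point p q r s :
  ndist p q + ndist r s <= ndist p r + ndist q s \/
  ndist p q + ndist r s <= ndist p s + ndist q r.
Proof.
rewrite /ndist.
move: (meetn_ultra p r q) (meetn_ultra p s q) (meetn_ultra r p s) (meetn_ultra r q s).
rewrite (meetnC r q) (meetnC r p) (meetnC s q).
move: (meetn p q) (meetn r s) (meetn p r) (meetn q s) (meetn p s) (meetn q r) => a b c e f g.
move: (rad p) (rad q) (rad r) (rad s) => h i j k.
move=> H1 H2 H3 H4.
suff: c + e <= a + b \/ f + g <= a + b by case=> ?; [left|right]; z2.
case/orP: (le_total (c + e) (a + b)) => X1; [by left|].
case/orP: (le_total (f + g) (a + b)) => X2; [by right|].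
by case: H1 H2 H3 H4 => H1 [] H2 [] H3 [] H4; z2.
Qed.


Lemma ndist_mk a r b s :
  ndist (mk a r) (mk b s) = r + s - (meetd a r b s + meetd a r b s).
Proof. by rewrite /ndist !rad_mk meetn_mk. Qed.

Lemma meetd_trunc a r b s r' s' (m := meetd a r b s) :
  m <= r' <= r -> m <= s' <= s -> meetd a r' b s' = m.
Proof.
move=> /andP[mr rr] /andP[ms ss]; apply/Z2_eqP; rewrite le_meetd.
case: (meetd_le a r b s) (meetd_le a r' b s') => m1 m2 m3 [n1 n2 n3].
rewrite le_meetd mr ms m3 n3 andbT; split=> //.
by rewrite (le_trans n1 rr) (le_trans n2 ss).
Qed.

Lemma ndist_ray a r s : s <= r -> ndist (mk a r) (mk a s) = r - s.
Proof. by move=> sr; rewrite ndist_mk meetdd min_r //; z2. Qed.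

Lemma norm_geodesic (p q : norm_space) : exists S, segment p q S.
Proof.
elim/norm_ind: p => a r; elim/norm_ind: q => b s.
set m := meetd a r b s.
have [mr ms mv] : [/\ m <= r, m <= s & vle m (a - b)] := meetd_le a r b s.
(* The path keeps the centre [a] while the radius decreases from [r] to
   [m], then the centre [b] while it increases to [s]. *)
pose f t : norm_space := if t <= r - m then mk a (r - t) else mk b (t - r + m + m).
exists (f @` [set t | 0 <= t <= r + s - (m + m)]); exists 0, (r + s - (m + m)), f.
split=> //; first by z2.
- suff H t u : 0 <= t -> t <= u -> u <= r + s - (m + m) ->
      ndist (f t) (f u) = u - t.
    move=> t u /andP[t0 t1] /andP[u0 u1] /=.
    case/orP: (le_total t u) => tu; last rewrite ndistC.
      by rewrite (labs_Z2 tu).1 H.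
    by rewrite (labs_Z2 tu).2 H.
  move=> t0 tu u1; rewrite /f; case: (boolP (t <= r - m)) => ht; last first.
    rewrite ifN; last by move: ht tu; z2.
    by rewrite ndistC ndist_ray; move: tu; z2.
  case: (boolP (u <= r - m)) => hu; first by rewrite ndist_ray; move: tu; z2.
  rewrite ndist_mk (@meetd_trunc a r b s); rewrite -?/m.
  + z2.
  + by apply/andP; split; z2.
  + by apply/andP; split; move: hu u1; z2.
- by rewrite /f ifT ?subr0 //; z2.
- rewrite /f; case: ifP => h; last by congr mk; z2.
  apply: norm_eq; apply/nrm_inj.
  have sm : s = m by move: h; z2.
  split; first by rewrite sm; z2.
  by apply: vle_weak mv; z2.
Qed.

Lemma betweenC (p q c : norm_space) : between p q c -> between q p c.
Proof.
by rewrite /between /= (ndistC q c) (ndistC c p) (ndistC q p) addrC.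
Qed.

(** Among the three radii at which the rays merge in pairs, the largest one
    gives the branch point. *)
Lemma norm_median (p q r : norm_space) :
  exists c, [/\ between p q c, between p r c & between q r c].
Proof.
have H (x y z : norm_space) : meetn x z <= meetn x y -> meetn y z <= meetn x y ->
    exists c, [/\ between x y c, between x z c & between y z c].
  elim/norm_ind: x => a r1; elim/norm_ind: y => b r2; elim/norm_ind: z => c r3.
  move=> le1 le2; have := meetn_ultra (mk a r1) (mk b r2) (mk c r3).
  have := meetn_ultra (mk b r2) (mk a r1) (mk c r3).
  rewrite (meetnC (mk b r2) (mk a r1)); move: le1 le2; rewrite !meetn_mk.
  set m := meetd a r1 b r2; set m1 := meetd a r1 c r3; set m2 := meetd b r2 c r3.
  move=> le1 le2 h1 h2; have e12 : m1 = m2.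
    by case: h1 h2 => h1 [] h2; move: le1 le2; z2.
  case: (meetd_le a r1 b r2) (meetd_le a r1 c r3) => k1 k2 k3 [k4 k5 k6].
  rewrite -/m -/m1 in k1 k2 k3 k4 k5 k6.
  exists (mk a m : norm_space); rewrite /between /= !ndist_mk.
  rewrite -/m -/m1 -/m2 meetdd min_r //.
  rewrite (@meetd_trunc a r1 b r2) ?lexx ?k1 ?k2 // -/m.
  rewrite (@meetd_trunc a r1 c r3) ?lexx ?k1 ?le1 ?k5 // -/m1.
  rewrite (meetdC b r2 a m) (@meetd_trunc a r1 b r2) ?lexx ?k1 ?k2 // -/m -e12.
  by split; z2.
have : (meetn p r <= meetn p q /\ meetn q r <= meetn p q) \/
       (meetn p q <= meetn p r /\ meetn q r <= meetn p r) \/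
       (meetn p q <= meetn q r /\ meetn p r <= meetn q r).
  by move: (meetn p r) (meetn p q) (meetn q r) => x y z; z2.
case=> [[h1 h2]|[[h1 h2]|[h1 h2]]].
- exact: H.
- have [|c [c1 c2 c3]] := H p r q h1; first by rewrite meetnC.
  by exists c; split=> //; apply: betweenC.
- have [||c [c1 c2 c3]] := H q r p; rewrite 1?meetnC 1?[meetn r p]meetnC //.
  by exists c; split=> //; apply: betweenC.
Qed.

Lemma norm_tree : is_tree norm_space.
Proof.
apply: hyperbolic_tree.
- exact: ndist_four_point.
- exact: norm_geodesic.
- exact: norm_median.
by split; exact: (mk 0 0).
Qed.

End ValuationTree.

(** * Groups of matrices acting on the tree of norms *)

Section Action.
Variables (K : fieldType) (v : K -> Z2).
Hypothesis vM : forall a b, a != 0 -> b != 0 -> v (a * b) = v a + v b.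
Hypothesis vD : forall a b r, a != 0 -> b != 0 -> a + b != 0 ->
  r <= v a -> r <= v b -> r <= v (a + b).


(** Gaussian elimination. After an exchange of the two forms, the pivot [a1]
    has the smaller weighted valuation, and subtracting a multiple of the first
    form from the second does not change the norm. *)
Lemma shifted_forms (a1 b1 a2 b2 : K) (r1 r2 : Z2) :
  a1 * b2 - b1 * a2 != 0 ->
  exists b s, shifted
    (fun w t => vle v (t - r1) (a1 * w.1 + b1 * w.2) /\
                vle v (t - r2) (a2 * w.1 + b2 * w.2)) (nrm v b s).
Proof.
wlog H : a1 b1 a2 b2 r1 r2 / a1 != 0 /\ vle v (v a1 + r1 - r2) a2.
  move=> W D; have [a10|a10] := eqVneq a1 0.
    have a20 : a2 != 0 by apply: contraNneq D => ->; rewrite a10; apply/eqP; ring.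
    have [||b [s h]] := W a2 b2 a1 b1 r2 r1.
    - by rewrite a10 a20 vle0.
    - by rewrite -oppr_eq0; move: D; congr (is_true (~~ (_ == 0))); ring.
    exists b, s; apply: shifted_trans h; exists 0 => w t; rewrite subr0; tauto.
  have [h|h] := boolP (vle v (v a1 + r1 - r2) a2); first exact: W.
  have /norP[a20 h'] : ~~ ((a2 == 0) || (v a1 + r1 - r2 <= v a2)) by [].
  have [||b [s h1]] := W a2 b2 a1 b1 r2 r1.
  - by rewrite a20 /vle (negPf a10) /=; split=> //; z2.
  - by rewrite -oppr_eq0; move: D; congr (is_true (~~ (_ == 0))); ring.
  exists b, s; apply: shifted_trans h1; exists 0 => w t; rewrite subr0; tauto.
case: H => a10 h D; pose b := - b1 / a1; pose g := b2 + a2 * b.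
have g0 : g != 0.
  apply: contraNneq D => /(congr1 (fun z => z * a1)); rewrite mul0r /g /b => <-.
  by apply/eqP; field.
exists b, (r2 + v g - (r1 + v a1)), (r1 + v a1) => -[x y] t /=.
have -> : a1 * x + b1 * y = a1 * (x - b * y) by rewrite /b; field.
have -> : a2 * x + b2 * y = a2 * (x - b * y) + g * y by rewrite /g; ring.
rewrite /nrm /= (vleMl vM) //.
have -> : t - r1 - v a1 = t - (r1 + v a1) by z2.
have E : vle v (t - r2) (g * y) = vle v (t - (r1 + v a1) - (r2 + v g - (r1 + v a1))) y.
  by rewrite (vleMl vM) //; congr (vle v _ _); z2.
rewrite -E; split=> -[h1 h2]; split=> //.
  rewrite (_ : g * y = a2 * (x - b * y) + g * y - a2 * (x - b * y)); last by ring.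
  apply: (vleB vM vD) => //; rewrite (_ : t - r2 = v a1 + r1 - r2 + (t - (r1 + v a1))); last by z2.
  exact: (vleM vM).
apply: (vleD vD) => //; rewrite (_ : t - r2 = v a1 + r1 - r2 + (t - (r1 + v a1))); last by z2.
exact: (vleM vM).
Qed.

Lemma shifted_precomp_nrm (M M' : 'M[K]_2) a r : M' *m M = 1%:M ->
  exists b s, shifted (fun w => nrm v a r (mulv M w)) (nrm v b s).
Proof.
move=> MM; have D : M 0 0 * M 1 1 - M 0 1 * M 1 0 != 0.
  have /(congr1 determinant) := MM; rewrite det_mulmx det1 (mx2_det M) => /eqP.
  by apply: contraTneq => ->; rewrite mulr0 eq_sym oner_eq0.
have [|b [s h]] := @shifted_forms (M 0 0 - a * M 1 0) (M 0 1 - a * M 1 1)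
    (M 1 0) (M 1 1) 0 r; first by move: D; congr (is_true (~~ (_ == 0))); ring.
exists b, s; apply: shifted_trans h; exists 0 => -[x y] t.
rewrite /nrm /mulv /= !subr0.
by have -> : (M 0 0 - a * M 1 0) * x + (M 0 1 - a * M 1 1) * y =
  M 0 0 * x + M 0 1 * y - a * (M 1 0 * x + M 1 1 * y) by ring.
Qed.

Variables (G : groupType) (rho : G -> 'M[K]_2).
Hypothesis rhoM : forall g h, rho (g * h)%g = rho g *m rho h.
Hypothesis rho1 : rho 1%g = 1%:M.

Lemma rhoV g : rho g^-1%g *m rho g = 1%:M.
Proof. by rewrite -rhoM mulVg. Qed.
Lemma rhoVr g : rho g *m rho g^-1%g = 1%:M.
Proof. by rewrite -rhoM mulgV. Qed.

Lemma norm_actP (g : G) (p : norm v) :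
  {q : norm v | shifted (fun w => sval p (mulv (rho g^-1%g) w)) (sval q)}.
Proof.
apply: cid; elim/norm_ind: p => a r; have [b [s h]] := shifted_precomp_nrm a r (rhoVr g).
by exists (mk v b s).
Qed.

Definition norm_act g p : norm v := sval (norm_actP g p).

Lemma norm_act_shifted g p :
  shifted (fun w => sval p (mulv (rho g^-1%g) w)) (sval (norm_act g p)).
Proof. by rewrite /norm_act; case: norm_actP. Qed.

Lemma shifted_norm (p q : norm v) : shifted (sval p) (sval q) -> p = q.
Proof.
elim/norm_ind: p => a r; elim/norm_ind: q => b s /(shifted_nrm vM) h.
exact: norm_eq.
Qed.

Lemma norm_act1 p : norm_act 1%g p = p.
Proof.
apply: shifted_norm; apply: shifted_trans (shifted_sym (norm_act_shifted 1%g p)) _.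
by exists 0 => w t; rewrite invg1 rho1 mulv1 subr0.
Qed.

Lemma norm_actM g h p : norm_act (g * h)%g p = norm_act g (norm_act h p).
Proof.
apply: shifted_norm; apply: shifted_trans (shifted_sym (norm_act_shifted (g * h)%g p)) _.
apply: shifted_trans (norm_act_shifted g _).
have := shifted_precomp (mulv (rho g^-1%g)) (norm_act_shifted h p).
apply: shifted_trans; exists 0 => w t.
by rewrite invgM rhoM mulvM subr0.
Qed.

Lemma norm_leP (p q : norm v) c :
  (forall w t, sval p w t -> sval q w (t + c)) <-> c <= meetn p q - rad p.
Proof.
elim/norm_ind: p => a r; elim/norm_ind: q => b s.
by rewrite (meetn_mk vM vD) (rad_mk vM vD); exact: nrm_leP.
Qed.

(** By [norm_leP] the difference [meetn p q - rad p] is determined by the order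
    of norms. The linear map preserves this order up to the homotheties [c] and
    [e], and they cancel when the two differences are added. *)
Lemma norm_act_isometry g p q :
  ndist (norm_act g p) (norm_act g q) = ndist p q.
Proof.
have [c hc] := norm_act_shifted g p; have [e he] := norm_act_shifted g q.
have mvK : forall w, mulv (rho g^-1%g) (mulv (rho g) w) = w.
  by move=> w; rewrite -mulvM rhoV mulv1.
have H (p' q' : norm v) (c' e' k : Z2) :
    (forall w t, sval p' (mulv (rho g^-1%g) w) t <-> sval (norm_act g p') w (t - c')) ->
    (forall w t, sval q' (mulv (rho g^-1%g) w) t <-> sval (norm_act g q') w (t - e')) ->
  k <= meetn p' q' - rad p' <->
  k + c' - e' <= meetn (norm_act g p') (norm_act g q') - rad (norm_act g p').
  move=> hp hq; rewrite -!norm_leP; split=> h w t.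
    move=> hw; have := (hp w (t + c')).2; rewrite addrK => /(_ hw)/h/hq.
    by congr (sval _ _ _); z2.
  rewrite -[w in sval p' w]mvK => /hp/h; rewrite (_ : t - c' + _ = t + k - e'); last by z2.
  by move/hq; rewrite mvK.
have h1 k := H p q c e k hc he; have h2 k := H q p e c k he hc.
rewrite /ndist.
move: h1 h2; rewrite (meetnC vM q) (meetnC vM (norm_act g q)).
move: (norm_act g p) (norm_act g q) => p' q'.
move: (meetn p q) (meetn p' q') (rad p) (rad q) (rad p') (rad q') => m m' r s r' s' h1 h2.
have e1 : m' - r' = m - r + c - e.
  have := (h1 (m - r)).1 (lexx _); have := (h1 (m' - r' - c + e)).2.
  rewrite (_ : m' - r' - c + e + c - e = m' - r'); last by z2.
  by rewrite lexx => /(_ isT); z2.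
have e2 : m' - s' = m - s + e - c.
  have := (h2 (m - s)).1 (lexx _); have := (h2 (m' - s' - e + c)).2.
  rewrite (_ : m' - s' - e + c + e - c = m' - s'); last by z2.
  by rewrite lexx => /(_ isT); z2.
by z2.
Qed.

Definition norm_action : isometricAction G (norm_space vM vD) :=
  @IsometricAction _ G (norm_space vM vD) norm_act norm_act1 norm_actM norm_act_isometry.

(** If [g] fixes the class of a norm, then [rho g] multiplies that norm by a
    constant. In an orthogonal basis this bounds the entries, hence the trace
    and the determinant. *)
Lemma fixed_bounded g p : norm_act g p = p ->
  exists c, vle v c (\tr (rho g)) /\ c + c = v (\det (rho g)).
Proof.
move=> gp; have [c hc] := norm_act_shifted g p; rewrite gp in hc.
have mvK w : mulv (rho g^-1%g) (mulv (rho g) w) = w.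
  by rewrite -mulvM rhoV mulv1.
have mvVK w : mulv (rho g) (mulv (rho g^-1%g) w) = w.
  by rewrite -mulvM rhoVr mulv1.
(* A matrix that raises a norm by [e] is tested on the orthogonal basis (1,
   0), (a, 1). *)
have H (M : 'M[K]_2) (e : Z2) :
    (forall w t, sval p w t -> sval p (mulv M w) (t + e)) ->
    vle v e (\tr M) /\ vle v (e + e) (\det M).
  elim/norm_ind: p {gp hc mvK mvVK} => a r h.
  have /= [h1 h2] := h _ _ ((nrm_e1 vM a r 0).2 (lexx _)).
  have /= [|h3 h4] := h (a, 1) r.
    by apply/(nrm_a1 vM); rewrite subrr lexx vle0.
  rewrite /mulv /= !(mulr1, mulr0, addr0, add0r) in h1 h2 h3 h4.
  have -> : \tr M = (M 0 0 - a * M 1 0) + (M 1 0 * a + M 1 1).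
    by rewrite mx2_trace; ring.
  have -> : \det M = (M 0 0 - a * M 1 0) * (M 1 0 * a + M 1 1)
     - M 1 0 * (M 0 0 * a + M 0 1 - a * (M 1 0 * a + M 1 1)).
    by rewrite mx2_det; ring.
  have h5 : vle v e (M 1 0 * a + M 1 1) by apply: vle_weak h4; z2.
  split; first exact: (vleD vD).
  apply: (vleB vM vD); first exact: (vleM vM).
  by rewrite (_ : e + e = (e - r) + (r + e)); [exact: (vleM vM)|z2].
(* The inverse gives the opposite inequality for the determinant. *)
have [|t1 d1] := H (rho g) (- c).
  by move=> w t hw; rewrite -hc mvK.
have [|_ d2] := H (rho g^-1%g) c.
  by move=> w t hw; apply/hc; rewrite addrK.
exists (- c); split=> //.
have := congr1 determinant (rhoV g); rewrite det_mulmx det1 => e.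
have := oner_neq0 K; rewrite -e mulf_eq0 => /norP[n1 n2].
have := vM n1 n2; rewrite e (v1 vM).
move: d1 d2; rewrite /vle (negPf n1) (negPf n2) /=.
move: (v (\det (rho g))) (v (\det (rho g^-1%g))) => x y; z2.
Qed.

(** An isometry of an interval either fixes its ends or exchanges them. *)
Lemma act_image_segment (a : isometricAction G (norm_space vM vD)) g p q S :
  segment p q S -> a g @` S = S -> a g p = p \/ (a g p = q /\ a g q = p).
Proof.
case=> s [t [f [st fiso fs ft ->]]] gS.
have inS u : s <= u <= t -> exists2 u', s <= u' <= t & f u' = a g (f u).
  move=> hu; have : (a g @` (f @` [set u | s <= u <= t])) (a g (f u)).
    by exists (f u) => //; exists u.
  by rewrite gS => -[u' h <-]; exists u'.
have [|x hx ex] := inS s; first by rewrite lexx.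
have [|y hy ey] := inS t; first by rewrite lexx andbT.
have := act_isometry a g (f s) (f t); rewrite -ex -ey !fiso ?lexx ?st //.
rewrite (labs_Z2 st).1 => /labsP e; rewrite -fs -ft -ex -ey.
case/andP: hx hy => x1 x2 /andP[y1 y2]; case: e => e; [right|left].
  split; congr f; z2.
by congr f; z2.
Qed.

Definition hyperbolic (M : 'M[K]_2) : Prop :=
  [/\ \tr M != 0 & v (\tr M) + v (\tr M) < v (\det M)].

(** An element that stabilises a segment fixes an end, or exchanges the ends.
    In the second case its square has a fixed point, hence is trivial; the
    trace being nonzero, the theorem of Cayley and Hamilton makes the matrix
    scalar, and a scalar matrix is not hyperbolic. *)
Lemma hyperbolic_free : (forall g, g <> 1%g -> hyperbolic (rho g)) ->
  acts_freely_on_tree Z2 G.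
Proof.
move=> hyp; exists (norm_space vM vD), norm_action.
have fixed p g : norm_act g p = p -> g = 1%g.
  move=> gp; apply: contrapT => /hyp[t0 lt].
  have [c [ct cd]] := fixed_bounded gp; move: ct lt; rewrite /vle (negPf t0) -cd /=.
  by z2.
split; first exact: norm_tree.
split=> [p g|S g [p [q pq]] gS]; first exact: fixed.
case: (act_image_segment pq gS) => [/fixed//|[e1 e2]].
have gg : (g * g)%g = 1%g.
  by apply: (fixed p); rewrite norm_actM; rewrite /= in e1 e2; rewrite e1 e2.
apply: contrapT => /hyp[t0 lt].
have CH : rho g *m rho g = \tr (rho g) *: rho g - (\det (rho g))%:M.
  rewrite {1 2 4}[rho g]mx2_eta mx2M mx2Z mx2_scalar mx2_trace mx2_det.
  by apply/matrixP => i j; case: (ord2P i) => ->; case: (ord2P j) => ->;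
    rewrite !(mx2E, mxE) /=; ring.
rewrite -rhoM gg rho1 in CH.
have E : rho g = ((1 + \det (rho g)) / \tr (rho g))%:M.
  apply: (scalerI t0); rewrite scale_scalar_mx mulrC divfK // raddfD /= CH.
  by rewrite subrK.
move: lt t0; rewrite E mxtrace_scalar det_scalar.
set a := (_ / _); rewrite -[a *+ 2]mulr_natr expr2 => lt t0.
have Ea : rho g = a%:M := E.
have a2 : a * a = 1.
  have := congr1 (fun M : 'M[K]_2 => M 0 0) (rhoM g g).
  by rewrite gg rho1 Ea -scalar_mxM !mxE eqxx !mulr1n.
have n2 : a * 2%:R * (a * 2%:R) = 2%:R * 2%:R :> K.
  by rewrite mulrACA a2 mul1r.
have a0 : a != 0 by apply/eqP => z; move/eqP: a2; rewrite z mul0r eq_sym oner_eq0.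
have q0 : (2%:R : K) != 0 by apply: contraNneq t0 => ->; rewrite mulr0.
have := lt; rewrite vM // (vM a0 a0).
have va : v a + v a = 0 by rewrite -vM // a2 (v1 vM).
have v2 : 0 <= v 2%:R.
  apply: (vD (oner_neq0 K) (oner_neq0 K)) => //; by rewrite (v1 vM) lexx.
by move: va v2; move: (v a) (v 2%:R) => x y; z2.
Qed.

End Action.

Local Close Scope classical_set_scope.

(** * The lexicographic valuation of rational functions *)

Section LowestTerm.
Variable R : idomainType.
Implicit Types p q : {poly R}.

Definition ordp p : nat := find (fun c => c != 0) p.
Definition lowc p : R := p`_(ordp p).

Lemma has_ordp p : p != 0 -> has (fun c => c != 0) p.
Proof.
move=> p0; apply/hasP; exists (lead_coef p); last by rewrite lead_coef_eq0.
by apply: mem_nth; rewrite prednK // lt0n size_poly_eq0.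
Qed.

Lemma lowc_eq0 p : (lowc p == 0) = (p == 0).
Proof.
have [->|p0] := eqVneq p 0; first by rewrite /lowc nth_default ?eqxx // size_poly0.
by apply/negbTE; apply: (nth_find 0 (has_ordp p0)).
Qed.

Lemma coef_lt_ordp p i : (i < ordp p)%N -> p`_i = 0.
Proof. by move=> /(before_find 0)/negbFE/eqP. Qed.

Lemma ordpE p n : p`_n != 0 -> (forall i, (i < n)%N -> p`_i = 0) ->
  ordp p = n /\ lowc p = p`_n.
Proof.
move=> pn h; suff e : ordp p = n by rewrite /lowc e.
have p0 : p != 0 by apply: contraNneq pn => ->; rewrite coef0.
case: (ltngtP (ordp p) n) => // [/h|/coef_lt_ordp e]; last by rewrite e eqxx in pn.
by move/eqP; rewrite -/(lowc p) lowc_eq0 (negPf p0).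
Qed.

Lemma ordpM p q : p != 0 -> q != 0 ->
  ordp (p * q) = (ordp p + ordp q)%N /\ lowc (p * q) = lowc p * lowc q.
Proof.
move=> p0 q0.
have E : (p * q)`_(ordp p + ordp q) = lowc p * lowc q.
  have h : (ordp p < (ordp p + ordp q).+1)%N by rewrite ltnS leq_addr.
  rewrite coefM (bigD1 (Ordinal h)) //= addKn big1 ?addr0 // => i ne.
  case: (ltngtP i (ordp p)) => hi; first by rewrite coef_lt_ordp ?mul0r.
    by rewrite [X in _ * X]coef_lt_ordp ?mulr0 //; have := ltn_ord i; lia.
  by case/eqP: ne; exact: val_inj.
rewrite -E; apply: ordpE; first by rewrite E mulf_neq0 // lowc_eq0.
move=> i hi; rewrite coefM big1 // => j _.
case: (ltnP j (ordp p)) => hj; first by rewrite coef_lt_ordp ?mul0r.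
by rewrite [X in _ * X]coef_lt_ordp ?mulr0 //; have := ltn_ord j; lia.
Qed.

End LowestTerm.

Section LexicographicValuation.
Variable k : fieldType.
Local Notation D := {poly {poly k}}.
Implicit Types p q : D.

(** The order of a polynomial in the outer variable comes first; the order of
    its lowest coefficient in the inner variable comes second. *)
Definition lexval p : Z2 := (Posz (ordp p), Posz (ordp (lowc p))).

Lemma lexvalM p q : p != 0 -> q != 0 -> lexval (p * q) = lexval p + lexval q.
Proof.
move=> p0 q0; rewrite /lexval; have [-> ->] := ordpM p0 q0.
by have [||-> _] := @ordpM _ (lowc p) (lowc q); rewrite ?lowc_eq0.
Qed.

(** A valuation at least [r] means that the coefficients below [r] vanish,
    which is visibly stable under sums. *)
Lemma le_lexval p (r : Z2) : p != 0 ->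
  reflect (forall i j : nat, ((Posz i, Posz j) : Z2) < r -> p`_i`_j = 0) (r <= lexval p).
Proof.
move=> p0; apply: (iffP idP) => [rp i j ij|h].
  have : ((Posz i, Posz j) : Z2) < lexval p by exact: lt_le_trans rp.
  rewrite /lexval ltNge Z2_leE /=; case: (ltngtP i (ordp p)) => [hi _|hi|-> hj].
  - by rewrite (@coef_lt_ordp _ p) // coef0.
  - lia.
  - by rewrite coef_lt_ordp //; move: hj; rewrite lexx /= -ltNge ltz_nat.
rewrite leNgt; apply/negP => /(h (ordp p) (ordp (lowc p)))/eqP.
by rewrite -/(lowc p) -/(lowc (lowc p)) !lowc_eq0 (negPf p0).
Qed.

Lemma lexvalD p q r : p != 0 -> q != 0 -> p + q != 0 ->
  r <= lexval p -> r <= lexval q -> r <= lexval (p + q).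
Proof.
move=> p0 q0 pq0 /(le_lexval _ p0) hp /(le_lexval _ q0) hq.
by apply/(le_lexval _ pq0) => i j ij; rewrite !coefD hp // hq // addr0.
Qed.

End LexicographicValuation.

Section FractionValuation.
Variables (R : idomainType) (u : R -> Z2).
Hypothesis uM : forall a b, a != 0 -> b != 0 -> u (a * b) = u a + u b.
Hypothesis uD : forall a b r, a != 0 -> b != 0 -> a + b != 0 ->
  r <= u a -> r <= u b -> r <= u (a + b).
Local Notation "x %:F" := (tofrac x).

(** The choice of a numerator and a denominator is made once and for all, in
    Type, so that it can define a function. *)
Lemma fraction_numden (x : {fraction R}) :
  {nd : R * R | nd.2 != 0 /\ x = nd.1%:F / nd.2%:F}.
Proof.
pose z := repr x; exists (\n_z, \d_z); have d0 := denom_ratioP z.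
split=> //; apply: (canRL (mulfK _)); first by rewrite tofrac_eq0.
rewrite -[x]reprK -/z /tofrac; unlock FracField.tofrac.
rewrite -[LHS]FracField.pi_mul; apply/eqP; rewrite FracField.equivf_def /=.
by rewrite /FracField.mulf /= !numden_Ratio ?mulf_neq0 ?oner_neq0 // !mulr1 mulrC.
Qed.

Definition fracval (x : {fraction R}) : Z2 :=
  u (sval (fraction_numden x)).1 - u (sval (fraction_numden x)).2.

Lemma fracvalE n d : n != 0 -> d != 0 -> fracval (n%:F / d%:F) = u n - u d.
Proof.
move=> n0 d0; rewrite /fracval; case: fraction_numden => -[n' d'] /= [d'0].
move/eqP; rewrite eqr_div ?tofrac_eq0 // -!tofracM tofrac_eq => /eqP e.
have n'0 : n' != 0.
  apply: contraNneq n0 => z; move/eqP: e; rewrite z mul0r mulf_eq0 (negPf d'0).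
  by rewrite orbF.
by move/(congr1 u): e; rewrite !uM //; move: (u n) (u d) (u n') (u d'); z2.
Qed.

Lemma fracvalM x y : x != 0 -> y != 0 -> fracval (x * y) = fracval x + fracval y.
Proof.
have [[a b] /= [b0 ->]] := fraction_numden x.
have [[c d] /= [d0 ->]] := fraction_numden y.
rewrite !mulf_eq0 !invr_eq0 !tofrac_eq0 => /norP[a0 _] /norP[c0 _].
rewrite mulf_div -!tofracM !fracvalE ?mulf_neq0 // !uM //.
by move: (u a) (u b) (u c) (u d); z2.
Qed.

Lemma fracvalD x y r : x != 0 -> y != 0 -> x + y != 0 ->
  r <= fracval x -> r <= fracval y -> r <= fracval (x + y).
Proof.
have [[a b] /= [b0 ->]] := fraction_numden x.
have [[c d] /= [d0 ->]] := fraction_numden y.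
rewrite addf_div ?tofrac_eq0 // -!tofracM -tofracD.
rewrite !mulf_eq0 !invr_eq0 !tofrac_eq0 => /norP[a0 _] /norP[c0 _] /norP[s0 _].
rewrite !fracvalE ?mulf_neq0 // => h1 h2.
suff : r + u (b * d) <= u (a * d + c * b) by clear h1 h2; move: (u (b * d)) (u (a * d + c * b)); z2.
apply: uD; rewrite ?mulf_neq0 //; rewrite !uM //;
  by move: h1 h2; move: (u a) (u b) (u c) (u d); z2.
Qed.

End FractionValuation.

Section HyperbolicPolynomials.
Variable k : fieldType.
Local Notation D := {poly {poly k}}.
Local Notation K := {fraction D}.
Local Notation "x %:F" := (tofrac x).

Definition kval : K -> Z2 := fracval (@lexval k).

(** Two reasons for [tau ^+ 2 / d] to have negative valuation. Either [d] but
    not [tau] vanishes with the outer variable, or both are constant in it and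
    the same happens in the inner variable. *)
Definition dominated (tau d : D) : Prop :=
  (tau.[0] != 0 /\ d.[0] = 0) \/
  exists tau0 d0 : {poly k}, [/\ tau = tau0%:P, d = d0%:P, tau0.[0] != 0 & d0.[0] = 0].

(** The scalar [s] does not matter, since hyperbolicity compares the square of
    the trace with the determinant. *)
Lemma dominated_hyperbolic (M : 'M[K]_2) (s : K) (tau d : D) :
  s != 0 -> d != 0 -> \tr M = s * tau%:F -> \det M = s ^+ 2 * d%:F ->
  dominated tau d -> hyperbolic kval M.
Proof.
move=> s0 d0 tE dE dom.
have t0 : tau != 0.
  case: dom => [[h _]|[tau0 [d1 [-> _ h _]]]].
    by apply: contraNneq h => ->; rewrite horner0.
  by rewrite polyC_eq0; apply: contraNneq h => ->; rewrite horner0.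
have frac1 a : a != 0 -> kval a%:F = lexval a.
  move=> a0; rewrite -[a%:F]divr1 -tofrac1 /kval fracvalE ?oner_neq0 //.
    by have := @lexvalM k 1 1 (oner_neq0 _) (oner_neq0 _); rewrite mulr1; move: (lexval 1) (lexval a); z2.
  exact: lexvalM.
have kM := fracvalM (@lexvalM k).
rewrite /hyperbolic tE mulf_neq0 ?tofrac_eq0 //; split=> //.
rewrite dE expr2 /kval !kM ?mulf_neq0 ?tofrac_eq0 // -/kval !frac1 //.
suff : lexval tau + lexval tau < lexval d.
  by move: (lexval tau) (lexval d) (kval s); z2.
have ord0 (A : idomainType) (p : {poly A}) : p.[0] != 0 -> ordp p = 0%N /\ lowc p = p.[0].
  by rewrite horner_coef0 => h; exact: ordpE.
have ordC (A : idomainType) (c : A) : c != 0 -> ordp c%:P = 0%N /\ lowc c%:P = c.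
  by move=> c0; have := ord0 A c%:P; rewrite hornerC => /(_ c0).
have ordS (A : idomainType) (p : {poly A}) : p != 0 -> p.[0] = 0 -> (0 < ordp p)%N.
  move=> p0 h; rewrite lt0n; apply/eqP => e.
  by move/eqP: h; rewrite horner_coef0 -e -/(lowc p) lowc_eq0 (negPf p0).
rewrite /lexval; case: dom => [[a b]|[tau0 [d1 [e1 e2 a b]]]].
  have [-> _] := ord0 _ _ a; have := ordS _ _ d0 b.
  by move: (ordp _) (ordp _) (ordp _) => i j l; rewrite ltNge Z2_leE /=; lia.
rewrite e1 e2 in t0 d0 *; rewrite !polyC_eq0 in t0 d0.
have [-> ->] := ordC _ _ t0; have [-> ->] := ordC _ _ d0.
have [-> _] := ord0 _ _ a; have := ordS _ _ d0 b.
by move: (ordp _) => i; rewrite ltNge Z2_leE /=; lia.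
Qed.

End HyperbolicPolynomials.

(** * The representations of Gamma1 *)

Section WordAction.
Variables (A : choiceType) (R : seq (A * bool) -> seq (A * bool) -> Prop).
Variables (S : Type) (act : S -> A * bool -> S).
Hypothesis actK : forall s l, act (act s l) (inv_letter l) = s.
Hypothesis actR : forall s u v, R u v -> foldl act s u = foldl act s v.

(** An action of the letters in which inverse letters cancel and which respects
    the relations is an action of the presented group. *)
Lemma foldl_eqv u v s : clos_refl_sym_trans _ (word_step R) u v ->
  foldl act s u = foldl act s v.
Proof.
move=> uv; elim: uv s => {u v} [u v []|//|u v _ IH s|u v w _ IH1 _ IH2 s].
- by move=> p l q s; rewrite !foldl_cat /= actK.
- by move=> p u' v' q uv s; rewrite !foldl_cat (actR _ uv).
- by rewrite IH.
- by rewrite IH1.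
Qed.

End WordAction.

(** Indices of three half-turns, also used as the integers modulo 3. *)
Variant tri := I0 | I1 | I2.

Definition tri_code (i : tri) : 'I_3 :=
  match i with I0 => @Ordinal 3 0 isT | I1 => @Ordinal 3 1 isT | I2 => @Ordinal 3 2 isT end.
Definition tri_decode (i : 'I_3) : tri :=
  match val i with 0%N => I0 | 1%N => I1 | _ => I2 end.
Lemma tri_codeK : cancel tri_code tri_decode.
Proof. by case. Qed.
HB.instance Definition _ := Finite.copy tri (can_type tri_codeK).

Section Matrices.
Variable A : comPzRingType.
Variables (U lam : A).

Definition delta : A := (1 - U ^+ 2) * (1 - 9%:R * U ^+ 2).

(** The limits of the vectors [fixpt] at [U = 1], up to scalars. *)
Definition vec (i : tri) : A * A :=
  match i with I0 => (1, -1) | I1 => (0, 1) | I2 => (1, 0) end.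

(** Up to a scalar, these are three involutions: their squares are the scalar
    matrix [delta]. The fundamental group of a pair of pants is the group of
    even words in three half-turns, and its boundary curves are the products of
    two of them. At [U = 1] the three matrices become nilpotent of rank one. *)
Definition invol (i : tri) : 'M[A]_2 :=
  match i with
  | I0 => mx2 (5%:R * U ^+ 2 - 1) (4%:R * U ^+ 2) (- (4%:R * U ^+ 2)) (1 - 5%:R * U ^+ 2)
  | I1 => mx2 (1 - U ^+ 2) (2%:R * (1 - U ^+ 2)) (- (4%:R * U ^+ 2)) (U ^+ 2 - 1)
  | I2 => mx2 (1 - U ^+ 2) (4%:R * U ^+ 2) (2%:R * (U ^+ 2 - 1)) (U ^+ 2 - 1)
  end.

(** The vector [fixpt (i, j)] is an eigenvector of [invol i *m invol j]; the
    other eigenvector is [fixpt (j, i)]. *)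
Definition fixpt (e : tri * tri) : A * A :=
  match e with
  | (I2, I1) => (1 + U, U - 1) | (I1, I2) => (U - 1, U + 1)
  | (I2, I0) => (2%:R * U, 1 - U) | (I0, I2) => (2%:R * U, - U - 1)
  | (I1, I0) => (U - 1, - (2%:R * U)) | (I0, I1) => (U + 1, - (2%:R * U))
  | _ => (0, 0)
  end.

Definition swap (e : tri * tri) := (e.2, e.1).

Lemma invol_sqr i : invol i *m invol i = delta%:M.
Proof.
by case: i; rewrite /invol mx2M mx2_scalar /delta; congr mx2; ring.
Qed.

Lemma det_invol i : \det (invol i) = - delta.
Proof. by case: i; rewrite /invol mx2_det !mx2E /delta; ring. Qed.

Definition fixsgn (i j : tri) : bool :=
  match i, j with I1, I2 | I2, I0 | I0, I1 => true | _, _ => false end.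

(** The half-turn [invol i] reverses the product of [invol i] and [invol j], so
    it exchanges the two eigenvectors. *)
Lemma invol_fixpt i j : i != j ->
  mulv (invol i) (fixpt (j, i)) =
  scalev ((-1) ^+ fixsgn i j * (U + 1) * (3%:R * U - 1)) (fixpt (i, j)).
Proof.
by case: i; case: j => //= _; rewrite /mulv /scalev /invol !mx2E /=; congr pair; ring.
Qed.

(** A pair [z] stands for a stable letter: its first component tells y from t,
    and its second one tells whether the letter is inverted, as in words. *)
Definition zinv (z : bool * bool) := (z.1, ~~ z.2).

(** The stable letter [z] conjugates the boundary curve of the half-turns
    [killed z] into that of [killed (zinv z)]. The order of the pair records
    which of the two eigenvectors is in the kernel of [zmx z] at [lam = 0]. *)
Definition killed (z : bool * bool) : tri * tri :=
  match z with
  | (false, false) => (I0, I2) | (false, true) => (I2, I1)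
  | (true, false) => (I1, I2) | (true, true) => (I1, I0)
  end.

Definition inpair (e : tri * tri) (i : tri) := (i == e.1) || (i == e.2).

(** A matrix carrying the eigenvectors of one boundary curve to those of
    another intertwines the two curves. One parameter [lam] is free, namely the
    ratio of the two factors; at [lam = 0] the matrix has rank one. *)
Definition zmx (z : bool * bool) : 'M[A]_2 :=
  rank1 (fixpt (killed (zinv z))) (fixpt (killed z))
  - lam *: rank1 (fixpt (swap (killed (zinv z)))) (fixpt (swap (killed z))).

(** How conjugation by [z] acts on the half-turns of its boundary curve. *)
Definition shift_tri (z : bool * bool) (i : tri) : tri :=
  match z, i with
  | (false, _), I0 => I1 | (false, _), I1 => I0 | (false, _), I2 => I2
  | (true, false), I2 => I1 | (true, false), I1 => I0 | (true, false), I0 => I2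
  | (true, true), I1 => I2 | (true, true), I0 => I1 | (true, true), I2 => I0
  end.

Lemma zmxE z : zmx z =
  let: (a, b) := (fixpt (killed (zinv z)), fixpt (killed z)) in
  let: (a', b') := (fixpt (swap (killed (zinv z))), fixpt (swap (killed z))) in
  mx2 (- (a.1 * b.2) + lam * (a'.1 * b'.2)) (a.1 * b.1 - lam * (a'.1 * b'.1))
      (- (a.2 * b.2) + lam * (a'.2 * b'.2)) (a.2 * b.1 - lam * (a'.2 * b'.1)).
Proof.
rewrite /zmx; apply/matrixP => i j; case: (ord2P i) => ->; case: (ord2P j) => ->;
  by rewrite !(mx2E, mxE) /=; ring.
Qed.

Lemma zmx_intertwine z i j : inpair (killed z) i -> inpair (killed z) j ->
  zmx z *m (invol i *m invol j) =
  invol (shift_tri z i) *m invol (shift_tri z j) *m zmx z.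
Proof.
by case: z => [] [] []; case: i => //= _; case: j => //= _;
  rewrite zmxE /= !mx2M; congr mx2; ring.
Qed.

Lemma zmxK z : zmx (zinv z) *m zmx z =
  ((-1) ^+ z.1 * 16%:R * U ^+ 2 * lam)%:M.
Proof.
by case: z => [] [] []; rewrite !zmxE /= mx2M mx2_scalar; congr mx2; ring.
Qed.

Lemma det_zmx z : \det (zmx z) = (-1) ^+ (~~ z.1) * 16%:R * U ^+ 2 * lam.
Proof. by case: z => [] [] []; rewrite zmxE /= mx2_det !mx2E /=; ring. Qed.

Definition invw (l : seq tri) : 'M[A]_2 := foldr (fun i M => invol i *m M) 1%:M l.

End Matrices.

Section Naturality.
Variables (A B : comPzRingType) (th : {rmorphism A -> B}) (U lam : A).

Definition map2v (w : A * A) : B * B := (th w.1, th w.2).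

Lemma map_mx2 (a b c d : A) : map_mx th (mx2 a b c d) = mx2 (th a) (th b) (th c) (th d).
Proof. by rewrite [LHS]mx2_eta; congr mx2; rewrite mxE mx2E. Qed.

Definition rmE := (rmorphB, rmorphD, rmorphN, rmorphM, rmorphXn, rmorph_nat, rmorph1, rmorph0).

Lemma map_delta : th (delta U) = delta (th U).
Proof. by rewrite /delta !rmE. Qed.

Lemma map_invol i : map_mx th (invol U i) = invol (th U) i.
Proof. by case: i; rewrite /= map_mx2 !rmE. Qed.

Lemma map_fixpt e : map2v (fixpt U e) = fixpt (th U) e.
Proof. by case: e => [] [] []; rewrite /map2v /= !rmE. Qed.

Lemma map_rank1 u w : map_mx th (rank1 u w) = rank1 (map2v u) (map2v w).
Proof. by rewrite /rank1 map_mx2 !rmE. Qed.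

Lemma map_zmx z : map_mx th (zmx U lam z) = zmx (th U) (th lam) z.
Proof. by rewrite /zmx map_mxB map_mxZ !map_rank1 !map_fixpt. Qed.

Lemma map_invw l : map_mx th (invw U l) = invw (th U) l.
Proof. by elim: l => [|i l IH] /=; rewrite ?map_mx1 ?map_mxM ?map_invol ?IH. Qed.

Lemma map_mulv M w : map2v (mulv M w) = mulv (map_mx th M) (map2v w).
Proof. by rewrite /map2v /mulv !mxE /= !rmE. Qed.

Lemma map_det2 u w : th (det2 u w) = det2 (map2v u) (map2v w).
Proof. by rewrite /det2 !rmE. Qed.

End Naturality.

(** ** The action of the group *)
Local Open Scope group_scope.

Definition gen (a : 'I_3) : Gamma1 := @cls (word_preGroup Gamma1_rel) [:: (a, false)].
Notation gx := (gen gen_x).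
Notation gy := (gen gen_y).
Notation gt := (gen gen_t).

Lemma clsW (l : 'I_3 * bool) w :
  @cls (word_preGroup Gamma1_rel) (l :: w) =
  (if l.2 then (gen l.1)^-1 else gen l.1) * @cls (word_preGroup Gamma1_rel) w.
Proof.
case: l => a [] /=; last by rewrite /gen -clsM.
by rewrite /gen -clsV -clsM.
Qed.

Lemma Gamma1_relE : gt * gx * gt^-1 = gx^-1 * gy^-1 * gx * gy.
Proof.
have : @cls (word_preGroup Gamma1_rel) [:: (gen_t, false); (gen_x, false); (gen_t, true)] =
  @cls (word_preGroup Gamma1_rel) [:: (gen_x, true); (gen_y, true); (gen_x, false); (gen_y, false)].
  apply/cls_eq; apply: rst_step.
  by apply: (@WordRel _ Gamma1_rel [::] [:: _; _; _] [:: _; _; _; _] [::]); split.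
rewrite !clsW /= -[cls _]/(1 : Gamma1) !mulg1 !mulgA; exact.
Qed.

Section Representation.
Variables (K : fieldType) (U lam : K).
Hypothesis nz : [/\ (2%:R : K) != 0, U != 0, delta U != 0 & lam != 0].
Local Open Scope ring_scope.
Local Notation I := (invol U).
Local Notation Z := (zmx U lam).

(** The relation does not constrain the scalar factors of y and t. With this
    choice the images of y and t at [lam = 1] are integral matrices. *)
Definition zscal (z : bool * bool) : K :=
  if z.2 then (4%:R * U * lam)^-1 else (-1) ^+ z.1 * (4%:R * U)^-1.

(** The generator x is sent to the product of the half-turns [I2] and [I1],
    divided by [delta] so as to have determinant 1. *)
Definition letter (l : 'I_3 * bool) : 'M[K]_2 :=
  match val l.1 with
  | 0%N => (delta U)^-1 *: (if l.2 then I I1 *m I I2 else I I2 *m I I1)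
  | 1%N => zscal (false, l.2) *: Z (false, l.2)
  | _ => zscal (true, l.2) *: Z (true, l.2)
  end.

Lemma nz4 : (4%:R : K) != 0.
Proof. by have [n2 _ _ _] := nz; rewrite (_ : 4 = 2 * 2)%N // natrM mulf_neq0. Qed.

Lemma letter_z g s : letter (if g then gen_t else gen_y, s) = zscal (g, s) *: Z (g, s).
Proof. by case: g. Qed.

Lemma letterK l : letter l *m letter (inv_letter l) = 1%:M.
Proof.
have [n2 nU nd nl] := nz; have n4 := nz4; case: l => -[[|[|[|//]]] h] s;
  rewrite /letter /inv_letter /=.
- have E i j : (delta U)^-1 *: (I i *m I j) *m ((delta U)^-1 *: (I j *m I i)) = 1%:M.
    rewrite -scalemxAl -scalemxAr mulmxA -(mulmxA (I i)) invol_sqr mul_mx_scalar.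
    by rewrite -scalemxAl invol_sqr !scale_scalar_mx; congr (_%:M); field.
  by case: s; [exact: (E I1 I2)|exact: (E I2 I1)].
- rewrite -scalemxAl -scalemxAr scalerA.
  have := zmxK U lam (zinv (false, s)); rewrite /zinv /= negbK => ->.
  rewrite scale_scalar_mx /zscal /=; congr (_%:M).
  by case: s => /=; field; rewrite ?n4 ?nU ?nl.
- rewrite -scalemxAl -scalemxAr scalerA.
  have := zmxK U lam (zinv (true, s)); rewrite /zinv /= negbK => ->.
  rewrite scale_scalar_mx /zscal /=; congr (_%:M).
  by case: s => /=; field; rewrite ?n4 ?nU ?nl.
Qed.


Definition wmx (w : seq ('I_3 * bool)) : 'M[K]_2 :=
  foldl (fun (M : 'M[K]_2) l => M *m letter l) 1%:M w.

Lemma foldl_wmx M w : foldl (fun (M : 'M[K]_2) l => M *m letter l) M w = M *m wmx w.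
Proof.
rewrite /wmx; elim: w M => [|l w IH] M /=; first by rewrite mulmx1.
by rewrite IH (IH (1%:M *m _)) mul1mx mulmxA.
Qed.

Lemma wmx_cat u w : wmx (u ++ w) = wmx u *m wmx w.
Proof. by rewrite /wmx foldl_cat foldl_wmx. Qed.

Lemma wmx1 l : wmx [:: l] = letter l. Proof. by rewrite /wmx /= mul1mx. Qed.
Lemma wmx_cons l w : wmx (l :: w) = letter l *m wmx w.
Proof. by rewrite -cat1s wmx_cat wmx1. Qed.

(** The relation is equivalent to y (x t x) = x y t. The intertwining property
    moves t and then y to the right of the half-turns, where both sides
    agree. *)
Lemma wmx_rel u w : Gamma1_rel u w -> wmx u = wmx w.
Proof.
case=> -> ->; set x := (gen_x, false); set y := (gen_y, false); set t := (gen_t, false).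
have [n2 nU nd nl] := nz.
rewrite !wmx_cons /wmx /= !mulmx1.
have kx : letter x *m letter (gen_x, true) = 1%:M by exact: (letterK x).
have kx' : letter (gen_x, true) *m letter x = 1%:M by exact: (letterK (gen_x, true)).
have ky : letter y *m letter (gen_y, true) = 1%:M by exact: (letterK y).
have kt : letter t *m letter (gen_t, true) = 1%:M by exact: (letterK t).
have ty z i j : inpair (killed z) i -> inpair (killed z) j ->
    letter (if z.1 then gen_t else gen_y, z.2) *m (I i *m I j)
    = I (shift_tri z i) *m I (shift_tri z j) *m letter (if z.1 then gen_t else gen_y, z.2).
  move=> hi hj; have := zmx_intertwine U lam hi hj.
  by rewrite letter_z -surjective_pairing -scalemxAl => ->; rewrite scalemxAr.
have yb : letter y *m (I I2 *m I I0) = I I2 *m I I1 *m letter y := ty (false, false) I2 I0 isT isT.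
have tx : letter t *m (I I2 *m I I1) = I I1 *m I I0 *m letter t := ty (true, false) I2 I1 isT isT.
have xE : letter x = (delta U)^-1 *: (I I2 *m I I1) by [].
have E : letter y *m letter x *m letter t *m letter x = letter x *m letter y *m letter t.
  have -> : letter y *m letter x *m letter t *m letter x =
      letter y *m (letter x *m ((delta U)^-1 *: (I I1 *m I I0))) *m letter t.
    by rewrite -!mulmxA; congr (_ *m (_ *m _)); rewrite xE -scalemxAr tx -?scalemxAl ?mulmxA.
  have -> : letter x *m ((delta U)^-1 *: (I I1 *m I I0)) = (delta U)^-1 *: (I I2 *m I I0).
    rewrite xE -scalemxAl -scalemxAr mulmxA -(mulmxA (I I2)) invol_sqr mul_mx_scalar.
    by rewrite -scalemxAl [X in _ *: X]scalerA mulVf // scale1r.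
  by rewrite -(scalemxAr _ (letter y)) yb (scalemxAl _ _ (letter y)).

have -> : letter t *m (letter x *m letter (gen_t, true)) =
    letter (gen_x, true) *m (letter x *m letter t *m letter x) *m letter (gen_t, true).
  by rewrite !mulmxA kx' mul1mx.
have ky' : letter (gen_y, true) *m letter y = 1%:M by exact: (letterK (gen_y, true)).
have -> : letter x *m letter t *m letter x =
    letter (gen_y, true) *m (letter x *m letter y *m letter t).
  by rewrite -E !mulmxA ky' mul1mx.
by rewrite -!mulmxA kt mulmx1.
Qed.

Definition rep (g : Gamma1) : 'M[K]_2 := wmx (repr g).

Lemma rep_cls w : rep (@cls (word_preGroup Gamma1_rel) w) = wmx w.
Proof.
apply: (@foldl_eqv _ Gamma1_rel); last exact: (@repr_cls (word_preGroup Gamma1_rel) w).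
  by move=> M l; rewrite -mulmxA letterK mulmx1.
by move=> M u v uv; rewrite !foldl_wmx (wmx_rel uv).
Qed.

Lemma repM g h : rep (g * h)%g = rep g *m rep h.
Proof.
by rewrite -(clsK g) -(clsK h) -clsM !rep_cls -wmx_cat.
Qed.

Lemma rep1 : rep 1%g = 1%:M. Proof. exact: rep_cls. Qed.

Lemma rep_gen a : rep (gen a) = letter (a, false).
Proof. by rewrite /gen rep_cls wmx1. Qed.

Lemma repV g : rep g^-1%g *m rep g = 1%:M.
Proof. by rewrite -repM mulVg rep1. Qed.
Lemma repVr g : rep g *m rep g^-1%g = 1%:M.
Proof. by rewrite -repM mulgV rep1. Qed.

End Representation.

Local Close Scope group_scope.
Local Close Scope ring_scope.

(** * Values of pairings *)

Local Open Scope group_scope.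

(** The second generator of the free group of the pair of pants; the first
    one is x, and y conjugates [gb] to x. *)
Definition gb : Gamma1 := gy^-1 * gx * gy.

(** The pair of pants group is generated by the products of two of three
    half-turns. This is the product of [i] and [I2]; the product of [i] and [j]
    is therefore [turn i * (turn j)^-1]. *)
Definition turn (i : tri) : Gamma1 :=
  match i with I0 => gb^-1 | I1 => gx^-1 | I2 => 1 end.

(** The value in Gamma1 of a word of even length in the half-turns. A single
    half-turn has no value in Gamma1; the boolean tells whether the position of
    a letter is even or odd. *)
Fixpoint pval (s : bool) (l : seq tri) : Gamma1 :=
  if l is i :: l' then (if s then (turn i)^-1 else turn i) * pval (~~ s) l' else 1.

Lemma pval_cat s l1 l2 : pval s (l1 ++ l2) = pval s l1 * pval (s (+) odd (size l1)) l2.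
Proof.
elim: l1 s => [|i l IH] s /=; first by rewrite mul1g addbF.
by rewrite IH mulgA addNb addbN.
Qed.

Notation alternating := (sorted (fun i j : tri => i != j)).

Definition redcons (i : tri) (l : seq tri) : seq tri :=
  if l is j :: l' then if i == j then l' else i :: l else [:: i].
Definition red (l : seq tri) : seq tri := foldr redcons [::] l.

Lemma red_alternating l : alternating (red l).
Proof.
elim: l => [|i l] //=; rewrite /redcons; case: (red l) => [|j l'] //= h.
by case: eqVneq => [_|ne] /=; [exact: path_sorted h|rewrite ne h].
Qed.

Lemma red_odd l : odd (size (red l)) = odd (size l).
Proof.
elim: l => [|i l] //= <-; rewrite /redcons; case: (red l) => [|j l'] //=.
by case: eqVneq => //= _; rewrite negbK.
Qed.

Lemma red_pval s l : pval s (red l) = pval s l.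
Proof.
elim: l s => [|i l IH] s //=; rewrite -IH /redcons; case: (red l) => [|j l'] //=.
case: eqVneq => [->|_] //=; rewrite mulgA negbK.
by case: s; rewrite /= ?mulVg ?mulgV mul1g.
Qed.

Lemma even_ind (P : seq tri -> Prop) : P [::] ->
  (forall i j l, ~~ odd (size l) -> P l -> P [:: i, j & l]) ->
  forall l, ~~ odd (size l) -> P l.
Proof.
move=> P0 PS l; have [n] := ubnP (size l); elim: n l => // n IH [|i [|j l]] //= lt.
by rewrite negbK => ol; apply: PS => //; apply: IH => //; lia.
Qed.

Definition zval (z : bool * bool) : Gamma1 :=
  let g := if z.1 then gt else gy in if z.2 then g^-1 else g.

Lemma zvalV z : zval (zinv z) = (zval z)^-1.
Proof. by case: z => g [] /=; rewrite /zval /= ?invgK. Qed.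

(** The defining relations of the double HNN extension: y and t act on boundary
    curves as [shift_tri] does on half-turns. *)
Lemma turn_pinch z i j : inpair (killed z) i -> inpair (killed z) j ->
  zval z * (turn i * (turn j)^-1) * (zval z)^-1 =
  turn (shift_tri z i) * (turn (shift_tri z j))^-1.
Proof.
have E (w k m k' m' : Gamma1) : w * (k * m^-1) * w^-1 = k' * m'^-1 ->
    w * (m * k^-1) * w^-1 = m' * k'^-1.
  by move=> /(congr1 (fun z : Gamma1 => z^-1)); rewrite !invgM !invgK !mulgA.
have eb : gt * gx * gt^-1 = gx^-1 * gb by rewrite Gamma1_relE /gb !mulgA.
have yb : gy * gb * gy^-1 = gx by rewrite /gb !mulgA mulgV mul1g mulgK.
have y1 : zval (false, false) * (turn I2 * (turn I0)^-1) * (zval (false, false))^-1 =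
    turn I2 * (turn I1)^-1 by rewrite /zval /= !mul1g !invgK yb.
have y2 : zval (false, true) * (turn I2 * (turn I1)^-1) * (zval (false, true))^-1 =
    turn I2 * (turn I0)^-1 by rewrite /zval /= !mul1g !invgK.
have t1 : zval (true, false) * (turn I2 * (turn I1)^-1) * (zval (true, false))^-1 =
    turn I1 * (turn I0)^-1 by rewrite /zval /= !mul1g !invgK eb.
have t2 : zval (true, true) * (turn I1 * (turn I0)^-1) * (zval (true, true))^-1 =
    turn I2 * (turn I1)^-1.
  by rewrite /zval /= !mul1g !invgK -eb !mulgA mulVg mul1g mulgVK.
have [->|] := eqVneq i j; first by rewrite !mulgV mulg1 mulgV.
case: z => [] [] []; case: i => //; case: j => // _ _ _; by [|apply: E].
Qed.

Lemma pval_pinch z l : all (inpair (killed z)) l -> ~~ odd (size l) ->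
  zval z * pval false l * (zval z)^-1 = pval false (map (shift_tri z) l).
Proof.
move=> + ol; elim/even_ind: l / ol => [|i j l ol IH] /=; first by rewrite mulg1 mulgV.
move=> /and3P[hi hj hl]; rewrite -(IH hl) !mulgA -turn_pinch // !mulgA.
by rewrite mulgVK.
Qed.

Notation zword := (seq ((bool * bool) * seq tri)).

Definition eval (e : zword) : Gamma1 :=
  foldr (fun zp g => zval zp.1 * pval false zp.2 * g) 1 e.

Lemma eval_cat e e' : eval (e ++ e') = eval e * eval e'.
Proof. by elim: e => [|zp e IH] /=; rewrite ?mul1g // IH !mulgA. Qed.

Definition conjugate (g h : Gamma1) : Prop := exists k, g = k * h * k^-1.
Lemma conj_refl g : conjugate g g. Proof. by exists 1; rewrite invg1 mulg1 mul1g. Qed.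
Lemma conj_trans g h k : conjugate g h -> conjugate h k -> conjugate g k.
Proof. by move=> [a ->] [b ->]; exists (a * b); rewrite invgM !mulgA. Qed.
Lemma conjC (g h : Gamma1) : conjugate (g * h) (h * g).
Proof. by exists g; rewrite mulgA mulgK. Qed.

(** ** Pairings *)

Section Pairing.
Local Open Scope ring_scope.
Local Notation A := {poly rat}.
Definition U0 : A := 1 + 'X.

Definition ev0 : {rmorphism A -> rat} := horner_eval (0 : rat).
Lemma ev0U : ev0 U0 = 1.
Proof. by rewrite /ev0 /= /horner_eval /U0 hornerD hornerC hornerX addr0. Qed.

(** At [lam = 0] the product of two stable letters separated by the word [l] of
    half-turns is this number times a matrix of rank one. *)
Definition pairing (e : tri * tri) (l : seq tri) (e' : tri * tri) : A :=
  det2 (fixpt U0 e) (mulv (invw U0 l) (fixpt U0 e')).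

Lemma vec_ne i j : i != j -> det2 (vec rat i) (vec rat j) != 0.
Proof. by case: i; case: j. Qed.

Lemma invol_at1 i : invol (1 : rat) i = 4%:R *: rank1 (vec rat i) (vec rat i).
Proof. by case: i; rewrite /rank1 mx2Z /=; congr mx2. Qed.

Lemma fixpt_at1 i j : i != j ->
  exists2 c, c != 0 & fixpt (1 : rat) (i, j) = scalev c (vec rat i).
Proof.
by case: i; case: j => // _; (exists 2%:R + exists (-2%:R)).
Qed.

(** At [U = 1] the half-turn [i] becomes a nilpotent matrix with kernel and
    image spanned by [vec i], and different half-turns have different lines. So
    no alternating product vanishes. *)
Lemma chain_ne0 l i j : path (fun i j => i != j) i (rcons l j) ->
  det2 (vec rat i) (mulv (invw 1 l) (vec rat j)) != 0.
Proof.
elim: l i => [|a l IH] i /=; first by rewrite andbT mulv1; exact: vec_ne.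
move=> /andP[ia h]; rewrite mulvM invol_at1.
have -> w : mulv (4%:R *: rank1 (vec rat a) (vec rat a)) w =
    scalev (4%:R * det2 (vec rat a) w) (vec rat a).
  by rewrite /mulv /rank1 !mxE /= /scalev /det2; congr pair; ring.
by rewrite det2Zr !mulf_neq0 ?vec_ne // IH.
Qed.

Lemma pairing_ne0 i j l i' j' : i != j -> i' != j' ->
  path (fun i j => i != j) i (rcons l i') -> pairing (i, j) l (i', j') != 0.
Proof.
move=> ij ij' h; suff : ev0 (pairing (i, j) l (i', j')) != 0.
  by apply: contraNneq => ->; rewrite rmorph0.
rewrite /pairing map_det2 map_mulv !map_fixpt map_invw ev0U.
have [c c0 ->] := fixpt_at1 ij; have [c' c0' ->] := fixpt_at1 ij'.
by rewrite mulvZ det2Zl det2Zr !mulf_neq0 // chain_ne0.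
Qed.

Lemma delta0 : delta U0 != 0.
Proof.
pose ev1 : {rmorphism A -> rat} := horner_eval (1 : rat).
have e : ev1 U0 = 2%:R.
  by rewrite /ev1 /= /horner_eval /U0 hornerD hornerC hornerX.
apply/eqP => /(congr1 ev1).
rewrite map_delta e rmorph0.
have -> : delta (2%:R : rat) = 105%:R by rewrite /delta; ring.
by move/eqP; rewrite pnatr_eq0.
Qed.

Lemma fixscal i j : (-1) ^+ fixsgn i j * (U0 + 1) * (3%:R * U0 - 1) != 0.
Proof.
move: ev0U; move: U0 => u eu; apply/eqP => /(congr1 ev0).
rewrite !rmE eu -mulrA; move/eqP.
by rewrite mulf_eq0 expf_eq0 oppr_eq0 oner_eq0 andbF.
Qed.

(** By [invol_fixpt] a half-turn next to one of its eigenvectors only changes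
    the eigenvector. *)
Lemma pairing_cons i j l e : i != j ->
  pairing (i, j) (i :: l) e = 0 -> pairing (j, i) l e = 0.
Proof.
move=> ij; rewrite /pairing /= mulvM => /(congr1 ( *%R ((-1) ^+ fixsgn i j * (U0 + 1) * (3%:R * U0 - 1)))).
rewrite mulr0 -det2Zl -invol_fixpt // det2_mulv det_invol => /eqP.
by rewrite mulf_eq0 oppr_eq0 (negPf delta0) => /eqP.
Qed.

Lemma invw_rcons (R : comPzRingType) (U : R) l i : invw U (rcons l i) = invw U l *m invol U i.
Proof. by elim: l => [|j l IH] /=; rewrite ?mulmx1 ?mul1mx // IH mulmxA. Qed.

Lemma pairing_rcons e l i j : i != j ->
  pairing e (rcons l i) (i, j) = 0 -> pairing e l (j, i) = 0.
Proof.
move=> ij; rewrite /pairing invw_rcons mulvM => /(congr1 ( *%R ((-1) ^+ fixsgn i j * (U0 + 1) * (3%:R * U0 - 1)))).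
rewrite mulr0 -det2Zr -mulvZ -mulvZ -invol_fixpt // -[X in mulv _ X]mulvM invol_sqr.
have -> w : mulv (delta U0)%:M w = scalev (delta U0) w.
  by rewrite /mulv !mxE /= /scalev; congr pair; ring.
rewrite mulvZ det2Zr => /eqP; by rewrite mulf_eq0 (negPf delta0) => /eqP.
Qed.

(** The pairing vanishes only if the word can be pinched. Half-turns at the
    ends of the word that belong to the adjacent boundary curve are absorbed by
    the eigenvectors. When none is left, the value at [U = 1] is nonzero unless
    the word is empty, and then the two lines coincide only if the vectors are
    the same. *)
Lemma pairing_eq0 i j l i' j' : i != j -> i' != j' -> alternating l ->
  pairing (i, j) l (i', j') = 0 ->
  all (inpair (i, j)) l /\ (i', j') = if odd (size l) then (j, i) else (i, j).
Proof.
have [n] := ubnP (size l); elim: n l i j i' j' => // n IH l i j i' j' lt ij ij' al z.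
case: l => [|a l] in lt al z *.
  split=> //=; have [ii|ne] := eqVneq i i'; last first.
    by have := @pairing_ne0 i j [::] i' j' ij ij'; rewrite z eqxx /= ne => /(_ isT).
  subst i'; have [<-//|jj] := eqVneq j j'.
  have := @pairing_ne0 j i [::] j' i; rewrite eq_sym ij eq_sym ij' /= jj => /(_ isT isT isT).
  have cz i1 i2 : (-1) ^+ fixsgn i1 i2 * (U0 + 1) * (3%:R * U0 - 1) != 0 by exact: fixscal.
  move: z; rewrite /pairing /= !mulv1 => z; case/eqP.
  apply: (mulfI delta0); rewrite mulr0 -[LHS]opprK -mulNr -(det_invol U0 i) -det2_mulv.
  by rewrite !invol_fixpt // det2Zl det2Zr z !mulr0 oppr0.
have ji : j != i by rewrite eq_sym.
have ji' : j' != i' by rewrite eq_sym.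
have [ai|ai] := eqVneq a i.
  subst a; have lt' : (size l < n)%N by move: lt => /=; lia.
  have [h1 h2] := IH l j i i' j' lt' ji ij' (path_sorted al) (pairing_cons ij z).
  split; first by rewrite /= {1}/inpair eqxx /=; apply: sub_all h1 => k; rewrite /inpair orbC.
  by rewrite h2 /=; case: (odd _).
case/lastP: l => [|l b] in lt al z *.
  have [ai'|ai'] := eqVneq a i'.
    subst a; have z' := @pairing_rcons (i, j) [::] i' j' ij' z.
    have n0 : (0 < n)%N by move: lt => /=; lia.
    have [h1] := IH [::] i j j' i' n0 ij ji' isT z'.
    by move=> /= [e1 e2]; subst i' j'; rewrite /inpair /= eqxx orbT.
  have := @pairing_ne0 i j [:: a] i' j' ij ij'.
  by rewrite z eqxx /= [i == a]eq_sym ai ai' => /(_ isT).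
have [bi'|bi'] := eqVneq b i'.
  subst b; have z' := @pairing_rcons (i, j) (a :: l) i' j' ij' z.
  have lt' : (size (a :: l) < n)%N by move: lt; rewrite /= size_rcons; lia.
  have al' : alternating (a :: l) by move: al; rewrite /= rcons_path => /andP[].
  have [h1 h2] := IH (a :: l) i j j' i' lt' ij ji' al' z'.
  rewrite -rcons_cons all_rcons h1 andbT size_rcons oddS.
  by move: h2; case: (odd _) => /= -[-> ->]; rewrite /inpair eqxx ?orbT.
have := @pairing_ne0 i j (a :: rcons l b) i' j' ij ij'.
rewrite z eqxx /= [i == a]eq_sym ai /= rcons_path last_rcons bi' andbT => h.
by move: al => /= al; have := h al.
Qed.

End Pairing.

(** * Cyclically reduced words *)

(** Two consecutive syllables are linked if their product remains of rank one
    at [lam = 0]. *)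
Definition link (a b : (bool * bool) * seq tri) : bool :=
  pairing (killed a.1) a.2 (killed (zinv b.1)) != 0%R.

Definition good (e : zword) : bool :=
  all (fun zp => alternating zp.2 && ~~ odd (size zp.2)) e.

(** By [pairing_eq0], unlinked syllables form a pinch of the HNN extension,
    which can be replaced by its image under [shift_tri]. *)
Lemma link_pinch a b : alternating a.2 -> ~~ odd (size a.2) -> ~~ link a b ->
  b.1 = zinv a.1 /\ all (inpair (killed a.1)) a.2.
Proof.
case: a b => [z p] [z' p']; rewrite [(z, p).1]/= [(z, p).2]/= [(z', p').1]/= => al ev.
rewrite /link negbK [(z, p).1]/= [(z, p).2]/= [(z', p').1]/= => /eqP h.
have K1 (w : bool * bool) : (killed w).1 != (killed w).2 by case: w => [] [] [].
have := K1 z; have := K1 (zinv z'); move: h.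
case E: (killed z) => [i j]; case E': (killed (zinv z')) => [i' j'] h k1 k2.
have [ap e] := pairing_eq0 k2 k1 al h; split=> //; move: e; rewrite (negPf ev).
by rewrite -E -E'; case: z {E ap} => [] [] []; case: z' {E'} => [] [] [].
Qed.

Definition normal (g : Gamma1) : Prop :=
  (exists l, [/\ alternating l, ~~ odd (size l) & conjugate g (pval false l)]) \/
  (exists e, [/\ e != [::], good e, cycle link e & conjugate g (eval e)]).

Lemma normal_conj g h : conjugate g h -> normal h -> normal g.
Proof.
by move=> gh [[l [h1 h2 h3]]|[e [h1 h2 h3 h4]]]; [left; exists l|right; exists e];
  split=> //; apply: conj_trans gh _.
Qed.

Lemma not_path (T : Type) (r : rel T) x p : ~~ path r x p ->
  exists p1 a b p2, x :: p = p1 ++ [:: a, b & p2] /\ ~~ r a b.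
Proof.
elim: p x => [//|y p IH] x /=; rewrite negb_and => /orP[h|/IH[p1 [a [b [p2 [-> h]]]]]].
  by exists [::], x, y, p.
by exists (x :: p1), a, b, p2.
Qed.

Lemma conj_eval_rot u w : conjugate (eval (u ++ w)) (eval (w ++ u)).
Proof. by rewrite !eval_cat; exact: conjC. Qed.

Lemma good_cat u w : good (u ++ w) = good u && good w.
Proof. exact: all_cat. Qed.

Lemma normal_pval l : ~~ odd (size l) -> normal (pval false l).
Proof.
move=> ol; left; exists (red l); rewrite red_alternating red_odd red_pval.
by split=> //; exact: conj_refl.
Qed.

Lemma eval_rcons e zp : eval (rcons e zp) = eval e * (zval zp.1 * pval false zp.2).
Proof. by rewrite -cats1 eval_cat /= mulg1. Qed.

Lemma even_cat l l' : ~~ odd (size l) -> ~~ odd (size l') ->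
  ~~ odd (size (l ++ l') : nat) /\ pval false (l ++ l') = pval false l * pval false l'.
Proof.
move=> /negbTE ol /negbTE ol'; rewrite size_cat oddD ol ol' pval_cat.
by rewrite ol.
Qed.

(** Pinching an unlinked pair, after a rotation that brings it to the front,
    decreases the number of stable letters. The second clause covers what a
    pinch produces: a word of half-turns, followed by a shorter product of
    syllables. *)
Lemma normal_eval n :
  (forall e, (size e < n)%N -> good e -> normal (eval e)) /\
  (forall l e, ~~ odd (size l) -> (size e < n)%N -> good e ->
     normal (pval false l * eval e)).
Proof.
elim: n => [//|n [IH1 IH2]].
have pinch a b r : (size r).+1 < n -> good [:: a, b & r] -> ~~ link a b ->
    normal (eval [:: a, b & r]).
  case: a b => [z p] [z' p'] lt /= /and3P[/andP[al ol] /andP[_ ol'] gr] ab.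
  have [/= -> ap] := @link_pinch (z, p) (z', p') al ol ab; rewrite zvalV.
  have om : ~~ odd (size (map (shift_tri z) p)) by rewrite size_map.
  have [o e] := even_cat om ol'.
  have -> : zval z * pval false p * ((zval z)^-1 * pval false p' * eval r) =
      pval false (map (shift_tri z) p ++ p') * eval r.
    by rewrite e -(pval_pinch ap ol) !mulgA.
  by apply: IH2 => //; apply: ltn_trans lt.
have H1 e : (size e < n.+1)%N -> good e -> normal (eval e).
  case: e => [|x s] lt ge.
    by left; exists [::]; split=> //; exact: conj_refl.
  have [c|c] := boolP (cycle link (x :: s)).
    by right; exists (x :: s); split=> //; exact: conj_refl.
  have [p1 [a [b [p2 [e ab]]]]] := not_path c.
  (* If the unlinked pair consists of the last syllable and the first one,
     the rotation is by one syllable. *)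
  case/lastP: p2 e => [|p2 y] e.
    have /rcons_inj[e1 eb] : rcons (x :: s) x = rcons (rcons p1 a) b.
      by rewrite rcons_cons e -[in RHS]cats1 cat_rcons.
    subst b; case: p1 e1 {e} => [|x' p1] /= [].
      move=> e2 e3; subst a s; move: ge; rewrite /good /= andbT => /andP[g1 g2].
      by have [+ _] := @link_pinch x x g1 g2 ab; case: (x.1) => [] [] [].
    move=> e2 e3; subst x' s; have es : x :: rcons p1 a = (x :: p1) ++ [:: a] by rewrite cats1.
    rewrite -[X in normal X]/(eval (x :: rcons p1 a)) es; rewrite es in lt ge.
    apply: normal_conj (conj_eval_rot (x :: p1) [:: a]) _.
    apply: pinch => //; first by move: lt; rewrite size_cat /=; lia.
    by move: ge; rewrite good_cat => /andP[h1 h2]; rewrite /good /= in h1 h2 *;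
      case/andP: h2 => -> _.
  have /rcons_inj[e1 ey] : rcons (x :: s) x = rcons (p1 ++ [:: a, b & p2]) y.
    by rewrite rcons_cat /= -e.
  rewrite e1 in lt ge *; apply: normal_conj (conj_eval_rot _ _) _.
  apply: pinch => //; first by move: lt; rewrite size_cat /= size_cat; lia.
  move: ge; rewrite -[good [:: a, b & p2 ++ p1]]/(good ([:: a, b & p2] ++ p1)).
  by rewrite !good_cat andbC.
split=> // l e ol lt ge; case/lastP: e => [|e [z q]] in lt ge *.
  by rewrite /= mulg1; exact: normal_pval.
rewrite eval_rcons; apply: normal_conj (conjC _ _) _.
move: ge; rewrite -cats1 good_cat => /andP[ge /andP[/andP[/= _ oq] _]].
have [o e1] := even_cat oq ol.
have -> : eval e * (zval z * pval false q) * pval false l =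
    eval (rcons e (z, red (q ++ l))).
  by rewrite eval_rcons /= red_pval e1 !mulgA.
apply: H1; first by move: lt; rewrite !size_rcons.
by rewrite -cats1 good_cat ge /good /= red_alternating red_odd o.
Qed.

Lemma Gamma1_gen (P : Gamma1 -> Prop) : P 1 ->
  (forall a (s : bool) g, P g -> P ((if s then (gen a)^-1 else gen a) * g)) ->
  forall g, P g.
Proof.
move=> P1 Pl g; rewrite -(clsK g); elim: (repr g) => [|[a s] w IH]; first exact: P1.
by rewrite clsW; exact: Pl.
Qed.

Lemma normal_form g : normal g.
Proof.
suff [l [e [ol ge ->]]] : exists l e, [/\ ~~ odd (size l), good e & g = pval false l * eval e].
  exact: (normal_eval (size e).+1).2.
elim/Gamma1_gen: g => [|a s g [l [e [ol ge ->]]]].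
  by exists [::], [::]; rewrite /= mulg1.
have Z z : exists l' e', [/\ ~~ odd (size l'), good e' &
    zval z * (pval false l * eval e) = pval false l' * eval e'].
  exists [::], ((z, red l) :: e); split=> //=.
    by rewrite ge red_alternating red_odd ol.
  by rewrite red_pval mul1g !mulgA.
have [->|[->|->]] : a = gen_x \/ (a = gen_y \/ a = gen_t).
  by case: a => -[|[|[|//]]] h; [left|right; left|right; right]; exact: val_inj.
- exists ((if s then [:: I1; I2] else [:: I2; I1]) ++ l), e; split=> //.
    by rewrite size_cat; case: s; rewrite /= negbK.
  rewrite pval_cat mulgA; congr (_ * _); case: s; congr (_ * _);
    by rewrite /= ?mul1g ?mulg1 ?invg1 ?mulg1 ?invgK.
- exact: (Z (false, s)).
- exact: (Z (true, s)).
Qed.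

Local Close Scope group_scope.

(** * Traces and determinants *)

Local Open Scope ring_scope.

Section Words.
Variables (A : comPzRingType) (U lam : A).
(** The image of a product of syllables, without its scalar factors. *)
Definition emx (e : zword) : 'M[A]_2 :=
  foldr (fun zp M => zmx U lam zp.1 *m invw U zp.2 *m M) 1%:M e.

Lemma det_invw l : \det (invw U l) = (- delta U) ^+ size l.
Proof. by elim: l => [|i l IH] /=; rewrite ?det1 // det_mulmx IH det_invol exprS. Qed.

Lemma trace_invw_cyc i l : \tr (invw U (i :: rcons l i)) = delta U * \tr (invw U l).
Proof.
rewrite /= invw_rcons mxtrace_mulC -mulmxA invol_sqr mul_mx_scalar; exact: mxtraceZ.
Qed.

End Words.

Lemma map_emx (A B : comPzRingType) (th : {rmorphism A -> B}) U lam e :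
  map_mx th (emx U lam e) = emx (th U) (th lam) e.
Proof.
by elim: e => [|zp e IH] /=; rewrite ?map_mx1 // !map_mxM map_zmx map_invw IH.
Qed.

(** Conjugation by the common first and last half-turn shortens the word and
    multiplies the trace by [delta]. *)
Lemma cyc_reduced l : alternating l -> ~~ odd (size l) -> l != [::] ->
  exists n l0 i, [/\ alternating (i :: rcons l0 i) , size l = (n.*2 + size l0).+1 &
   forall (A : comPzRingType) (U : A), \tr (invw U l) = delta U ^+ n * \tr (invw U (i :: l0))].
Proof.
have [n] := ubnP (size l); elim: n l => // n IH l lt al ev ln.
case: l => [//|i l] in lt al ev ln *; clear ln; case/lastP: l => [//|l j] in lt al ev *.
have [ji|ji] := eqVneq j i; last first.
  exists 0%N, (rcons l j), i; split=> [||A U]; last by rewrite expr0 mul1r.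
    by move: al; rewrite /= [path _ _ (rcons (rcons _ _) _)]rcons_path last_rcons ji andbT.
  by rewrite /= size_rcons.
subst j; case: (eqVneq l [::]) => [e|ne]; first by move: al; rewrite e /= eqxx.
have [|||m [l1 [k [h1 h2 h3]]]] := IH l _ _ _ ne.
- by move: lt; rewrite /= size_rcons; lia.
- by move: al; rewrite /= rcons_path => /andP[/path_sorted].
- by move: ev; rewrite /= size_rcons /= negbK.
exists m.+1, l1, k; split=> //; first by rewrite /= size_rcons h2 doubleS.
by move=> A U; rewrite trace_invw_cyc h3 exprS mulrA.
Qed.

Lemma trace_invw_ne0 l0 i : alternating (i :: rcons l0 i) ->
  \tr (invw (1 : rat) (i :: l0)) != 0.
Proof.
move=> h; rewrite /= invol_at1 -scalemxAl mxtraceZ mulf_neq0 //.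
by rewrite trace_rank1; exact: chain_ne0.
Qed.

(** Consecutive links make all the scalars in [rank1_rank1] nonzero. *)
Lemma emx_rank1 s a : path link a s -> exists2 c, c != 0 &
  emx U0 0 (a :: s) = c *: (rank1 (fixpt U0 (killed (zinv a.1)))
     (fixpt U0 (killed (last a s).1)) *m invw U0 (last a s).2).
Proof.
have z0 z : zmx U0 0 z = rank1 (fixpt U0 (killed (zinv z))) (fixpt U0 (killed z)).
  by rewrite /zmx scale0r subr0.
elim: s a => [|b s IH] a; first by exists 1; rewrite ?oner_neq0 // /emx /= mulmx1 z0 scale1r.
case/andP=> ab /IH[c c0 e]; exists (c * pairing (killed a.1) a.2 (killed (zinv b.1))).
  by rewrite mulf_neq0.
rewrite -[emx _ _ _]/(zmx U0 0 a.1 *m invw U0 a.2 *m emx U0 0 (b :: s)) e z0.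
by rewrite -scalemxAr mulmxA rank1_rank1 -scalemxAl scalerA.
Qed.

Lemma trace_emx_ne0 e : e != [::] -> cycle link e -> \tr (emx U0 0 e) != 0.
Proof.
case: e => [//|a s] _; rewrite /cycle rcons_path => /andP[/emx_rank1[c c0 ->] la].
by rewrite mxtraceZ mulf_neq0 // trace_rank1.
Qed.

(** The inner variable is [U - 1] and the outer one is [lam]. *)
Definition UU : {poly {poly rat}} := U0%:P.
Definition LL : {poly {poly rat}} := 'X.

Definition at0 : {rmorphism {poly {poly rat}} -> {poly rat}} := horner_eval (0 : {poly rat}).
Lemma at0U : at0 UU = U0. Proof. by rewrite /at0 /= /horner_eval hornerC. Qed.
Lemma at0L : at0 LL = 0. Proof. by rewrite /at0 /= /horner_eval hornerX. Qed.

Lemma UU_neq0 : UU != 0.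
Proof.
rewrite polyC_eq0; apply/eqP => /(congr1 ev0); rewrite ev0U rmorph0.
by apply/eqP; rewrite oner_neq0.
Qed.

Lemma deltaUU_neq0 : delta UU != 0.
Proof.
apply/eqP => /(congr1 at0); rewrite map_delta at0U rmorph0.
by apply/eqP; exact: delta0.
Qed.

Section Evaluation.
Variables (K : fieldType) (U lam : K).
Hypothesis nz : [/\ (2%:R : K) != 0, U != 0, delta U != 0 & lam != 0].
Local Notation rep := (rep U lam).

Lemma rep_inv g (N N' : 'M[K]_2) : rep g = N -> N *m N' = 1%:M -> rep g^-1%g = N'.
Proof.
move=> e NN; rewrite -[LHS]mulmx1 -NN -e mulmxA (repV nz) mul1mx //.
Qed.

(** The image of [gb] follows from that of x by the intertwining property of
    y. *)
Lemma rep_turn i : rep (turn i) = (delta U)^-1 *: (invol U i *m invol U I2).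
Proof.
have [n2 nU nd nl] := nz.
have xE : rep gx = (delta U)^-1 *: (invol U I2 *m invol U I1) by rewrite (rep_gen nz).
have inv i1 j1 : ((delta U)^-1 *: (invol U i1 *m invol U j1)) *m
    ((delta U)^-1 *: (invol U j1 *m invol U i1)) = 1%:M.
  rewrite -scalemxAl -scalemxAr mulmxA -(mulmxA (invol U i1)) invol_sqr mul_mx_scalar.
  by rewrite -scalemxAl invol_sqr !scale_scalar_mx; congr (_%:M); field.
case: i; rewrite /turn.
- have bE : rep gb = (delta U)^-1 *: (invol U I2 *m invol U I0).
    have ny : rep gy *m ((delta U)^-1 *: (invol U I2 *m invol U I0)) = rep gx *m rep gy.
      have h := @zmx_intertwine _ U lam (false, false) I2 I0 isT isT.
      rewrite xE (rep_gen nz) (letter_z U lam false false) -scalemxAl -!scalemxAr -!scalemxAl h.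
      by rewrite scalerA mulrC -scalerA.
    by rewrite /gb !(repM nz) -mulmxA -ny mulmxA (repV nz) mul1mx.
  exact: rep_inv bE (inv _ _).
- exact: rep_inv xE (inv _ _).
- by rewrite (rep1 nz) invol_sqr scale_scalar_mx mulVf.
Qed.

Lemma rep_pval l : ~~ odd (size l) ->
  rep (pval false l) = (delta U)^-1 ^+ (size l)./2 *: invw U l.
Proof.
have [n2 nU nd nl] := nz.
move=> ol; elim/even_ind: l / ol => [|i j l _ IH] /=; first by rewrite (rep1 nz) expr0 scale1r.
rewrite !(repM nz) IH rep_turn.
have -> : rep (turn j)^-1%g = (delta U)^-1 *: (invol U I2 *m invol U j).
  apply: rep_inv (rep_turn j) _.
  rewrite -scalemxAl -scalemxAr mulmxA -(mulmxA (invol U j)) invol_sqr mul_mx_scalar.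
  by rewrite -scalemxAl invol_sqr !scale_scalar_mx; congr (_%:M); field.
have e : (delta U)^-1 *: (invol U i *m invol U I2) *m ((delta U)^-1 *: (invol U I2 *m invol U j))
    = (delta U)^-1 *: (invol U i *m invol U j).
  rewrite -scalemxAl -scalemxAr mulmxA -(mulmxA (invol U i)) invol_sqr mul_mx_scalar.
  by rewrite -scalemxAl [X in _ *: X]scalerA mulVf // scale1r.
by rewrite mulmxA e -scalemxAl -scalemxAr scalerA exprS mulmxA.
Qed.

Lemma rep_zval z : exists2 c, c != 0 & rep (zval z) = c *: zmx U lam z.
Proof.
have [n2 nU nd nl] := nz; have n4 := nz4 nz.
have P g : (zscal U lam (g, false) != 0) /\
  rep (if g then gt else gy) = zscal U lam (g, false) *: zmx U lam (g, false).
  by split; [rewrite /zscal mulf_neq0 ?signr_eq0 // invr_eq0 mulf_neq0|case: g; rewrite (rep_gen nz)].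
case: z => g []; last by exists (zscal U lam (g, false)); have [] := P g.
exists (zscal U lam (g, true)); first by rewrite /zscal /= invr_eq0 !mulf_neq0.
rewrite /zval /=; apply: rep_inv (P g).2 _.
have := letterK nz (if g then gen_t else gen_y, false).
by rewrite /inv_letter /= !letter_z.
Qed.

Lemma rep_eval e : good e -> exists2 c, c != 0 & rep (eval e) = c *: emx U lam e.
Proof.
have [n2 nU nd nl] := nz.
elim: e => [|[z p] e IH] /=; first by exists 1; rewrite ?oner_neq0 // (rep1 nz) scale1r.
move=> /andP[/andP[/= _ op] /IH[c c0 ec]]; have [c' c0' ez] := rep_zval z.
exists (c' * (delta U)^-1 ^+ (size p)./2 * c).
  by rewrite !mulf_neq0 // expf_neq0 // invr_eq0.
by rewrite !(repM nz) ez ec rep_pval // -!scalemxAl -!scalemxAr !scalerA -scalemxAl scalerA mulrAC.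
Qed.

Lemma rep_conj g h : conjugate g h -> \tr (rep g) = \tr (rep h) /\ \det (rep g) = \det (rep h).
Proof.
case=> k ->; rewrite !(repM nz) mxtrace_mulC mulmxA (repV nz) mul1mx; split=> //.
rewrite !det_mulmx mulrAC -det_mulmx (repVr nz) det1 mul1r //.
Qed.
End Evaluation.

(** An element that is not conjugate into the pair of pants group is conjugate
    to a product of linked syllables. At [lam = 0] its trace is a product of
    nonzero pairings, whereas its determinant is divisible by [lam]. For an
    element of the pair of pants group, the matrix does not involve [lam], and
    the same holds at [U = 1] by [chain_ne0]. The polynomials do not depend on
    the field in which the parameters are evaluated. *)
Theorem trace_det (g : Gamma1) : g <> 1%g ->
  exists tau d : {poly {poly rat}}, [/\ d != 0, dominated tau d &
    forall (K : fieldType) (th : {rmorphism {poly {poly rat}} -> K}),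
      [/\ (2%:R : K) != 0, th UU != 0, delta (th UU) != 0 & th LL != 0] ->
      exists s, [/\ s != 0, \tr (rep (th UU) (th LL) g) = s * th tau &
                 \det (rep (th UU) (th LL) g) = s ^+ 2 * th d]].
Proof.
move=> g1; case: (normal_form g) => [[l [al ol cg]]|[e [e0 ge ce cg]]].
  have l0 : l != [::].
    apply: contra_notN g1 => /eqP e; case: cg => k ->; by rewrite e /= mulg1 mulgV.
  have [n [l1 [i [h1 h2 h3]]]] := cyc_reduced al ol l0.
  have ol1 : odd (size l1) by move: ol; rewrite h2 oddS oddD odd_double negbK.
  have even1 : ~~ odd (size l1).+1 by rewrite oddS ol1.
  exists (\tr (invw U0 (i :: l1)))%:P, ((- delta U0) ^+ (size l1).+1)%:P; split.
  - by rewrite polyC_eq0 expf_neq0 // oppr_eq0 delta0.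
  - right; exists (\tr (invw U0 (i :: l1))), ((- delta U0) ^+ (size l1).+1); split=> //.
      rewrite -[_.[0]]/(ev0 _) -trace_map_mx.
      by rewrite map_invw ev0U; exact: trace_invw_ne0.
    rewrite -[_.[0]]/(ev0 _) rmorphXn rmorphN map_delta ev0U.
    by rewrite /delta expr1n subrr mul0r oppr0 expr0n.
  move=> K th nz; have [n2 nU nd nl] := nz.
  pose thc : {rmorphism {poly rat} -> K} := (th \o polyC)%FUN.
  have [-> ->] := rep_conj nz cg; rewrite (rep_pval nz) //.
  exists ((delta (th UU))^-1 ^+ (size l)./2 * delta (th UU) ^+ n); split.
  - by rewrite mulf_neq0 // expf_neq0 // invr_eq0.
  - rewrite mxtraceZ h3 -mulrA; congr (_ * (_ * _)).
    by rewrite -[RHS]/(thc (\tr (invw U0 (i :: l1)))) -trace_map_mx map_invw.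
  - rewrite detZ det_invw -[X in _ = _ * X]/(thc ((- delta U0) ^+ (size l1).+1)) rmorphXn rmorphN map_delta.
    rewrite h2 exprMn -[RHS]mulrA; congr (_ * _).
    by rewrite -addnS exprD -mul2n exprM sqrrN -!exprM mulnC.
have nz0 : \tr (emx U0 0 e) != 0 := trace_emx_ne0 e0 ce.
have dE e' : \det (emx UU LL e') = \prod_(zp <- e')
    (((-1) ^+ (~~ zp.1.1) * 16%:R * UU ^+ 2 * LL) * (- delta UU) ^+ size zp.2).
  elim: e' => [|zp e' IH]; first by rewrite big_nil /= det1.
  by rewrite big_cons -IH /= !det_mulmx det_zmx det_invw.
have dU := deltaUU_neq0; have U0n := UU_neq0.
have n16 : (16%:R : {poly {poly rat}}) != 0.
  by rewrite -polyC_natr polyC_eq0 -polyC_natr polyC_eq0 pnatr_eq0.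
exists (\tr (emx UU LL e)), (\det (emx UU LL e)); split.
- rewrite dE prodf_seq_neq0; apply/allP => zp _ /=.
  by rewrite !mulf_neq0 ?signr_eq0 ?expf_neq0 ?oppr_eq0 ?polyX_eq0.
- left; rewrite -![_.[0]]/(at0 _) -trace_map_mx -det_map_mx map_emx at0U at0L; split=> //.
  case: e e0 {ge ce cg nz0 dE} => [//|zp e] _; rewrite /= !det_mulmx det_zmx.
  by rewrite mulr0 !mul0r.
- move=> K th nz.
  have [-> ->] := rep_conj nz cg; have [c c0 ->] := rep_eval nz ge.
  by exists c; rewrite mxtraceZ detZ -trace_map_mx -det_map_mx map_emx.
Qed.
(** Over the field of rational functions in both variables, [trace_det] and
    [dominated_hyperbolic] make every nontrivial element hyperbolic. *)
Theorem Gamma1_free_action : acts_freely_on_tree Z2 Gamma1.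
Proof.
pose K := {fraction {poly {poly rat}}}.
pose th : {rmorphism {poly {poly rat}} -> K} := @tofrac {poly {poly rat}}.
have nz : [/\ (2%:R : K) != 0, th UU != 0, delta (th UU) != 0 & th LL != 0].
  rewrite -map_delta -(rmorph_nat th) /th /= !tofrac_eq0.
  rewrite UU_neq0 deltaUU_neq0 polyX_eq0; split=> //.
  by rewrite -polyC_natr polyC_eq0 -polyC_natr polyC_eq0 pnatr_eq0.
apply: (@hyperbolic_free K (@kval rat) _ _ Gamma1 (rep (th UU) (th LL))).
- exact: (fracvalM (@lexvalM rat)).
- exact: (fracvalD (@lexvalM rat) (@lexvalD rat)).
- by move=> g h; exact: repM.
- exact: rep1.
move=> g /trace_det[tau [d [d0 dom /(_ K th nz)[s [s0 tE dE]]]]].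
exact: dominated_hyperbolic s0 d0 tE dE dom.
Qed.

(** * Torsion-free nilpotent quotients from filtrations *)

(** A ring with a decreasing multiplicative filtration by additive subgroups,
    whose graded pieces are torsion-free, and a multiplicative map from a group
    that is 1 modulo the first step. The group then maps to the
    first congruence subgroup, and its images modulo the higher congruence
    subgroups are nilpotent and torsion-free. *)
Section FilteredRing.
Variables (R : pzRingType) (F : nat -> R -> Prop).
Hypothesis F0 : forall k, F k 0.
Hypothesis FD : forall k a b, F k a -> F k b -> F k (a + b).
Hypothesis FN : forall k a, F k a -> F k (- a).
Hypothesis FM : forall j k a b, F j a -> F k b -> F (j + k) (a * b).
Hypothesis FS : forall k a, F k.+1 a -> F k a.
Hypothesis F_torsion : forall k n a, (0 < n)%N -> F k (a *+ n) -> F k a.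
Hypothesis F1 : F 0 1.

Lemma Fle j k a : (j <= k)%N -> F k a -> F j a.
Proof. by move=> /subnK<-; elim: (k - j)%N => // n IH /FS. Qed.

Lemma FB k a b : F k a -> F k b -> F k (a - b).
Proof. by move=> ha hb; apply: FD => //; apply: FN. Qed.

Lemma Fmuln k n a : F k a -> F k (a *+ n).
Proof. by move=> h; elim: n => [|n IH]; rewrite ?mulr0n // mulrS; exact: FD. Qed.

Variables (G : groupType) (phi : G -> R).
Hypothesis phi1 : phi 1%g = 1.
Hypothesis phiM : forall g h, phi (g * h)%g = phi g * phi h.
Hypothesis phiI : forall g, F 1 (phi g - 1).

Lemma phi0 g : F 0 (phi g).
Proof. by rewrite -(subrK 1 (phi g)); apply: FD => //; apply: (@Fle 0 1). Qed.

Section Quotient.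
Variable k : nat.

Definition cong (g h : G) : Prop := F k (phi g - phi h).

Lemma congl a b c : cong a b -> cong (c * a)%g (c * b)%g.
Proof.
by rewrite /cong !phiM -mulrBr => h; rewrite -[k]add0n; apply: FM => //; exact: phi0.
Qed.

Lemma congr_ a b c : cong a b -> cong (a * c)%g (b * c)%g.
Proof.
by rewrite /cong !phiM -mulrBl => h; rewrite -[k]addn0; apply: FM => //; exact: phi0.
Qed.

Lemma cong_mulV a : clos_refl_sym_trans _ cong (a^-1 * a)%g 1%g.
Proof. by rewrite mulVg; exact: rst_refl. Qed.
Lemma cong_mulrV a : clos_refl_sym_trans _ cong (a * a^-1)%g 1%g.
Proof. by rewrite mulgV; exact: rst_refl. Qed.

Definition cong_preGroup : preGroup :=
  @PreGroup G cong 1%g (fun a b => (a * b)%g) (fun a => a^-1%g) (@mulgA G)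
   (@mul1g G) (@mulg1 G) congl congr_ cong_mulV cong_mulrV.

Definition Qk : groupType := quo cong_preGroup.
Definition qcls (g : G) : Qk := @cls cong_preGroup g.

Lemma qcls_eq g h : qcls g = qcls h <-> cong g h.
Proof.
rewrite /qcls cls_eq; split=> [|gh]; last exact: rst_step.
elim=> {g h} [//|g|g h _|g h l _ h1 _ h2]; rewrite /= /cong.
- by rewrite subrr.
- by move=> /FN; rewrite opprB.
- by rewrite -(subrKA (phi h)); apply: FD.
Qed.

Lemma qclsM : {morph qcls : g h / (g * h)%g}.
Proof. by move=> g h; rewrite /qcls -clsM. Qed.
Lemma qcls1 : qcls 1%g = 1%g. Proof. by []. Qed.
Lemma qclsV g : qcls g^-1%g = (qcls g)^-1%g. Proof. by rewrite /qcls -clsV. Qed.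
Lemma qcls_surj q : exists g, qcls g = q.
Proof. by exists (repr q); exact: clsK. Qed.
HB.instance Definition _ := isMultiplicative.Build G Qk qcls qclsM.

(** If [phi g = 1 + a] then the n-th power is [1 + a *+ n] up to products of
    two elements of level [j]. *)
Lemma phiX g n j : (0 < j)%N -> F j (phi g - 1) ->
  F j.+1 (phi (g ^+ n)%g - 1 - (phi g - 1) *+ n).
Proof.
move=> j0 hj; set a := phi g - 1 in hj *.
have pg : phi g = 1 + a by rewrite /a addrC subrK.
elim: n => [|n IH]; first by rewrite expg0 phi1 subrr mulr0n subr0.
set r := phi (g ^+ n)%g - 1 - a *+ n in IH.
have pn : phi (g ^+ n)%g = 1 + (a *+ n + r) by rewrite /r [a *+ n + _]addrC subrK addrC subrK.
rewrite expgS phiM pg pn.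
have -> : (1 + a) * (1 + (a *+ n + r)) - 1 - a *+ n.+1 = r + a * (a *+ n + r).
  do 2! apply: (canLR (addrK _)); rewrite mulrDl mul1r [a * (1 + _)]mulrDr mulr1 mulrS.
  by rewrite [LHS](AC ((1 * 2) * 2) ((3 * 5) * (4 * 2) * 1)).
apply: FD => //; apply: (@Fle _ (j + j)); first by lia.
by apply: FM => //; apply: FD; [exact: Fmuln|exact: FS].
Qed.

(** A power that is 1 to level [k] forces [g] to be 1 to level [k], one level
    at a time. *)
Lemma Qk_torsion_free : torsion_free Qk.
Proof.
move=> q n n0; have [g <-] := qcls_surj q.
have -> : (qcls g ^+ n = qcls (g ^+ n))%g.
  by elim: n {n0} => // n IH; rewrite !expgS qclsM IH.
rewrite -!qcls1 !qcls_eq /cong phi1 => h.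
suff H j : (j <= k)%N -> F j (phi g - 1) by exact: H.
elim: j => [|j IH] jk; first by apply: FB => //; exact: phi0.
have [->|j0] := posnP j; first exact: phiI.
apply: (@F_torsion _ n) => //; rewrite -[_ *+ n](subKr (phi (g ^+ n)%g - 1)).
apply: FB; first exact: Fle jk h.
apply: phiX => //; apply: IH; exact: ltnW.
Qed.

(** The commutator of [1 + a] and [1 + b] is 1 up to [a * b - b * a], and
    levels add up. *)
Lemma Qk_lower_central n q : lower_central n q ->
  exists2 g, qcls g = q & F n.+1 (phi g - 1).
Proof.
elim: n q => [|n IH] q /=; first by have [g <-] := qcls_surj q; exists g.
set S := [set q | exists2 g, qcls g = q & F n.+2 (phi g - 1)]%classic.
move=> h; change (S q); refine (h S _ _) => {h}.
- split=> [|_ _ [g <- hg] [h' <- hh]|_ [g <- hg]].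
  + by exists 1%g; rewrite // phi1 subrr.
  + exists (g * h')%g; first by rewrite qclsM.
    rewrite phiM (_ : _ - 1 = (phi g - 1) * phi h' + (phi h' - 1)).
      by apply: FD => //; rewrite -[n.+2]addn0; apply: FM => //; exact: phi0.
    by rewrite mulrBl mul1r addrA subrK.
  + exists g^-1%g; first by rewrite qclsV.
    rewrite (_ : _ - 1 = - (phi g^-1%g * (phi g - 1))).
      by apply: FN; rewrite -[n.+2]add0n; apply: FM => //; exact: phi0.
    by rewrite mulrBr -phiM mulVg phi1 mulr1 opprB.
- move=> _ [x /IH[g <- hg] [y _ <-]]; have [l <-] := qcls_surj y.
  exists [~ g, l]%g; first by rewrite /commg /conjg !qclsM !qclsV.
  have -> : ([~ g, l] = (l * g)^-1 * (g * l))%g by rewrite /commg /conjg invgM !mulgA.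
  rewrite phiM (_ : _ - 1 = phi (l * g)^-1%g * (phi (g * l)%g - phi (l * g)%g)).
    rewrite -[n.+2]add0n; apply: FM; first exact: phi0.
    have -> : phi (g * l)%g - phi (l * g)%g =
        (phi g - 1) * (phi l - 1) - (phi l - 1) * (phi g - 1).
      rewrite !phiM !mulrBl !mulrBr !mul1r !mulr1; move: (phi g) (phi l) => b c.
      rewrite -[b * c - b - _]addrA -[c * b - c - _]addrA -!opprD [c + (b - 1)]addrCA.
      by rewrite [in RHS]opprB [RHS]addrA subrK.
    by apply: FB; [rewrite -[n.+2]addn1|rewrite -[n.+2]add1n]; apply: FM.
  by rewrite mulrBr -!phiM mulVg phi1.
Qed.

Lemma Qk_nilpotent : nilpotent Qk.
Proof.
exists k => q /Qk_lower_central[g <- h] /=; rewrite -qcls1 qcls_eq /cong phi1.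
exact: FS.
Qed.

End Quotient.

Lemma residually_torsion_free_nilpotent g :
  (exists k, ~ F k (phi g - 1)) ->
  exists (Q : groupType) (f : {multiplicative G -> Q}),
    [/\ torsion_free Q /\ nilpotent Q, forall q, exists h, f h = q & f g <> 1%g].
Proof.
move=> [k hk]; exists (Qk k), (@qcls k); split.
- by split; [exact: Qk_torsion_free|exact: Qk_nilpotent].
- exact: qcls_surj.
by rewrite -qcls1 qcls_eq /cong phi1.
Qed.

End FilteredRing.

Local Close Scope ring_scope.

(** * Special cube complexes from involutions *)

(** ** The combinatorial cube *)
Section Cube.
Variable n : nat.
Implicit Types (u w : cube n) (i j : 'I_n).

Notation sh u i := (shift u i true).

Lemma shE u i j : sh u i j = u j (+) (j == i).
Proof. by rewrite ffunE andbT. Qed.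

Lemma shK u i : sh (sh u i) i = u.
Proof. by apply/ffunP=> j; rewrite !shE addbK. Qed.

Lemma shC u i j : sh (sh u i) j = sh (sh u j) i.
Proof. by apply/ffunP=> k; rewrite !shE addbAC. Qed.

Lemma sh_inj u i j : sh u i = sh u j -> i = j.
Proof.
move=> /ffunP/(_ i); rewrite !shE eqxx => /addbI/esym/eqP //.
Qed.

Lemma hamming_eq0 u w : (hamming u w == 0) = (u == w).
Proof.
rewrite cards_eq0; apply/eqP/eqP => [e|->]; last first.
  by apply/setP => i; rewrite !inE eqxx.
by apply/ffunP => i; apply/eqP; move/setP/(_ i): e; rewrite !inE => /negbFE.
Qed.

(** Vertices at distance 1 span an edge. *)
Lemma hamming_eq1 u w : hamming u w = 1 -> exists i, w = sh u i.
Proof.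
move=> /eqP/cards1P[i /setP e]; exists i; apply/ffunP => j; rewrite shE.
by have := e j; rewrite !inE; case: (j == i) (u j) (w j) => [] [] [].
Qed.

Lemma hamming_sh u i : hamming u (sh u i) = 1.
Proof.
rewrite /hamming (_ : [set _ | _]%SET = [set i]%SET) ?cards1 //.
by apply/setP => j; rewrite !inE shE; case: (u j) (j == i) => [] [].
Qed.

Lemma cube_ind (P : cube n -> Prop) :
  P (corner0 n) -> (forall u i, P u -> P (sh u i)) -> forall u, P u.
Proof.
move=> P0 PS u; have [k] := ubnP #|[set i | u i]%SET|; elim: k u => // k IH u lt.
have [i ui|u0] := pickP (fun i => u i); last first.
  by rewrite (_ : u = corner0 n) //; apply/ffunP => i; rewrite u0 ffunE.
rewrite -(shK u i); apply/PS/IH.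
have iu : i \in [set i | u i]%SET by rewrite inE.
rewrite (cardsD1 i) iu add1n ltnS in lt; apply: leq_ltn_trans lt.
apply: subset_leq_card; apply/fintype.subsetP => j; rewrite !inE shE.
by case: eqVneq => [->|] /=; rewrite ?ui // addbF.
Qed.

End Cube.
Notation sh u i := (shift u i true).

(** An isometric embedding sends parallel edges to parallel edges: the two
    edges issued from an edge of a square are sent to distinct directions at
    both of its ends, so the square goes to a square. *)
Lemma cubemap_dir m n (f : cubemap m n) : exists d : 'I_m -> 'I_n,
  injective d /\ forall u i, f (sh u i) = sh (f u) (d i).
Proof.
have fh u w : hamming (f u) (f w) = hamming u w.
  by have /forallP/(_ u)/forallP/(_ w)/eqP := cubemapP f.
have finj : injective f.
  by move=> u w e; apply/eqP; rewrite -hamming_eq0 -fh hamming_eq0 e.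
have /choice[d0 d0E] (ui : cube m * 'I_m) :
    exists j, f (sh ui.1 ui.2) = sh (f ui.1) j.
  by apply: hamming_eq1; rewrite fh hamming_sh.
have dj u i j : d0 (sh u j, i) = d0 (u, i).
  have [->|ij] := eqVneq i j.
    have := d0E (sh u j, j); rewrite /= shK (d0E (u, j)) /= => e.
    apply/esym; by apply: (@sh_inj _ (sh (f u) (d0 (u, j)))); rewrite shK -e.
  have n1 : d0 (u, i) != d0 (u, j).
    apply: contra_neq ij => e; apply: (@sh_inj _ u); apply: finj.
    by rewrite (d0E (u, i)) (d0E (u, j)) /= e.
  have n2 : d0 (u, i) != d0 (sh u i, j).
    apply/eqP => e; have := d0E (sh u i, j); rewrite /= (d0E (u, i)) /= -e shK => /finj/ffunP/(_ i).
    by rewrite !shE eqxx (negPf ij); case: (u i).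
  have := d0E (sh u i, j); rewrite /= (d0E (u, i)) /= shC (d0E (sh u j, i)) /= (d0E (u, j)) /=.
  move=> /ffunP/(_ (d0 (u, i))); rewrite !shE eqxx (negPf n1) (negPf n2).
  by case: eqVneq => // _; case: (f u _).
have dc u i : d0 (u, i) = d0 (corner0 m, i).
  by elim/cube_ind: u => // u j <-; exact: dj.
exists (fun i => d0 (corner0 m, i)); split=> [i j e|u i]; last first.
  by rewrite -(dc u) (d0E (u, i)).
by apply: (@sh_inj _ (corner0 m)); apply: finj; rewrite (d0E (_, i)) (d0E (_, j)) /= e.
Qed.

(** Combinatorial data for a special cube complex. Every hyperplane has a
    label. The vertex on the other side of the hyperplane [l] is [mv l v], with
    [mv l v = v] if no edge at [v] crosses [l]. Two hyperplanes cross when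
    [mv_comm] relates them, and [mv_side] tells their two sides apart. Naming
    the hyperplanes in advance makes the four forbidden pathologies
    impossible. *)
Record moves := Moves {
  mv_vertex : choiceType;
  mv_label : choiceType;
  mv : mv_label -> mv_vertex -> mv_vertex;
  mv_comm : rel mv_label;
  mv_side : mv_label -> mv_vertex -> bool;
  mvK : forall l, involutive (mv l);
  K_sym : symmetric mv_comm;
  K_irr : irreflexive mv_comm;
  K_comm : forall l l' v, mv_comm l l' -> mv l (mv l' v) = mv l' (mv l v);
  mv_inj : forall l l' v, mv l v != v -> mv l v = mv l' v -> l = l';
  side_mv : forall l v, mv l v != v -> mv_side l (mv l v) = ~~ mv_side l v;
  side_K : forall l l' v, mv_comm l l' -> mv_side l (mv l' v) = mv_side l v
}.

Section Involutions.
Variable D : moves.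
Local Notation V := (mv_vertex D).
Local Notation L := (mv_label D).
Local Notation mv := (@mv D).
Local Notation K := (@mv_comm D).
Local Notation side := (@mv_side D).

(** A cube of the complex is a cube of vertices whose directions carry pairwise
    crossing labels, each of them moving the vertices. *)
Definition labelled n (c : cube n -> V) (ell : 'I_n -> L) : Prop :=
  (forall i j, i != j -> K (ell i) (ell j)) /\
  forall u i, c (sh u i) = mv (ell i) (c u) /\ mv (ell i) (c u) != c u.

Definition is_cell n (c : {ffun cube n -> V}) : bool := `[< exists ell, labelled c ell >].

Record icell n := ICell { icell_val :> {ffun cube n -> V}; icellP : is_cell icell_val }.
HB.instance Definition _ n := [isSub for @icell_val n].
HB.instance Definition _ n := [Choice of icell n by <:].

Lemma is_cell_face m n (f : cubemap m n) (c : icell n) :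
  is_cell [ffun u => c (f u)].
Proof.
have /asboolP[ell [ell1 ell2]] := icellP c; have [d [dinj dE]] := cubemap_dir f.
apply/asboolP; exists (ell \o d); split=> [i j ij|u i].
  by apply: ell1; rewrite (inj_eq dinj).
by rewrite !ffunE dE; exact: ell2.
Qed.

Definition iface m n (f : cubemap m n) (c : icell n) : icell m :=
  ICell (is_cell_face f c).

Lemma ifaceE m n (f : cubemap m n) (c : icell n) u : iface f c u = c (f u).
Proof. by rewrite ffunE. Qed.

Lemma icell_eq n (c c' : icell n) : (forall u, c u = c' u) -> c = c'.
Proof. by move=> h; apply/val_inj/ffunP. Qed.

Lemma iface_id n (c : icell n) : iface (cubemap_id n) c = c.
Proof. by apply: icell_eq => u; rewrite !ffunE. Qed.

Lemma iface_comp k m n (g : cubemap m n) (f : cubemap k m) (c : icell n) :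
  iface (cubemap_comp g f) c = iface f (iface g c).
Proof. by apply: icell_eq => u; rewrite !ffunE. Qed.

(** The vertices of a cube are told apart by the sides of its hyperplanes, so a
    cube is embedded. *)
Lemma labelled_side n (c : cube n -> V) ell : labelled c ell ->
  forall u i, side (ell i) (c u) = side (ell i) (c (corner0 n)) (+) u i.
Proof.
move=> [h1 h2] u; elim/cube_ind: u => [|u j IH] i; first by rewrite ffunE addbF.
have [e ne] := h2 u j; rewrite e shE; have [ij|ij] := eqVneq i j.
  by rewrite -ij in e ne *; rewrite side_mv // IH addbA addbT.
by rewrite side_K ?h1 // IH addbF.
Qed.

Lemma icell_inj n (c : icell n) : injective c.
Proof.
have /asboolP[ell h] := icellP c; move=> u w e; apply/ffunP => i.
by have := labelled_side h u i; rewrite e (labelled_side h w i) => /addbI.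
Qed.

Lemma iface_free n (f : cubemap n n) (c : icell n) :
  iface f c = c -> f = cubemap_id n.
Proof.
move=> e; apply/val_inj/ffunP => u; rewrite ffunE; apply: (@icell_inj n c).
by rewrite -ifaceE e.
Qed.

Definition icomplex : cubeComplex := CubeComplex iface_id iface_comp iface_free.
Notation X := icomplex.

(** ** Cells from labels *)

(** The vertex [u] of the cube at [v] with directions [ell], reached by
    applying the involutions of the list [r] selected by [u]. *)
Definition sweep n (ell : 'I_n -> L) (v : V) (u : cube n) (r : seq 'I_n) : V :=
  foldr (fun i w => if u i then mv (ell i) w else w) v r.

Lemma sweep_notin n (ell : 'I_n -> L) v u r i : i \notin r -> sweep ell v (sh u i) r = sweep ell v u r.
Proof.
elim: r => [//|j r IH] /=; rewrite in_cons negb_or => /andP[ij ir].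
by rewrite IH // shE eq_sym (negPf ij) addbF.
Qed.

Lemma sweep_sh n (ell : 'I_n -> L) v u r i : (forall i j, i != j -> K (ell i) (ell j)) ->
  i \in r -> uniq r -> sweep ell v (sh u i) r = mv (ell i) (sweep ell v u r).
Proof.
move=> hK; elim: r => [//|j r IH] /=; rewrite in_cons => /orP[/eqP<-|ir] /andP[jr ur].
  by rewrite sweep_notin // shE eqxx; case: (u i) => //=; rewrite mvK.
have ij : i != j by apply: contraNneq jr => <-.
rewrite IH // shE eq_sym (negPf ij) addbF; case: ifP => // _.
by rewrite K_comm // hK // eq_sym.
Qed.

Lemma sweep_move n (ell : 'I_n -> L) v u r i : (forall i j, i != j -> K (ell i) (ell j)) ->
  mv (ell i) v != v -> mv (ell i) (sweep ell v u r) != sweep ell v u r.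
Proof.
move=> hK h; elim: r => [//|j r IH] /=; case: ifP => // _.
have [->|ij] := eqVneq j i; first by rewrite mvK eq_sym.
by rewrite -K_comm ?hK // (inj_eq (can_inj (mvK _))).
Qed.

Lemma icell_of n (ell : 'I_n -> L) v : (forall i j, i != j -> K (ell i) (ell j)) ->
  (forall i, mv (ell i) v != v) ->
  exists c : icell n, c (corner0 n) = v /\ labelled c ell.
Proof.
move=> hK hm; pose c := [ffun u => sweep ell v u (enum 'I_n)].
have hc : labelled c ell.
  split=> // u i; rewrite !ffunE sweep_sh ?mem_enum ?enum_uniq //.
  by split=> //; exact: sweep_move.
have cc : is_cell c by apply/asboolP; exists ell.
exists (ICell cc); split=> //=; rewrite ffunE.
elim: (enum _) => //= i r ->; by rewrite ffunE.
Qed.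

(** ** Edges *)

Lemma edge_label (e : icell 1) : {l | mv l (e (corner0 1)) != e (corner0 1) /\
   e (corner1 ord0) = mv l (e (corner0 1))}.
Proof.
apply: cid; have /asboolP[ell [_ h]] := icellP e.
by exists (ell ord0); have [e1 e2] := h (corner0 1) ord0.
Qed.

Definition lab (e : icell 1) : L := sval (edge_label e).
Definition src (e : icell 1) : V := e (corner0 1).
Definition tgt (e : icell 1) : V := e (corner1 ord0).

Lemma lab_move e : mv (lab e) (src e) != src e.
Proof. by rewrite /lab; case: edge_label => l []. Qed.
Lemma tgtE e : tgt e = mv (lab e) (src e).
Proof. by rewrite /lab; case: edge_label => l []. Qed.
Lemma labE e l : tgt e = mv l (src e) -> lab e = l.
Proof. by rewrite tgtE => /mv_inj; apply; exact: lab_move. Qed.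

Lemma cube1P (u : cube 1) : u = corner0 1 \/ u = corner1 ord0.
Proof.
case E: (u ord0); [right|left]; apply/ffunP => i; rewrite (ord1 i) E !ffunE //.
Qed.

Lemma edge_eq (e e' : icell 1) : src e = src e' -> lab e = lab e' -> e = e'.
Proof.
move=> hs hl; apply: icell_eq => u; case: (cube1P u) => -> //.
by rewrite -/(tgt e) -/(tgt e') !tgtE hs hl.
Qed.

Lemma edge_exists v l : mv l v != v -> exists e, src e = v /\ lab e = l.
Proof.
move=> h; have [||e [e1 [_ e2]]] := @icell_of 1 (fun=> l) v.
- by move=> i j; rewrite (ord1 i) (ord1 j).
- by [].
exists e; split=> //; apply: labE; rewrite /tgt.
by have [-> _] := e2 (corner0 1) ord0.
Qed.

Lemma edge_at_lab n (c : icell n) ell u i : labelled c ell ->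
  src (edge_at u i (c : cell X n)) = c u /\ lab (edge_at u i (c : cell X n)) = ell i.
Proof.
move=> [_ h].
have s0 : shift u i false = u by apply/ffunP => j; rewrite !ffunE andbF addbF.
have e0 : src (edge_at u i (c : cell X n)) = c u.
  by rewrite /src /edge_at ifaceE !ffunE s0.
split=> //; apply: labE; rewrite e0 /tgt /edge_at ifaceE !ffunE eqxx /=.
by have [-> _] := h u i.
Qed.

Lemma src_flip e : src (flip (e : cell X 1)) = tgt e.
Proof.
rewrite /src /flip /edge_at ifaceE !ffunE /tgt; congr (e _).
by apply/ffunP => j; rewrite !ffunE andbF addbF.
Qed.

Lemma lab_flip e : lab (flip (e : cell X 1)) = lab e.
Proof.
apply: labE; rewrite src_flip [X in mv _ X]tgtE mvK /tgt /flip /edge_at ifaceE !ffunE /src.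
by congr (e _); apply/ffunP => j; rewrite !ffunE (ord1 j) eqxx.
Qed.

(** ** Vertices *)

Definition vx (c : icell 0) : V := c (corner0 0).

Lemma cube0 (u : cube 0) : u = corner0 0.
Proof. by apply/ffunP => -[]. Qed.

Lemma vx_inj : injective vx.
Proof. by move=> c c' e; apply: icell_eq => u; rewrite (cube0 u). Qed.

Lemma pt_subproof (v : V) : is_cell [ffun _ : cube 0 => v].
Proof.
by apply/asboolP; exists (fun i : 'I_0 => False_rect L (notF (ltn_ord i))); split=> [[]|u []].
Qed.

Definition pt (v : V) : icell 0 := ICell (pt_subproof v).
Lemma vx_pt v : vx (pt v) = v. Proof. by rewrite /vx ffunE. Qed.
Lemma pt_vx c : pt (vx c) = c. Proof. by apply: vx_inj; rewrite vx_pt. Qed.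

Lemma vx_vertex_at n (c : icell n) u : vx (vertex_at u (c : cell X n)) = c u.
Proof. by rewrite /vx ifaceE ffunE. Qed.

Lemma sourceE (e : cell X 1) : source e = pt (src e).
Proof. by apply: vx_inj; rewrite vx_vertex_at vx_pt. Qed.
Lemma targetE (e : cell X 1) : target e = pt (tgt e).
Proof. by apply: vx_inj; rewrite vx_vertex_at vx_pt. Qed.

(** ** Squares and hyperplanes *)

Lemma span_labels (a b : cell X 1) : span_square a b ->
  [/\ src a = src b & K (lab a) (lab b)].
Proof.
case=> s [<- <-]; have /asboolP[ell h] := icellP (s : icell 2).
rewrite /corner_edge.
have [-> ->] := @edge_at_lab 2 s ell (corner0 2) ord0 h.
have [-> ->] := @edge_at_lab 2 s ell (corner0 2) ord_max h.
by split=> //; apply: h.1.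
Qed.

Lemma square_at v l l' : K l l' -> mv l v != v -> mv l' v != v ->
  exists (s : icell 2) ell, [/\ labelled s ell, s (corner0 2) = v, ell ord0 = l & ell ord_max = l'].
Proof.
move=> kl m m'; pose ell (i : 'I_2) := if i == ord0 then l else l'.
have [||s [s0 hs]] := @icell_of 2 ell v; last by exists s, ell.
- by move=> i j; rewrite /ell; case: (i) (j) => [[|[|//]] hi] [[|[|//]] hj]; rewrite // K_sym.
- by move=> i; rewrite /ell; case: ifP.
Qed.

Lemma labels_span (a b : cell X 1) : src a = src b -> K (lab a) (lab b) -> span_square a b.
Proof.
move=> e k; have [|s [ell [hs s0 l0 l1]]] := square_at k (lab_move a) _.
  by rewrite e lab_move.
exists s; rewrite /corner_edge.
have [e1 e2] := @edge_at_lab 2 s ell (corner0 2) ord0 hs.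
have [e3 e4] := @edge_at_lab 2 s ell (corner0 2) ord_max hs.
by split; apply: edge_eq; rewrite ?e1 ?e2 ?e3 ?e4 ?s0 ?l0 ?l1.
Qed.

(** Crossing a hyperplane does not change the side of another one, so parallel
    oriented edges have the same label and start on the same side. *)
Lemma parallel_labels (a b : cell X 1) : parallel a b ->
  lab a = lab b /\ side (lab a) (src a) = side (lab b) (src b).
Proof.
elim=> {a b} [a b [s [-> ->]]|//|a b _ [-> ->]//|a b c _ [-> ->] _ [-> ->]//].
have /asboolP[ell h] := icellP (s : icell 2).
have [-> ->] := @edge_at_lab 2 s ell (corner0 2) ord0 h.
have [-> ->] := @edge_at_lab 2 s ell (corner1 ord_max) ord0 h.
by split=> //; have [-> _] := h.2 (corner0 2) ord_max; rewrite side_K // h.1.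
Qed.

Lemma same_hyperplane_labels (a b : cell X 1) : same_hyperplane a b -> lab a = lab b.
Proof. by case=> /parallel_labels[-> _] //; rewrite lab_flip. Qed.

(** Edges that span a square have distinct labels, and edges with the same
    hyperplane have the same label. An edge is not parallel to its reverse
    since they start on different sides. An edge is determined by its origin
    and its label, which excludes self-osculation. Two edges at a vertex with
    crossing labels span a square, which excludes inter-osculation and gives
    the flag condition. *)
Theorem icomplex_special : special X.
Proof.
split.
- split=> [n c i j e|n c c' e0 e|n v e einj es esp].
  + apply: (@sh_inj _ (corner0 n)); apply: (@icell_inj n c).
    have /asboolP[ell h] := icellP (c : icell n).
    have [h1 h2] := @edge_at_lab n c ell (corner0 n) i h.
    have [h3 h4] := @edge_at_lab n c ell (corner0 n) j h.
    have := tgtE (corner_edge c i); rewrite /corner_edge h1 h2 => t1.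
    have := tgtE (corner_edge c j); rewrite /corner_edge h3 h4 => t2.
    have [-> _] := h.2 (corner0 n) i; have [-> _] := h.2 (corner0 n) j.
    by rewrite -t1 -t2 -[edge_at _ i c]/(corner_edge c i) e.
  + have /asboolP[ell h] := icellP (c : icell n).
    have /asboolP[ell' h'] := icellP (c' : icell n).
    have c0 : (c : icell n) (corner0 n) = (c' : icell n) (corner0 n).
      by rewrite -!vx_vertex_at e0.
    have el i : ell i = ell' i.
      have [_ <-] := @edge_at_lab n c ell (corner0 n) i h.
      have [_ <-] := @edge_at_lab n c' ell' (corner0 n) i h'.
      by rewrite -[edge_at _ _ _]/(corner_edge c i) e.
    apply: icell_eq; elim/cube_ind => // u i IH.
    by have [-> _] := h.2 u i; have [-> _] := h'.2 u i; rewrite el IH.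
  + have sv i : src (e i) = vx v by rewrite -(vx_pt (src (e i))) -sourceE es.
    have [||c [c0 h]] := @icell_of n (fun i => lab (e i)) (vx v).
    * by move=> i j /esp/span_labels[].
    * by move=> i; rewrite -(sv i) lab_move.
    exists c; split; first by apply: vx_inj; rewrite vx_vertex_at.
    move=> i; have [h1 h2] := @edge_at_lab n c _ (corner0 n) i h.
    by apply: edge_eq; rewrite ?h1 ?h2 // c0 sv.
- by move=> a b /span_labels[_ k] /same_hyperplane_labels e; rewrite e K_irr in k.
- move=> a /parallel_labels[]; rewrite src_flip lab_flip tgtE side_mv ?lab_move // => _.
  by case: (side _ _).
- move=> a b [sab ab _] /parallel_labels[l _]; apply: ab; apply: edge_eq => //.
  by rewrite -(vx_pt (src a)) -sourceE sab sourceE vx_pt.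
- move=> a b a' b' /span_labels[_ k] [s' ab' nsp] [/same_hyperplane_labels e1 /same_hyperplane_labels e2].
  apply: nsp; apply: labels_span; last by rewrite -e1 -e2.
  by rewrite -(vx_pt (src a')) -sourceE s' sourceE vx_pt.
Qed.


(** ** Paths as words in the labels *)

(** The path made of the edge labelled [l] at [v] if there is one, and empty
    otherwise. Labels that do not move are thus skipped, and relations between
    words of labels hold at every vertex. *)
Definition step v l : seq (icell 1) :=
  if pselect (exists e, src e = v /\ lab e = l) is left h then [:: sval (cid h)]
  else [::].

Lemma stepE e : step (src e) (lab e) = [:: e].
Proof.
rewrite /step; case: pselect => [h|]; last by case; exists e.
by case: cid => e' /= [h1 h2]; congr [:: _]; apply: edge_eq.
Qed.

Lemma step_fix v l : mv l v = v -> step v l = [::].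
Proof.
move=> h; rewrite /step; case: pselect => // h'; exfalso; case: h' => e [e1 e2].
by have := lab_move e; rewrite e2 e1 h eqxx.
Qed.

Fixpoint lpath v (w : seq L) : seq (icell 1) :=
  if w is l :: w' then step v l ++ lpath (mv l v) w' else [::].

Definition run v (w : seq L) : V := foldl (fun v l => mv l v) v w.

Lemma lpath_cat v w w' : lpath v (w ++ w') = lpath v w ++ lpath (run v w) w'.
Proof. by elim: w v => //= l w IH v; rewrite IH catA. Qed.

Lemma run_cat v w w' : run v (w ++ w') = run (run v w) w'.
Proof. exact: foldl_cat. Qed.

Lemma run_rev v w : run (run v w) (rev w) = v.
Proof.
elim: w v => //= l w IH v; rewrite rev_cons -cats1 run_cat /run /= -/(run _ _).
by rewrite -/(run _ (rev w)) IH mvK.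
Qed.

Lemma walkE u w (e : cell X 1) p :
  walk u (e :: p) w = (source e == u) && walk (target e) p w.
Proof. by []. Qed.

Lemma walk_lpath v w : walk (X := X) (pt v) (lpath v w) (pt (run v w)).
Proof.
elim: w v => [|l w IH] v /=; first exact: eqxx.
have [h|h] := eqVneq (mv l v) v; first by rewrite (step_fix h) /= {1}h; move: (IH (mv l v)); rewrite h.
have [e [e1 e2]] := edge_exists h; subst v l; rewrite stepE cat1s.
by rewrite walkE sourceE eqxx targetE tgtE; exact: IH.
Qed.

Lemma walk_labels (p : seq (cell X 1)) u w : walk u p w ->
  p = lpath (vx u) (map lab p) /\ run (vx u) (map lab p) = vx w.
Proof.
elim: p u => [|e p IH] u; first by move=> /eqP->.
rewrite walkE => /andP[/eqP<-]; rewrite sourceE targetE tgtE => /IH[].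
by rewrite !vx_pt /= stepE cat1s => {1}<- <-.
Qed.

(** Homotopy of paths with fixed ends; for loops it is the relation of the
    fundamental group, by [htpy_loop]. *)
Definition hstep (u w : cell X 0) (p q : seq (cell X 1)) : Prop :=
  [/\ walk u p w, walk u q w & path_step p q].
Definition htpy u w := clos_refl_sym_trans _ (hstep u w).

Lemma htpy_cat a b u w l r p q : walk a l u -> walk w r b -> htpy u w p q ->
  htpy a b (l ++ p ++ r) (l ++ q ++ r).
Proof.
move=> al rb; elim=> {p q} [p q [h1 h2 h3]|p|p q _ IH|p q s _ IH1 _ IH2].
- apply: rst_step; split.
  + exact: walk_cat al (walk_cat h1 rb).
  + exact: walk_cat al (walk_cat h2 rb).
  + case: h3 => *; rewrite -!catA !(catA l); [exact: PathCancel|exact: PathSquare].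
- exact: rst_refl.
- exact: rst_sym.
- exact: rst_trans IH1 IH2.
Qed.

Lemma htpy_walk u w p q : htpy u w p q -> walk u p w = walk u q w.
Proof. by elim=> {p q} [p q []|//|//|p q r _ -> _ ->//]; move=> -> ->. Qed.

Lemma htpy_loop v p q : htpy v v p q -> forall lp lq : loop v,
  loop_path lp = p -> loop_path lq = q ->
  clos_refl_sym_trans _ (@loop_step X v) lp lq.
Proof.
elim=> {p q} [p q [_ _ s] lp lq e1 e2|p lp lq e1 e2|p q _ IH lp lq e1 e2|p q r pq IH1 _ IH2 lp lq e1 e2].
- by apply: rst_step; rewrite /loop_step e1 e2.
- by rewrite (_ : lp = lq); [exact: rst_refl|apply: val_inj; rewrite /= e1 e2].
- by apply: rst_sym; apply: IH.
have wq : walk v q v by rewrite -(htpy_walk pq) -e1; exact: loopP.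
by apply: (rst_trans _ _ _ (Loop wq)); [apply: IH1|apply: IH2].
Qed.

Definition lhom v (w w' : seq L) : Prop :=
  run v w = run v w' /\ htpy (pt v) (pt (run v w)) (lpath v w) (lpath v w').

Lemma lhom_refl v w : lhom v w w.
Proof. by split=> //; exact: rst_refl. Qed.

Lemma lhom_sym v w w' : lhom v w w' -> lhom v w' w.
Proof. by case=> e h; split=> //; rewrite -e; exact: rst_sym. Qed.

Lemma lhom_trans v w w' w'' : lhom v w w' -> lhom v w' w'' -> lhom v w w''.
Proof.
case=> e h [e' h']; split; first by rewrite e.
by apply: rst_trans h _; rewrite e.
Qed.

Lemma lhom_cat v a w w' b : lhom (run v a) w w' -> lhom v (a ++ w ++ b) (a ++ w' ++ b).
Proof.
case=> e h; split; first by rewrite !run_cat e.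
rewrite !lpath_cat !run_cat -e; apply: htpy_cat h; first exact: walk_lpath.
exact: walk_lpath.
Qed.

Lemma lhom_fix v l : mv l v = v -> lhom v [:: l] [::].
Proof. by move=> h; rewrite /lhom /run /= (step_fix h) h; split=> //; exact: rst_refl. Qed.

Lemma lhom_cancel v l : lhom v [:: l; l] [::].
Proof.
have [h|h] := eqVneq (mv l v) v.
  by rewrite /lhom /run /= h h (step_fix h); split=> //; exact: rst_refl.
have [e [e1 e2]] := edge_exists h; subst v l.
rewrite /lhom /run /= mvK; split=> //; apply: rst_step.
have w := walk_lpath (src e) [:: lab e; lab e]; rewrite /run /= mvK in w.
have E : step (mv (lab e) (src e)) (lab e) = [:: flip (e : cell X 1)].
  by rewrite -stepE src_flip lab_flip tgtE.
rewrite E in w *.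
split=> //; first exact: eqxx.
by rewrite stepE; exact: (@PathCancel X [::] e [::]).
Qed.

Lemma lhom_swap v l l' : K l l' -> lhom v [:: l; l'] [:: l'; l].
Proof.
move=> k; have kc := K_comm v k.
have [h|h] := eqVneq (mv l v) v.
  have h' : mv l (mv l' v) = mv l' v by rewrite kc h.
  rewrite /lhom /run /= h (step_fix h) /= (step_fix h') h' cats0; split=> //; exact: rst_refl.
have [h1|h1] := eqVneq (mv l' v) v.
  have h' : mv l' (mv l v) = mv l v by rewrite -kc h1.
  rewrite /lhom /run /= h1 (step_fix h1) /= (step_fix h') h' cats0; split=> //; exact: rst_refl.
have [s [ell [hs s0 l0 l1]]] := square_at k h h1.
have P i j x y : ell i = x -> ell j = y -> lpath v [:: x; y] =
    [:: edge_at (corner0 2) i (s : cell X 2); edge_at (sh (corner0 2) i) j (s : cell X 2)].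
  move=> <- <-; have [e1 e2] := @edge_at_lab 2 s ell (corner0 2) i hs.
  have [e3 e4] := @edge_at_lab 2 s ell (sh (corner0 2) i) j hs.
  have [e5 _] := hs.2 (corner0 2) i.
  rewrite /= -s0 -e1 -e2 stepE e1 e2 -e5 -e3 -e4 stepE; done.
split; first by rewrite /run /= kc.
apply: rst_step; split.
- exact: walk_lpath.
- by rewrite (_ : run v [:: l; l'] = run v [:: l'; l]); [exact: walk_lpath|rewrite /run /= kc].
rewrite (P _ _ _ _ l0 l1) (P _ _ _ _ l1 l0).
exact: (@PathSquare X [::] s [::]).
Qed.

(** Homotopy allows for the relations of the right-angled Coxeter group whose
    generators are the labels. The letter [l] is cancelled with a letter of the
    stack if it commutes with everything in between. This solves the word
    problem, so that homotopies can be found by computation. *)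
Fixpoint rcancel (st : seq L) (l : L) : option (seq L) :=
  if st is m :: st' then
    if m == l then Some st'
    else if K m l then omap (cons m) (rcancel st' l) else None
  else None.
Definition rpush (st : seq L) (l : L) : seq L := odflt (l :: st) (rcancel st l).
Definition racg (w : seq L) : seq L := foldl rpush [::] w.

Lemma lhom_rcancel v st l st' : rcancel st l = Some st' ->
  lhom v (rev st ++ [:: l]) (rev st').
Proof.
elim: st st' => //= m st IH st'; case: eqVneq => [->|_].
  case=> <-; rewrite rev_cons cat_rcons -[X in lhom _ _ X]cats0.
  exact: (@lhom_cat v (rev st) [:: l; l] [::] [::] (lhom_cancel _ _)).
case: ifP => // k; case E: (rcancel st l) => [st''|] //= [<-].
rewrite !rev_cons cat_rcons.
apply: lhom_trans (@lhom_cat v (rev st) [:: m; l] [:: l; m] [::] (lhom_swap _ k)) _.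
rewrite cats0 -cat_rcons -cats1 -[X in lhom _ _ X]cats1.
exact: (@lhom_cat v [::] _ _ [:: m] (IH _ E)).
Qed.

Lemma lhom_racg v w : lhom v w (rev (racg w)).
Proof.
suff H st : lhom v (rev st ++ w) (rev (foldl rpush st w)) by exact: (H [::]).
elim: w st => [|l w IH] st /=; first by rewrite cats0; exact: lhom_refl.
apply: lhom_trans (IH _); rewrite -cat1s catA.
suff h : lhom v (rev st ++ [:: l]) (rev (rpush st l)).
  exact: (@lhom_cat v [::] _ _ w h).
rewrite /rpush; case E: rcancel => [st'|] /=; first exact: lhom_rcancel.
by rewrite rev_cons cats1; exact: lhom_refl.
Qed.

Lemma lhom_inv v w : lhom v (w ++ rev w) [::].
Proof.
elim: w v => [|l w IH] v /=; first exact: lhom_refl.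
rewrite rev_cons -cats1 catA -cat1s.
apply: lhom_trans (@lhom_cat v [:: l] (w ++ rev w) [::] [:: l] (IH _)) _.
exact: lhom_cancel.
Qed.

Lemma racg_lhom v w w' : racg (w ++ rev w') = [::] -> lhom v w w'.
Proof.
move=> h; have e : lhom v (w ++ rev w') [::] by have := lhom_racg v (w ++ rev w'); rewrite h.
have r : run v w = run v w'.
  have := e.1; rewrite run_cat => e1.
  by rewrite -[LHS](run_rev _ (rev w')) e1 revK.
apply: lhom_trans (_ : lhom v w (w ++ rev w' ++ w')) _.
  rewrite -[X in lhom _ X _]cats0; apply: lhom_sym.
  have := lhom_inv (run v w) (rev w'); rewrite revK => h1.
  by have := @lhom_cat v w _ _ [::] h1; rewrite !cats0.
by rewrite catA; exact: (@lhom_cat v [::] _ _ w' e).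
Qed.

End Involutions.

(** * A finite special complex *)

(** Gamma1 is the fundamental group of a square complex with four vertices: a
    vertex c' and a vertex p' joined by three horizontal edges, a second copy
    c'', p'' of this graph, two vertical edges from c' to c'', three vertical
    edges from p' to p'', and six squares. The weights of the edges, which are
    words of Gamma1, are given by [wt]. The complex below is the covering that
    belongs to the action [qact] of Gamma1 on 18 points. In this covering the
    hyperplanes are embedded and can be named by labels, and every statement
    about it is a finite check. *)

Definition tstep (e : bool) (i : tri) : tri :=
  match e, i with
  | false, I0 => I1 | false, I1 => I2 | false, I2 => I0
  | true, I0 => I2 | true, I1 => I0 | true, I2 => I1
  end.

(** The triple (a, b, e) stands for an element of the semidirect product of
    (Z/3)^2 by the inversion, e being the sign. In this quotient of Gamma1, x
    and t generate the two factors Z/3 and y is the inversion; [qx], [qy], [qt]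
    multiply on the right by the generators or their inverses. *)
Definition Qt := (tri * tri * bool)%type.
Definition qx (s : bool) (q : Qt) : Qt := let: (a, b, e) := q in (a, tstep (s (+) e) b, e).
Definition qt (s : bool) (q : Qt) : Qt := let: (a, b, e) := q in (tstep (s (+) e) a, b, e).
Definition qy (q : Qt) : Qt := let: (a, b, e) := q in (a, b, ~~ e).
Definition qact (q : Qt) (l : 'I_3 * bool) : Qt :=
  match val l.1 with 0 => qx l.2 q | 1 => qy q | _ => qt l.2 q end.

(** The copy (' or ''), the type (c or p) of the vertex, and its sheet. *)
Definition Vt := (bool * bool * Qt)%type.
(** Hyperplanes dual to horizontal edges, then those dual to vertical edges. *)
Definition Lt := (tri * bool * tri + tri)%type.

(** The sheet is multiplied by the weight of the [j]-th horizontal edge of the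
    copy [s]; [hdiv] is the inverse. *)
Definition hmul (s : bool) (j : tri) (q : Qt) : Qt :=
  match j with
  | I1 => q
  | I2 => if s then qx false (qy (qx true q)) else qy q
  | I0 => if s then qt true (qx true q) else qt true q
  end.
Definition hdiv (s : bool) (j : tri) (q : Qt) : Qt :=
  match j with
  | I1 => q
  | I2 => if s then qx false (qy (qx true q)) else qy q
  | I0 => if s then qx false (qt false q) else qt false q
  end.

Definition qalpha (q : Qt) : tri * bool := (q.1.1, q.2).

Definition Lh (a : tri) (e : bool) (j : tri) : Lt := inl (a, e, j).
Definition Lv (i : tri) : Lt := inr i.

Definition mvt (l : Lt) (v : Vt) : Vt :=
  let: (s, k, q) := v in let: (a, b, e) := q in
  match l with
  | inl (a0, e0, j) =>
    if k then let q' := hdiv s j q in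
      if qalpha q' == (a0, e0) then (s, false, q') else v
    else if (a, e) == (a0, e0) then (s, true, hmul s j q) else v
  | inr i =>
    if i == a then (~~ s, k, qx s q)
    else if i == tstep e a then (~~ s, k, q)
    else if k then (~~ s, k, qx (~~ s) q) else v
  end.

Definition Kt (l l' : Lt) : bool :=
  match l, l' with
  | inl (a, e, _), inr i | inr i, inl (a, e, _) => i != tstep (~~ e) a
  | _, _ => false
  end.

Definition sidet (l : Lt) (v : Vt) : bool := if l is inl _ then v.1.2 else v.1.1.

Definition tris := [:: I0; I1; I2].
Definition bools := [:: false; true].
Definition allQ : seq Qt := [seq (x, e) | x <- [seq (a, b) | a <- tris, b <- tris], e <- bools].
Definition allV : seq Vt := [seq (x, q) | x <- [seq (s, k) | s <- bools, k <- bools], q <- allQ].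
Definition allL : seq Lt :=
  [seq inl x | x <- [seq (y, j) | y <- [seq (a, e) | a <- tris, e <- bools], j <- tris]] ++ map inr tris.

Lemma mem_tris i : i \in tris. Proof. by case: i. Qed.
Lemma mem_bools i : i \in bools. Proof. by case: i. Qed.
Lemma mem_allQ q : q \in allQ.
Proof.
case: q => [[a b] e]; apply: allpairs_f; last exact: mem_bools.
by apply: allpairs_f; exact: mem_tris.
Qed.
Lemma mem_allV v : v \in allV.
Proof.
case: v => [[s k] q]; apply: allpairs_f; last exact: mem_allQ.
by apply: allpairs_f; exact: mem_bools.
Qed.
Lemma mem_allL l : l \in allL.
Proof.
rewrite mem_cat; case: l => [[[a e] j]|i]; apply/orP; [left|right].
  apply/map_f/allpairs_f; last exact: mem_tris.
  by apply: allpairs_f; [exact: mem_tris|exact: mem_bools].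
exact/map_f/mem_tris.
Qed.

Lemma forallV (P : pred Vt) : all P allV -> forall v, P v.
Proof. by move=> /allP h v; apply: h; exact: mem_allV. Qed.
Lemma forallL (P : pred Lt) : all P allL -> forall v, P v.
Proof. by move=> /allP h v; apply: h; exact: mem_allL. Qed.
Lemma forallQ (P : pred Qt) : all P allQ -> forall v, P v.
Proof. by move=> /allP h v; apply: h; exact: mem_allQ. Qed.

Lemma mvtK l : involutive (mvt l).
Proof.
move=> v; apply/eqP; move: l; apply: forallL; move: v; apply: forallV.
by vm_compute.
Qed.

Lemma Kt_sym : symmetric Kt.
Proof. by move=> [[[a e] j]|i] [[[a' e'] j']|i']. Qed.

Lemma Kt_irr : irreflexive Kt.
Proof. by move=> [[[a e] j]|i]. Qed.

Lemma Kt_comm l l' v : Kt l l' -> mvt l (mvt l' v) = mvt l' (mvt l v).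
Proof.
suff: ~~ Kt l l' || (mvt l (mvt l' v) == mvt l' (mvt l v)) by case: Kt => //= /eqP.
move: v; apply: forallV; move: l'; apply: forallL; move: l; apply: forallL.
by vm_compute.
Qed.

Lemma mvt_inj l l' v : mvt l v != v -> mvt l v = mvt l' v -> l = l'.
Proof.
suff: (mvt l v == v) || ((mvt l v != mvt l' v) || (l == l')).
  by move=> /orP[->//|/orP[/eqP//|/eqP//]].
by move: v; apply: forallV; move: l'; apply: forallL; move: l; apply: forallL; vm_compute.
Qed.

Lemma sidet_mv l v : mvt l v != v -> sidet l (mvt l v) = ~~ sidet l v.
Proof.
suff: (mvt l v == v) || (sidet l (mvt l v) == ~~ sidet l v) by move=> /orP[->//|/eqP].
by move: v; apply: forallV; move: l; apply: forallL; vm_compute.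
Qed.

Lemma sidet_K l l' v : Kt l l' -> sidet l (mvt l' v) = sidet l v.
Proof.
suff: ~~ Kt l l' || (sidet l (mvt l' v) == sidet l v) by case: Kt => //= /eqP.
by move: v; apply: forallV; move: l'; apply: forallL; move: l; apply: forallL; vm_compute.
Qed.

Definition pants : moves :=
  @Moves Vt Lt mvt Kt sidet mvtK Kt_sym Kt_irr Kt_comm mvt_inj sidet_mv sidet_K.
Definition cover : cubeComplex := icomplex pants.

Notation word := (seq ('I_3 * bool)).
Definition xlet s : 'I_3 * bool := (gen_x, s).
Definition ylet s : 'I_3 * bool := (gen_y, s).
Definition tlet s : 'I_3 * bool := (gen_t, s).

(** Around every square the weights multiply to 1 in Gamma1, by [wt_square]
    below, so that they define a homomorphism from the fundamental group. *)
Definition wt (l : Lt) (v : Vt) : word :=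
  if mvt l v == v then [::] else
  let: (s, k, q) := v in let: (a, b, e) := q in
  match l with
  | inl (_, _, j) =>
    let w := match j with
      | I1 => [::]
      | I2 => if s then [:: xlet true; ylet false; xlet false] else [:: ylet false]
      | I0 => if s then [:: xlet true; tlet true] else [:: tlet true]
      end in if k then inv_word w else w
  | inr i =>
    let w := if i == a then [:: xlet false]
      else if i == tstep e a then [::] else [:: tlet false; xlet true; tlet true] in
    if s then inv_word w else w
  end.

Definition q1 : Qt := (I0, I0, false).
Definition base : Vt := (false, false, q1).

(** A path from the vertex (', c, q) to the next such vertex, whose weight is
    the given letter. *)
Definition liftl (q : Qt) (l : 'I_3 * bool) : seq Lt :=
  let: (a, b, e) := q in
  match val l.1 with
  | 0 => if l.2 then [:: Lv (tstep e a); Lv a] else [:: Lv a; Lv (tstep e a)]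
  | 1 => if l.2 then [:: Lh a e I1; Lh a (~~ e) I2] else [:: Lh a e I2; Lh a (~~ e) I1]
  | _ => if l.2 then [:: Lh a e I0; Lh (tstep (~~ e) a) e I1]
         else [:: Lh a e I1; Lh (tstep e a) e I0]
  end.

Fixpoint liftw (q : Qt) (w : word) : seq Lt :=
  if w is l :: w' then liftl q l ++ liftw (qact q l) w' else [::].

(** A path of trivial weight from the vertex (', c) of the same sheet. *)
Definition connector (v : Vt) : seq Lt :=
  let: (s, k, (a, b, e)) := v in
  (if s then [:: Lv (tstep e a)] else [::]) ++ (if k then [:: Lh a e I1] else [::]).

Definition letters : seq ('I_3 * bool) :=
  [:: xlet false; xlet true; ylet false; ylet true; tlet false; tlet true].

Notation prun := (@run pants).

Definition vq (q : Qt) : Vt := (false, false, q).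

Lemma forall_letter (P : pred ('I_3 * bool)) : all P letters -> forall l, P l.
Proof.
move=> /allP h [a s]; apply: h; suff: a = gen_x \/ (a = gen_y \/ a = gen_t).
  by case: s => -[->|[->|->]].
by case: a => -[|[|[|//]]] h; [left|right; left|right; right]; exact: val_inj.
Qed.

Lemma run_liftl q l : prun (vq q) (liftl q l) = vq (qact q l).
Proof.
apply/eqP; move: l; apply: forall_letter.
by move: q; apply: (@forallQ (fun q => all _ letters)); vm_compute.
Qed.

Lemma run_connector v : prun (vq v.2) (connector v) = v.
Proof. by apply/eqP; move: v; apply: forallV; vm_compute. Qed.

Lemma lift_inverse q l : @racg pants (liftw q [:: l; inv_letter l]) = [::].
Proof.
apply/eqP; move: l; apply: forall_letter.
by move: q; apply: (@forallQ (fun q => all _ letters)); vm_compute.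
Qed.

Lemma lift_relation q :
  @racg pants (liftw q [:: tlet false; xlet false; tlet true] ++
       rev (liftw q [:: xlet true; ylet true; xlet false; ylet false])) = [::].
Proof. by apply/eqP; move: q; apply: forallQ; vm_compute. Qed.

(** Every edge is homotopic to the lift of its weight, up to the connectors at
    its ends. With [lift_relation] this inverts the homomorphism given by the
    weights. *)
Lemma connector_edge l v : mvt l v != v ->
  @racg pants ((connector v ++ [:: l]) ++ rev (liftw v.2 (wt l v) ++ connector (mvt l v))) = [::] /\
  foldl qact v.2 (wt l v) = (mvt l v).2.
Proof.
suff: (mvt l v == v) || [&& @racg pants ((connector v ++ [:: l]) ++ rev (liftw v.2 (wt l v) ++ connector (mvt l v))) == [::] &
  foldl qact v.2 (wt l v) == (mvt l v).2].
  by move=> /orP[->//|/andP[/eqP -> /eqP ->]].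
by move: v; apply: forallV; move: l; apply: forallL; vm_compute.
Qed.

(** * Its fundamental group as a subgroup of Gamma1 *)

Local Open Scope group_scope.

Notation gcls := (@cls (word_preGroup Gamma1_rel)).
Notation weqv := (clos_refl_sym_trans _ (word_step Gamma1_rel)).
Notation plhom := (@lhom pants).

Lemma gcls_cat u w : gcls (u ++ w) = gcls u * gcls w.
Proof. by rewrite -clsM. Qed.

Lemma gcls_inv w : gcls (inv_word w) = (gcls w)^-1.
Proof. exact: (clsV (P := word_preGroup Gamma1_rel)). Qed.

(** Free reduction with a stack. *)
Definition fpush (st : word) (l : 'I_3 * bool) : word :=
  if st is m :: st' then if l == inv_letter m then st' else l :: st else [:: l].
Definition fred (w : word) : word := rev (foldl fpush [::] w).

Lemma gcls_fred w : gcls (fred w) = gcls w.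
Proof.
suff H st : gcls (rev (foldl fpush st w)) = gcls (rev st ++ w) by rewrite /fred H.
elim: w st => [|l w IH] st /=; first by rewrite cats0.
rewrite IH -cat1s catA !gcls_cat; congr (_ * _).
case: st => [|m st] /=; first by rewrite -gcls_cat.
case: eqVneq => [->|_]; last by rewrite !rev_cons -!cats1 !gcls_cat.
apply/esym; rewrite -gcls_cat rev_cons cat_rcons; apply/cls_eq; apply: rst_step.
by have := @WordCancel _ Gamma1_rel (rev st) m [::]; rewrite !cats0.
Qed.

Definition relator : word :=
  [:: tlet false; xlet false; tlet true; ylet true; xlet true; ylet false; xlet false].
(** The word problem for the weights around a square: after free reduction such
    a word is empty or a cyclic conjugate of the relator or of its inverse. *)
Definition relators : seq word :=
  [::] :: [seq rot n w | w <- [:: relator; inv_word relator], n <- iota 0 7].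

Lemma gcls_relators w : w \in relators -> gcls w = 1.
Proof.
have r1 : gcls relator = 1.
  have e := Gamma1_relE.
  rewrite /relator !clsW /= -[gcls [::]]/(1 : Gamma1) mulg1 !mulgA e.
  by rewrite !mulgK mulgVK mulVg.
rewrite in_cons => /orP[/eqP-> //|/allpairsP[[w' n] /= [h _ ->]]].
have w1 : gcls w' = 1.
  move: h; rewrite !inE => /orP[/eqP->//|/eqP->].
  by rewrite gcls_inv r1 invg1.
rewrite /rot gcls_cat; move: w1; rewrite -{1}(cat_take_drop n w') gcls_cat => w1.
move: w1 => /(congr1 (fun z => (gcls (take n w'))^-1 * z * gcls (take n w'))).
by rewrite mulKg mulg1 mulVg.
Qed.

Lemma gcls_eq u w : fred (u ++ inv_word w) \in relators -> gcls u = gcls w.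
Proof.
move=> /gcls_relators; rewrite gcls_fred gcls_cat gcls_inv.
by move=> /(congr1 (fun z => z * gcls w)); rewrite mulgVK mul1g.
Qed.

Lemma wt_inv l v : gcls (wt l v ++ wt l (mvt l v)) = 1.
Proof.
rewrite -[1 in RHS]/(gcls [::]); apply: gcls_eq; move: v; apply: forallV; move: l.
by apply: forallL; vm_compute.
Qed.

Lemma wt_square l l' v : Kt l l' ->
  gcls (wt l v ++ wt l' (mvt l v)) = gcls (wt l' v ++ wt l (mvt l' v)).
Proof.
move=> k; apply: gcls_eq; move: k.
suff: ~~ Kt l l' || (fred ((wt l v ++ wt l' (mvt l v)) ++
    inv_word (wt l' v ++ wt l (mvt l' v))) \in relators) by case: Kt.
by move: v; apply: forallV; move: l'; apply: forallL; move: l; apply: forallL; vm_compute.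
Qed.

Notation plab := (@lab pants).
Notation psrc := (@src pants).
Notation ppt := (@pt pants).
Notation pvx := (@vx pants).
Notation plpath := (@lpath pants).

Definition pword (p : seq (cell cover 1)) : word :=
  flatten [seq wt (plab e) (psrc e) | e <- p].

Lemma pword_cat (p q : seq (cell cover 1)) : pword (p ++ q) = pword p ++ pword q.
Proof. by rewrite /pword map_cat flatten_cat. Qed.

Lemma pword_cons (e : cell cover 1) p : pword (e :: p) = wt (plab e) (psrc e) ++ pword p.
Proof. by []. Qed.

Fixpoint lword (v : Vt) (ws : seq Lt) : word :=
  if ws is l :: ws' then wt l v ++ lword (mvt l v) ws' else [::].

Lemma lword_cat v a b : lword v (a ++ b) = lword v a ++ lword (prun v a) b.
Proof. by elim: a v => //= l a IH v; rewrite IH catA. Qed.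

Lemma pword_lpath v ws : pword (plpath v ws) = lword v ws.
Proof.
elim: ws v => //= l ws IH v; rewrite pword_cat IH; congr (_ ++ _).
have [h|h] := eqVneq (mvt l v) v; first by rewrite step_fix // /wt h eqxx.
have [e [e1 e2]] := @edge_exists pants v l h; subst v l.
by rewrite stepE pword_cons /= cats0.
Qed.

(** Homotopies of paths preserve weights, since the weights around a square
    multiply to 1. *)
Lemma gcls_path_step (p q : seq (cell cover 1)) : path_step p q -> gcls (pword p) = gcls (pword q).
Proof.
case=> {p q} [p e q|p s q]; rewrite !pword_cat !gcls_cat.
  rewrite src_flip lab_flip tgtE -[gcls [::]]/(1 : Gamma1) mulg1 -gcls_cat.
  by rewrite (wt_inv (plab e) (psrc e)) mul1g.
congr (_ * (_ * _)); rewrite -[gcls [::]]/(1 : Gamma1) !mulg1 -!gcls_cat; have /asboolP[ell h] := icellP (s : icell pants 2).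
have [-> ->] := @edge_at_lab pants 2 s ell (corner0 2) ord0 h.
have [-> ->] := @edge_at_lab pants 2 s ell (corner0 2) ord_max h.
have [-> ->] := @edge_at_lab pants 2 s ell (corner1 ord0) ord_max h.
have [-> ->] := @edge_at_lab pants 2 s ell (corner1 ord_max) ord0 h.
have [-> _] := h.2 (corner0 2) ord0; have [-> _] := h.2 (corner0 2) ord_max.
by apply: wt_square; apply: (h.1 ord0 ord_max).
Qed.

Lemma pword_walk (p : seq (cell cover 1)) u w : walk u p w -> pword p = lword (pvx u) (map plab p).
Proof.
elim: p u => // e p IH u; rewrite (@walkE pants) => /andP[/eqP<- /IH].
by rewrite pword_cons => ->; rewrite sourceE targetE !vx_pt tgtE.
Qed.

(** ** Lifting words *)

Lemma qactK q l : qact (qact q l) (inv_letter l) = q.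
Proof.
apply/eqP; move: l; apply: forall_letter.
by move: q; apply: (@forallQ (fun q => all _ letters)); vm_compute.
Qed.

Lemma qact_rel q u w : Gamma1_rel u w -> foldl qact q u = foldl qact q w.
Proof.
case=> -> ->; apply/eqP; move: q; apply: forallQ; by vm_compute.
Qed.

Lemma qact_eqv q u w : weqv u w -> foldl qact q u = foldl qact q w.
Proof. by apply: foldl_eqv; [exact: qactK|exact: qact_rel]. Qed.

Lemma lift_cat q u w : liftw q (u ++ w) = liftw q u ++ liftw (foldl qact q u) w.
Proof. by elim: u q => //= l u IH q; rewrite IH catA. Qed.

Lemma run_lift q w : prun (vq q) (liftw q w) = vq (foldl qact q w).
Proof. by elim: w q => //= l w IH q; rewrite run_cat run_liftl IH. Qed.

Lemma lift_step q u w : word_step Gamma1_rel u w -> plhom (vq q) (liftw q u) (liftw q w).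
Proof.
case=> {u w} [p l r|p u w r uw]; rewrite !lift_cat.
  rewrite [foldl qact _ [:: _; _]]/= qactK.
  apply: (@lhom_cat pants (vq q) (liftw q p) _ [::]); rewrite run_lift.
  by apply: racg_lhom; rewrite cats0 lift_inverse.
rewrite (qact_rel _ uw); apply: lhom_cat; rewrite run_lift.
case: uw => -> ->; apply: racg_lhom; exact: lift_relation.
Qed.

(** Equivalent words lift to homotopic paths, because a relator lifts to a
    null-homotopic path at every sheet. *)
Lemma lift_eqv q u w : weqv u w -> plhom (vq q) (liftw q u) (liftw q w).
Proof.
elim=> {u w} [u w /lift_step|u|u w _|u w r _ h1 _ h2].
- exact.
- exact: lhom_refl.
- exact: lhom_sym.
- exact: lhom_trans h1 h2.
Qed.

(** Every path is homotopic to the lift of its weight. *)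
Lemma lift_lword (ws : seq Lt) (v : Vt) :
  plhom (vq v.2) (connector v ++ ws) (liftw v.2 (lword v ws) ++ connector (prun v ws)) /\
  foldl qact v.2 (lword v ws) = (prun v ws).2.
Proof.
elim: ws v => [|l ws IH] v; first by rewrite cats0; split=> //; exact: lhom_refl.
have rc := run_connector v.
have [h|h] := eqVneq (mvt l v) v.
  have e0 : prun v (l :: ws) = prun v ws by rewrite -[LHS]/(prun (mvt l v) ws) h.
  have e1 : lword v (l :: ws) = lword v ws by rewrite /= /wt h eqxx.
  have [h1 h2] := IH v; rewrite e0 e1; split=> //.
  apply: lhom_trans h1; rewrite -cat1s.
  by apply: (@lhom_cat pants (vq v.2) (connector v) [:: l] [::] ws); apply: lhom_fix; rewrite rc.
have [k1 k2] := connector_edge h; have [h1 h2] := IH (mvt l v).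
rewrite -[prun v (l :: ws)]/(prun (mvt l v) ws) [lword _ _]/= foldl_cat k2; split=> //.
rewrite lift_cat k2 -cat1s catA.
apply: lhom_trans (@lhom_cat pants (vq v.2) [::] _ _ ws (racg_lhom _ k1)) _.
rewrite cat0s -!catA.
have h3 : plhom (prun (vq v.2) (liftw v.2 (wt l v))) (connector (mvt l v) ++ ws)
    (liftw (mvt l v).2 (lword (mvt l v) ws) ++ connector (prun (mvt l v) ws)).
  by rewrite run_lift k2.
by have := @lhom_cat pants (vq v.2) (liftw v.2 (wt l v)) _ _ [::] h3; rewrite !cats0.
Qed.

(** ** The homomorphism *)


Definition basept : cell cover 0 := ppt base.
Notation coverH := (fundamental_group basept).
Notation hcls := (@cls (loop_preGroup basept)).

Definition Psi (h : coverH) : Gamma1 := gcls (pword (loop_path (repr h))).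

Lemma Psi_cls (p : loop basept) : Psi (hcls p) = gcls (pword (loop_path p)).
Proof.
have E (l l' : loop basept) : clos_refl_sym_trans _ (@loop_step cover basept) l l' ->
    gcls (pword (loop_path l)) = gcls (pword (loop_path l')).
  elim=> {l l'} [l l' st|//|l l' _ ->//|l l' l'' _ -> _ ->//].
  exact: gcls_path_step st.
exact: (E _ _ (@repr_cls (loop_preGroup basept) p)).
Qed.

Lemma PsiM : {morph Psi : g h / g * h}.
Proof.
by move=> g h; rewrite -(clsK g) -(clsK h) -clsM !Psi_cls pword_cat gcls_cat.
Qed.

HB.instance Definition _ := isMultiplicative.Build coverH Gamma1 Psi PsiM.

Lemma Psi1 : Psi 1 = 1. Proof. by apply: (mulgI (Psi 1)); rewrite -PsiM !mulg1. Qed.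

Lemma loop_labels (p : loop basept) :
  [/\ loop_path p = plpath base (map plab (loop_path p)),
      prun base (map plab (loop_path p)) = base &
      pword (loop_path p) = lword base (map plab (loop_path p))].
Proof.
have w := loopP p; have [h1 h2] := walk_labels w.
have vb : pvx basept = base := @vx_pt pants base.
by rewrite vb in h1 h2; split=> //; rewrite (pword_walk w) vb.
Qed.

Lemma Psi_stab (h : coverH) : exists2 w, Psi h = gcls w & foldl qact q1 w = q1.
Proof.
exists (pword (loop_path (repr h))) => //; have [_ h2 ->] := loop_labels (repr h).
by have [_ ->] := lift_lword (map plab (loop_path (repr h))) base; rewrite h2.
Qed.

(** A loop is homotopic to the lift of its weight, and the lift of a word that
    is trivial in Gamma1 is null-homotopic. *)
Lemma Psi_ker (h : coverH) : Psi h = 1 -> h = 1.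
Proof.
rewrite -(clsK h); set p := repr h; rewrite Psi_cls => e.
have [h1 h2 h3] := loop_labels p; set ws := map plab _ in h1 h2 h3.
have e' : weqv (pword (loop_path p)) [::].
  by apply/(@cls_eq (word_preGroup Gamma1_rel)).
have [k _] := lift_lword ws base.
have : plhom base ws [::].
  apply: lhom_trans k _; rewrite -h3 h2 cats0.
  exact: (lift_eqv q1 e').
case=> _; rewrite h2 -h1 => hp; apply/(@cls_eq (loop_preGroup basept)).
exact: (htpy_loop hp).
Qed.

Lemma Psi_inj : injective Psi.
Proof.
move=> g h e; apply/(mulgI h^-1); rewrite mulVg; apply: Psi_ker.
by rewrite PsiM e -PsiM mulVg Psi1.
Qed.

Lemma lword_liftl q l : lword (vq q) (liftl q l) = [:: l].
Proof.
apply/eqP; move: l; apply: forall_letter.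
by move: q; apply: (@forallQ (fun q => all _ letters)); vm_compute.
Qed.

Lemma lword_lift q w : lword (vq q) (liftw q w) = w.
Proof. by elim: w q => //= l w IH q; rewrite lword_cat lword_liftl run_liftl IH. Qed.

(** The lift of a word that stabilises the base sheet is a loop. The image of
    [Psi] is therefore the stabiliser of a point in a finite action. *)
Lemma Psi_range w : foldl qact q1 w = q1 -> range Psi (gcls w).
Proof.
move=> e; have wk := @walk_lpath pants base (liftw q1 w).
rewrite (run_lift q1) e in wk.
exists (hcls (Loop wk)) => //.
by rewrite Psi_cls /= pword_lpath lword_lift.
Qed.

Definition tripow (i : tri) (l : 'I_3 * bool) : word :=
  match i with I0 => [::] | I1 => [:: l] | I2 => [:: l; l] end.
Definition coset_word (q : Qt) : word :=
  tripow q.1.2 (xlet false) ++ tripow q.1.1 (tlet false) ++ (if q.2 then [:: ylet false] else [::]).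

Lemma coset_wordE q : foldl qact q1 (coset_word q) = q.
Proof. by apply/eqP; move: q; apply: forallQ; vm_compute. Qed.

Lemma Psi_finite_index : finite_index (range Psi).
Proof.
exists [seq gcls (inv_word (coset_word q)) | q <- allQ] => g.
rewrite -(clsK g); set w := repr g.
pose q := foldl qact q1 (inv_word w).
exists (gcls (inv_word (coset_word q))); first exact: map_f (mem_allQ q).
rewrite gcls_inv invgK -gcls_cat; apply: Psi_range.
rewrite foldl_cat coset_wordE /q -foldl_cat.
by rewrite (qact_eqv q1 (word_mulV Gamma1_rel w)).
Qed.

Lemma cover_connected : connected cover.
Proof.
split; first by split; exact: (ppt base).
have R (u : cell cover 0) : exists p, walk (X := cover) (ppt base) p u.
  exists (plpath base (liftw q1 (coset_word (pvx u).2) ++ connector (pvx u))).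
  have := @walk_lpath pants base (liftw q1 (coset_word (pvx u).2) ++ connector (pvx u)).
  by rewrite run_cat (run_lift q1) coset_wordE run_connector pt_vx.
move=> u w; have [p hp] := R u; have [q hq] := R w.
by exists (path_rev p ++ q); apply: walk_cat (walk_rev hp) hq.
Qed.

Theorem Gamma1_virtually_special : virtually special_group Gamma1.
Proof.
exists coverH, (Psi : {multiplicative coverH -> Gamma1}); split.
- exact: Psi_inj.
- exact: Psi_finite_index.
exists cover, basept; split.
- exact: cover_connected.
- exact: icomplex_special.
by exists (idfun : {multiplicative coverH -> coverH}); exists idfun.
Qed.

Local Close Scope group_scope.

(** * Congruences on the finite index subgroup *)

Local Open Scope ring_scope.

Lemma size_exp_gt (p : {poly rat}) n : (1 < size p)%N -> (n < size (p ^+ n)%R)%N.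
Proof.
move=> p1; have s0 : (0 < size (p ^+ n)%R)%N.
  by rewrite size_poly_gt0 expf_neq0 // -size_poly_gt0 ltnW.
by rewrite -(prednK s0) size_exp ltnS leq_pmull // -subn1 subn_gt0.
Qed.

Section AdicFiltration.
Variables (pi : {poly rat}) (pi_gt1 : (1 < size pi)%N).
Local Notation K := {fraction {poly rat}}.
Local Notation "x %:F" := (tofrac x).

(** The multiples of the k-th power of [pi] in the local ring of fractions with
    a denominator prime to [pi]. *)
Definition adic (k : nat) (z : K) : Prop :=
  exists n d, coprimep pi d /\ z = (pi ^+ k * n)%:F / d%:F.

Lemma coprimep_neq0 d : coprimep pi d -> d != 0.
Proof.
by apply: contraTneq => ->; rewrite coprimep0 -size_poly_eq1 gtn_eqF.
Qed.

Lemma adic_frac n d : coprimep pi d -> adic 0 (n%:F / d%:F).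
Proof. by move=> cd; exists n, d; rewrite expr0 mul1r. Qed.

Lemma adic_poly k n : adic k (pi ^+ k * n)%:F.
Proof. by exists n, 1; rewrite coprimep1 tofrac1 divr1. Qed.

Lemma adic0 k : adic k 0.
Proof. by have := adic_poly k 0; rewrite mulr0 tofrac0. Qed.

Lemma adic1 : adic 0 1.
Proof. by have := adic_poly 0 1; rewrite expr0 mulr1 tofrac1. Qed.

Lemma adicD k a b : adic k a -> adic k b -> adic k (a + b).
Proof.
move=> [n [d [cd ->]]] [n' [d' [cd' ->]]].
exists (n * d' + n' * d), (d * d'); split; first by rewrite coprimepMr cd.
rewrite addf_div ?tofrac_eq0 ?coprimep_neq0 // -!tofracM -tofracD.
by congr (_%:F / _); ring.
Qed.

Lemma adicN k a : adic k a -> adic k (- a).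
Proof.
by move=> [n [d [cd ->]]]; exists (- n), d; rewrite mulrN tofracN mulNr.
Qed.

Lemma adicM j k a b : adic j a -> adic k b -> adic (j + k) (a * b).
Proof.
move=> [n [d [cd ->]]] [n' [d' [cd' ->]]].
exists (n * n'), (d * d'); split; first by rewrite coprimepMr cd.
by rewrite mulf_div -!tofracM exprD; congr (_%:F / _); ring.
Qed.

Lemma adicS k a : adic k.+1 a -> adic k a.
Proof.
by move=> [n [d [cd ->]]]; exists (pi * n), d; rewrite exprSr mulrA.
Qed.

Lemma adic_torsion k n a : (0 < n)%N -> adic k (a *+ n) -> adic k a.
Proof.
move=> n0 [m [d [cd e]]]; exists (n%:R^-1 *: m), d; split=> //.
have nK : (n%:R : K) != 0.
  by rewrite -(rmorph_nat (@tofrac _)) tofrac_eq0 -polyC_natr polyC_eq0 pnatr_eq0 -lt0n.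
apply: (mulfI nK); rewrite mulr_natl e mulrA -(rmorph_nat (@tofrac _)) -tofracM.
congr (_%:F / _); rewrite -mul_polyC mulrCA (mulrA n%:R) -polyC_natr -polyCM.
by rewrite mulfV ?mul1r // pnatr_eq0 -lt0n.
Qed.

Lemma adic_separated z : (forall k, adic k z) -> z = 0.
Proof.
have [[a b] /= [b0 ->]] := fraction_numden z => h.
have [->|lam0] := eqVneq a 0; first by rewrite tofrac0 mul0r.
have [n [d [cd /eqP]]] := h (size a).
have d0 := coprimep_neq0 cd.
rewrite eqr_div ?tofrac_eq0 // -!tofracM tofrac_eq => /eqP e.
have : pi ^+ size a %| a.
  rewrite -(@Gauss_dvdpl _ a d); first by rewrite e -mulrA dvdp_mulIl.
  exact: coprimep_expl.
by move=> /(dvdp_leq lam0); rewrite leqNgt size_exp_gt.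
Qed.

Definition madic (k : nat) (M : 'M[K]_2) : Prop := forall i j, adic k (M i j).

Lemma madic0 k : madic k 0.
Proof. by move=> i j; rewrite mxE; exact: adic0. Qed.

Lemma madic1 : madic 0 1.
Proof. by move=> i j; rewrite mxE; case: eqP => _; [exact: adic1|exact: adic0]. Qed.

Lemma madicD k a b : madic k a -> madic k b -> madic k (a + b).
Proof. by move=> ha hb i j; rewrite mxE; exact: adicD. Qed.

Lemma madicN k a : madic k a -> madic k (- a).
Proof. by move=> ha i j; rewrite mxE; exact: adicN. Qed.

Lemma madicM j k (a b : 'M[K]_2) : madic j a -> madic k b -> madic (j + k) (a * b).
Proof. by move=> ha hb i l; rewrite mxE big_ord2; apply: adicD; exact: adicM. Qed.

Lemma madicZ j k c (b : 'M[K]_2) : adic j c -> madic k b -> madic (j + k) (c *: b).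
Proof. by move=> hc hb i l; rewrite mxE; exact: adicM. Qed.

Lemma madicS k a : madic k.+1 a -> madic k a.
Proof. by move=> ha i j; exact: adicS. Qed.

Lemma madic_torsion k n (a : 'M[K]_2) : (0 < n)%N -> madic k (a *+ n) -> madic k a.
Proof.
move=> n0 ha i j; apply: (adic_torsion n0); move: (ha i j).
by rewrite -scaler_nat mxE mulr_natl.
Qed.

Lemma madic_separated M : (forall k, madic k M) -> M = 0.
Proof. by move=> h; apply/matrixP => i j; rewrite mxE; apply: adic_separated => k; exact: h. Qed.

Lemma madic_map (P : 'M[{poly rat}]_2) : madic 0 (map_mx (@tofrac _) P).
Proof. by move=> i j; rewrite mxE; have := adic_poly 0 (P i j); rewrite expr0 mul1r. Qed.

End AdicFiltration.

(** The matrices of the letters at [lam = 1], modulo the polynomial [pi0]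
    below, generate a finite group: x becomes the identity, y and t become
    integral matrices of order 2 and 3. The group acts through the sheets of
    the covering, and this is the matrix of a sheet. *)
Definition frame (A : pzRingType) (q : Qt) : 'M[A]_2 :=
  match q with
  | (I0, _, false) => mx2 1 0 0 1
  | (I0, _, true) => mx2 1 1 0 (-1)
  | (I1, _, false) => mx2 0 1 (-1) (-1)
  | (I1, _, true) => mx2 0 (-1) (-1) 0
  | (I2, _, false) => mx2 (-1) (-1) 1 0
  | (I2, _, true) => mx2 (-1) 0 1 1
  end.

Lemma frame_qact (A : comPzRingType) q l :
  frame A (qact q l) = frame A q *m frame A (qact q1 l).
Proof.
case: l => -[[|[|[|//]]] h] s; case: q => -[a b] e; case: s; case: a; case: e;
  by rewrite /= mx2M; congr mx2; ring.
Qed.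

Section LetterFrame.
Variables (K : fieldType) (U lam : K).
Hypothesis nz : [/\ (2%:R : K) != 0, U != 0, delta U != 0 & lam != 0].

(** A stable letter is affine in [lam], or in its inverse, so that it differs
    from its value at [lam = 1] by a multiple of [1 - lam]. *)
Lemma letter_frameE g s :
  zscal U lam (g, s) *: zmx U lam (g, s) - frame K (qact q1 (if g then gen_t else gen_y, s)) =
  (1 - lam) *: ((if s then (4%:R * U * lam)^-1 else (-1) ^+ g * (4%:R * U)^-1) *:
     (if s then rank1 (fixpt U (killed (zinv (g, s)))) (fixpt U (killed (g, s)))
      else rank1 (fixpt U (swap (killed (zinv (g, s))))) (fixpt U (swap (killed (g, s)))))).
Proof.
have [n2 nU _ nl] := nz; have n4 := nz4 nz.
apply/matrixP => i j; rewrite zmxE /zscal.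
case: g; case: s; rewrite /= /rank1 /= !mx2Z;
  case: (ord2P i) => ->; case: (ord2P j) => ->; rewrite !(mxE, mx2E) /=; field; by rewrite ?nl ?nU ?n4 ?n2.
Qed.
End LetterFrame.

Section BaseField.
Local Notation K := {fraction {poly rat}}.
Local Notation "x %:F" := (tofrac x).

(** At the roots of [pi0] the three half-turns coincide, so that x becomes the
    identity: see [invol_pair]. *)
Definition pi0 : {poly rat} := 3%:R * U0 ^+ 2 - 1.
(** This element is congruent to 1 modulo [pi0] and is not constant: so all of
    its powers are allowed values of [lam], and among them some avoid the zeros
    of a given polynomial. *)
Definition lam0 : {poly rat} := (2%:R^-1)%:P * (3%:R * (1 - U0 ^+ 2)).

Lemma lam0E : 2%:R * lam0 = 3%:R * (1 - U0 ^+ 2).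
Proof. by rewrite /lam0 mulrA -polyC_natr -polyCM mulfV // mul1r. Qed.

Lemma size_pi0 : (1 < size pi0)%N.
Proof.
rewrite ltnNge; apply/negP => /size1_polyC e.
have : pi0.[0] = pi0.[-1] by rewrite e !hornerC.
by rewrite /pi0 /U0 !hornerE.
Qed.

Lemma size_lam0 : (1 < size lam0)%N.
Proof.
rewrite ltnNge; apply/negP => /size1_polyC e.
have : lam0.[0] = lam0.[-1] by rewrite e !hornerC.
by rewrite /lam0 /U0 !hornerE.
Qed.

Lemma coprime_U0 : coprimep pi0 U0.
Proof.
apply/Bezout_coprimepP; exists (-1, 3%:R * U0); rewrite /= /pi0.
by rewrite (_ : _ + _ = 1); [rewrite eqpxx|ring].
Qed.

Lemma coprime_delta : coprimep pi0 (delta U0).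
Proof.
rewrite /delta coprimepMr; apply/andP; split; apply/Bezout_coprimepP.
  exists (1, 3%:R); rewrite /= /pi0 (_ : _ + _ = 2%:R); last by ring.
  by rewrite -size_poly_eq1 -polyC_natr size_polyC.
exists (-3%:R, -1); rewrite /= /pi0 (_ : _ + _ = 2%:R); last by ring.
by rewrite -size_poly_eq1 -polyC_natr size_polyC.
Qed.

Lemma pi0E : pi0 = 2%:R * (1 - lam0).
Proof. by rewrite mulrBr lam0E /pi0; ring. Qed.

Lemma coprime_lam0 : coprimep pi0 lam0.
Proof.
apply/Bezout_coprimepP; exists (1, 2%:R); rewrite /= pi0E (_ : _ + _ = 2%:R); last by ring.
by rewrite -size_poly_eq1 -polyC_natr size_polyC.
Qed.

Lemma coprime_nat n : (0 < n)%N -> coprimep pi0 n%:R.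
Proof.
move=> n0; apply/Bezout_coprimepP; exists (0, 1); rewrite /= mul0r add0r mul1r.
by rewrite -size_poly_eq1 -polyC_natr size_polyC pnatr_eq0 -lt0n n0.
Qed.

Variable m : nat.
Definition lamval : {poly rat} := lam0 ^+ m.
Local Notation U := U0%:F.
Local Notation lam := lamval%:F.

Lemma frame_nz : [/\ (2%:R : K) != 0, U != 0, delta U != 0 & lam != 0].
Proof.
rewrite -(map_delta (@tofrac _)) -(rmorph_nat (@tofrac _)) !tofrac_eq0.
have := coprimep_neq0 size_pi0; move=> h; split; apply: h.
- exact: coprime_nat.
- exact: coprime_U0.
- exact: coprime_delta.
- exact/coprimep_expr/coprime_lam0.
Qed.

Lemma adic_lam : adic pi0 1 (1 - lam).
Proof.
have [n e] : exists n, 1 - lamval = pi0 * n.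
  rewrite /lamval -opprB subrX1; exists ((2%:R^-1)%:P * \sum_(i < m) lam0 ^+ i).
  by rewrite pi0E mulrACA -polyC_natr -polyCM mulfV // mul1r -mulNr opprB.
by exists n, 1; rewrite coprimep1 tofrac1 divr1 -tofracB -e.
Qed.

Local Notation letter := (letter U lam).
Local Notation M k := (madic pi0 k).

Lemma invol_pair (s : bool) :
  (if s then invol U I1 *m invol U I2 else invol U I2 *m invol U I1) - (delta U)%:M =
  pi0%:F *: map_mx (@tofrac _)
     (if s then mx2 (4%:R * (1 - U0 ^+ 2)) (2%:R * (1 - U0 ^+ 2))
                    (- (2%:R * (1 - U0 ^+ 2))) (- (8%:R * U0 ^+ 2))
      else mx2 (- (8%:R * U0 ^+ 2)) (- (2%:R * (1 - U0 ^+ 2)))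
               (2%:R * (1 - U0 ^+ 2)) (4%:R * (1 - U0 ^+ 2))).
Proof.
have <- : map_mx (@tofrac _) (delta U0)%:M = (delta U)%:M :> 'M_2.
  by rewrite map_scalar_mx map_delta.
rewrite -!(map_invol (@tofrac _)) -map_mxZ.
have -> : (if s then map_mx (@tofrac _) (invol U0 I1) *m map_mx (@tofrac _) (invol U0 I2)
   else map_mx (@tofrac _) (invol U0 I2) *m map_mx (@tofrac _) (invol U0 I1)) =
   map_mx (@tofrac _) (if s then invol U0 I1 *m invol U0 I2 else invol U0 I2 *m invol U0 I1).
  by case: s; rewrite map_mxM.
rewrite -map_mxB; congr map_mx.
apply/matrixP => i j; case: s; rewrite /invol mx2M mx2_scalar mx2Z;
  case: (ord2P i) => ->; case: (ord2P j) => ->; rewrite !(mxE, mx2E) /= /delta /pi0; ring.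
Qed.

Lemma letter_frame l : M 1 (letter l - frame K (qact q1 l)).
Proof.
have [n2 nU nd nl] := frame_nz; have n4 := nz4 frame_nz.
have H0 c d : coprimep pi0 d -> adic pi0 0 (c%:F / d%:F) by exact: adic_frac.
have cz g s : letter (if g then gen_t else gen_y, s) -
   frame K (qact q1 (if g then gen_t else gen_y, s)) =
   (1 - lam) *: ((if s then (4%:R * U * lam)^-1 else (-1) ^+ g * (4%:R * U)^-1) *:
     map_mx (@tofrac _) (if s then
       rank1 (fixpt U0 (killed (zinv (g, s)))) (fixpt U0 (killed (g, s)))
       else rank1 (fixpt U0 (swap (killed (zinv (g, s))))) (fixpt U0 (swap (killed (g, s)))))).
  rewrite letter_z (letter_frameE frame_nz).
  by case: s; rewrite (map_rank1 (@tofrac _)) !(map_fixpt (@tofrac _)).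
have unit_adic d : coprimep pi0 d -> adic pi0 0 (d%:F^-1).
  by move=> cd; have := H0 1 d cd; rewrite tofrac1 mul1r.
have cU := coprime_U0; have c4 : coprimep pi0 4%:R by exact: coprime_nat.
have cl : coprimep pi0 lamval by exact/coprimep_expr/coprime_lam0.
have hz g s : M 1 (letter (if g then gen_t else gen_y, s) -
   frame K (qact q1 (if g then gen_t else gen_y, s))).
  rewrite cz; apply: (@madicZ _ 1 0); first exact: adic_lam.
  apply: (@madicZ _ 0 0); last exact: madic_map.
  have t4 : (4%:R : K) = 4%:R%:F by rewrite rmorph_nat.
  have tg : ((-1) ^+ g : K) = ((-1) ^+ g)%:F by rewrite !rmE.
  case: s; rewrite t4 -?tofracM ?tg; last by apply: H0; rewrite coprimepMr c4.
  by apply: unit_adic; rewrite !coprimepMr c4 cU.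
case: l => -[[|[|[|//]]] h] s.
- have -> : letter (Ordinal h, s) - frame K (qact q1 (Ordinal h, s)) =
    (delta U)^-1 *: (pi0%:F *: map_mx (@tofrac _)
     (if s then mx2 (4%:R * (1 - U0 ^+ 2)) (2%:R * (1 - U0 ^+ 2))
                    (- (2%:R * (1 - U0 ^+ 2))) (- (8%:R * U0 ^+ 2))
      else mx2 (- (8%:R * U0 ^+ 2)) (- (2%:R * (1 - U0 ^+ 2)))
               (2%:R * (1 - U0 ^+ 2)) (4%:R * (1 - U0 ^+ 2)))).
    rewrite -(invol_pair s) [RHS]scalerBr.
    rewrite (_ : frame K _ = 1%:M); last by rewrite (mx2_scalar 1) {hz cz}; case: (s).
    by rewrite [X in _ = _ - X]scale_scalar_mx (mulVf nd).
  apply: (@madicZ _ 0 1); last apply: (@madicZ _ 1 0); last exact: madic_map.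
    by rewrite -(map_delta (@tofrac _)); apply: unit_adic; exact: coprime_delta.
  by have := adic_poly pi0 1 1; rewrite mulr1 expr1.
- by have := hz false s; congr (M 1 (letter _ - frame K (qact q1 _))); congr pair; exact: val_inj.
- by have := hz true s; congr (M 1 (letter _ - frame K (qact q1 _))); congr pair; exact: val_inj.
Qed.

Lemma frame_adic q : M 0 (frame K q).
Proof.
have -> : frame K q = map_mx (@tofrac _) (frame _ q); last exact: madic_map.
by case: q => -[[] b] []; rewrite /frame map_mx2 !rmE.
Qed.

Lemma letter_adic l : M 0 (letter l).
Proof.
rewrite -(subrK (frame K (qact q1 l)) (letter l)); apply: madicD; first exact: size_pi0.
  by apply: (@madicS pi0 0); exact: letter_frame.
exact: frame_adic.
Qed.

Lemma wmx_adic w : M 0 (wmx U lam w).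
Proof.
elim: w => [|l w IH]; first exact: madic1.
by rewrite wmx_cons; apply: (@madicM _ size_pi0 0 0); [exact: letter_adic|].
Qed.

Lemma wmx_frame q w : M 1 (frame K q *m wmx U lam w - frame K (foldl qact q w)).
Proof.
elim: w q => [|l w IH] q; first by rewrite /wmx /= mulmx1 subrr; exact: madic0.
rewrite wmx_cons [foldl _ _ _]/=.
rewrite -[_ - _](subrKA (frame K (qact q l) *m wmx U lam w)); apply: (madicD size_pi0); last exact: IH.
rewrite mulmxA -mulmxBl; apply: (@madicM _ size_pi0 1 0); last exact: wmx_adic.
rewrite frame_qact -mulmxBr; apply: (@madicM _ size_pi0 0 1); [exact: frame_adic|exact: letter_frame].
Qed.

(** The image of [Psi] stabilises the sheet whose matrix is the identity. *)
Lemma rep_stab h : M 1 (rep U lam (Psi h) - 1).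
Proof.
have [w -> e] := Psi_stab h; rewrite (rep_cls frame_nz).
by have := wmx_frame q1 w; rewrite e /= -mx2_scalar mul1mx.
Qed.
End BaseField.
(** A power of [a] at which [E] vanishes divides the constant term of [E]. *)
Lemma horner_exp_neq0 (E : {poly {poly rat}}) (a : {poly rat}) :
  E.[0] != 0 -> (1 < size a)%N -> exists m, E.[a ^+ m] != 0.
Proof.
move=> E0 a1; exists (size E.[0]); apply: contraTneq isT => e.
have /factor_theorem[q qE] : root (E - E.[0]%:P) 0.
  by rewrite /root hornerD hornerN hornerC subrr.
have dv : a ^+ size E.[0] %| E.[0].
  have e2 : E.[0] = - (q.[a ^+ size E.[0]] * a ^+ size E.[0]).
    have := congr1 (fun p => p.[a ^+ size E.[0]]) qE.
    by rewrite hornerM hornerD hornerN hornerC e add0r hornerXsubC subr0 => <-; rewrite opprK.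
  by rewrite [X in _ %| X]e2 dvdpNr dvdp_mulIr.
by have := dvdp_leq E0 dv; rewrite leqNgt size_exp_gt.
Qed.

(** The discriminant of the characteristic polynomial. *)
Lemma dominated_disc (tau d : {poly {poly rat}}) :
  dominated tau d -> (tau ^+ 2 - 4%:R * d).[0] != 0.
Proof.
case=> [[t0 d0]|[tau0 [d0 [-> -> t0 d00]]]].
  by rewrite !hornerE d0 mulr0 subr0 mulf_neq0.
rewrite !hornerE; apply: contraNneq t0 => /(congr1 (fun p => p.[0])).
by rewrite !hornerE d00 mulr0 subr0 => /eqP; rewrite mulf_eq0 orbb.
Qed.

(** The discriminant of the trace and determinant of a nontrivial element,
    taken at a suitable power of [lam0], is nonzero, so its image is not the
    identity. The filtration by powers of [pi0] is separated, and the image is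
    not 1 at some level. *)
Theorem Gamma1_virtually_residually_nilpotent :
  virtually (residually (fun Q => torsion_free Q /\ nilpotent Q)) Gamma1.
Proof.
exists coverH, (Psi : {multiplicative coverH -> Gamma1}); split.
- exact: Psi_inj.
- exact: Psi_finite_index.
move=> h h1; have g1 : Psi h <> 1%g by move=> e; apply: h1; exact: Psi_ker.
have [tau [d [_ dom tr_det]]] := trace_det g1.
have [m Em] := horner_exp_neq0 (dominated_disc dom) size_lam0.
have nz := frame_nz m.
pose th : {rmorphism {poly {poly rat}} -> {fraction {poly rat}}} :=
  (@tofrac _ \o horner_eval (lamval m))%FUN.
have thU : th UU = tofrac U0 by rewrite /th /= /horner_eval hornerC.
have thL : th LL = tofrac (lamval m) by rewrite /th /= /horner_eval hornerX.
have := tr_det _ th; rewrite thU thL => /(_ nz)[s [s0 tE dE]].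
set phi := fun h : coverH => rep (tofrac U0) (tofrac (lamval m)) (Psi h).
have pi1 := size_pi0.
apply: (@residually_torsion_free_nilpotent 'M[{fraction {poly rat}}]_2 (madic pi0)
  (madic0 pi0) (madicD pi1) (@madicN pi0) (@madicM _ pi1) (@madicS pi0)
  (@madic_torsion pi0) (madic1 pi0) coverH phi).
- by rewrite /phi Psi1 (rep1 nz).
- by move=> g g'; rewrite /phi PsiM (repM nz).
- exact: rep_stab.
apply: contrapT => /forallNP hk; apply/negP: Em; rewrite negbK.
have /eqP : phi h - 1 = 0 by apply: (madic_separated pi1) => k; apply: contrapT; exact: hk.
rewrite subr_eq0 /phi => /eqP e1; rewrite e1 in tE dE.
have t2 : s * th tau = 2%:R by rewrite -tE mxtrace1.
have d2 : s ^+ 2 * th d = 1 by rewrite -dE det1.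
suff : th (tau ^+ 2 - 4%:R * d) == 0 by rewrite /th /= tofrac_eq0.
apply/eqP/(mulfI (expf_neq0 2 s0)).
rewrite mulr0 rmorphB rmorphXn [th (_ * d)]rmorphM rmorph_nat mulrBr -exprMn t2 mulrCA d2; ring.
Qed.

Local Close Scope ring_scope.

(** * The lower central series of Gamma1 *)

Local Open Scope group_scope.

Section LowerCentralSeries.
Implicit Types G Q : groupType.

Lemma generated_subgroup G (S : set G) : subgroup (generated S).
Proof.
split=> [K [] //|g h hg hh K sK SK|g hg K sK SK].
- by have [_ KM _] := sK; apply: KM; [exact: hg|exact: hh].
- by have [_ _ KV] := sK; apply: KV; exact: hg.
Qed.

Lemma sub_generated G (S : set G) g : S g -> generated S g.
Proof. by move=> Sg K _; apply. Qed.

Lemma lower_central_commg G n (g h : G) :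
  lower_central n g -> lower_central n.+1 [~ g, h].
Proof. by move=> hg; apply: sub_generated; exists g => //; exists h. Qed.

Lemma lower_centralJ G n (g h : G) : lower_central n g -> lower_central n (g ^ h).
Proof.
elim: n g => [//|n IH] g hg; set S := [set g | lower_central n.+1 (g ^ h)]%classic.
have [L1 LM LV] := generated_subgroup [set [~ g, h] | g in @lower_central G n & h in setT]%classic.
rewrite -[lower_central _ _]/(S g); refine (hg S _ _).
- split; rewrite /S /=; first by rewrite conj1g.
  + by move=> a b ha hb; rewrite conjMg; exact: LM.
  + by move=> a ha; rewrite conjVg; exact: LV.
- by move=> _ [a ha [b _ <-]]; rewrite /S /= conjRg; apply: lower_central_commg; exact: IH.
Qed.

Lemma lower_central_morph G Q (f : {multiplicative G -> Q}) n g :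
  lower_central n g -> lower_central n (f g).
Proof.
have f1 : f 1 = 1 by apply: (mulgI (f 1)); rewrite -gmulfM !mulg1.
have fV a : f a^-1 = (f a)^-1 by apply: (mulgI (f a)); rewrite -gmulfM !mulgV.
elim: n g => [//|n IH] g hg; set S := [set g | lower_central n.+1 (f g)]%classic.
have [L1 LM LV] := generated_subgroup [set [~ g, h] | g in @lower_central Q n & h in setT]%classic.
rewrite -[lower_central _ _]/(S g); refine (hg S _ _).
- split; rewrite /S /=; first by rewrite f1.
  + by move=> a b ha hb; rewrite gmulfM; exact: LM.
  + by move=> a ha; rewrite fV; exact: LV.
- move=> _ [a ha [b _ <-]]; rewrite /S /= /commg /conjg !gmulfM !fV.
  by apply: (@lower_central_commg Q n (f a) (f b)); exact: IH.
Qed.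

End LowerCentralSeries.

(** The generator x acts without fixed points on the sheets of the covering. *)
Lemma gx_neq1 : gx <> 1.
Proof.
move=> e; have /(qact_eqv q1) // : weqv [:: xlet false] [::].
by apply/(@cls_eq (word_preGroup Gamma1_rel)).
Qed.

(** The defining relation, conjugated by t. It puts x in every term of the
    lower central series. *)
Lemma gx_commutator : gx = [~ gx, gy] ^ gt.
Proof.
have -> : [~ gx, gy] = gt * gx * gt^-1 by rewrite Gamma1_relE /commg /conjg !mulgA.
by rewrite /conjg mulgVK mulKg.
Qed.

Lemma gx_lower_central n : lower_central n gx.
Proof.
elim: n => // n IH; rewrite gx_commutator.
by apply: lower_centralJ; exact: lower_central_commg.
Qed.

Theorem Gamma1_not_residually_nilpotent : ~ residually nilpotent Gamma1.
Proof.
move=> /(_ gx gx_neq1)[Q [f [[n nQ] _ fx]]]; apply: fx.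
exact: nQ _ (lower_central_morph f (gx_lower_central n)).
Qed.

Local Close Scope group_scope.

Theorem theorem5p4 :
  [/\ acts_freely_on_tree Z2 Gamma1,
      virtually special_group Gamma1,
      virtually (residually (fun Q => torsion_free Q /\ nilpotent Q)) Gamma1 &
      ~ residually nilpotent Gamma1].
Proof.
split.
- exact: Gamma1_free_action.
- exact: Gamma1_virtually_special.
- exact: Gamma1_virtually_residually_nilpotent.
- exact: Gamma1_not_residually_nilpotent.
Qed.
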